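(* Let $T:\widetilde{\mathcal{W}}\to\mathbb{R}$ be a bounded continuous function on the metric space $(\widetilde{\mathcal{W}},\delta_\Box)$, and for each $n\ge 1$ let $$\psi_n=\frac{1}{n^2}\log\sum_{G\in\mathcal{G}_n}e^{n^2T(\widetilde{G})}.$$ Then the limit $\psi:=\lim_{n\to\infty}\psi_n$ exists and $$\lim_{n\to\infty}\psi_n=\sup_{\widetilde{h}\in\widetilde{\mathcal{W}}}\bigl(T(\widetilde{h})-I(\widetilde{h})\bigr).$$
   Context: $\mathcal{G}_n$ is the set of all simple graphs (undirected, no loops, no multiple edges) on the vertex set $\{1,\dots,n\}$. $\mathcal{W}$ is the set of all measurable functions $h:[0,1]^2\to[0,1]$ with $h(x,y)=h(y,x)$. The cut distance on $\mathcal{W}$ is $d_\Box(f,g)=\sup_{S,A\subseteq[0,1]}\left|\int_{S\times A}[f(x,y)-g(x,y)]\,dx\,dy\right|$ (supremum over measurable sets). Let $\Sigma$ be the set of measure-preserving bijections $\sigma:[0,1]\to[0,1]$ and write $g_\sigma(x,y)=g(\sigma x,\sigma y)$. For $g\in\mathcal{W}$, $\widetilde{g}$ denotes the closure in $(\mathcal{W},d_\Box)$ of the orbit $\{g_\sigma:\sigma\in\Sigma\}$; $\widetilde{\mathcal{W}}$ is the resulting quotient space, with metric $\delta_\Box(\widetilde{f},\widetilde{g})=\inf_{\sigma\in\Sigma}d_\Box(f,g_\sigma)$. For a simple graph $G$ on $\{1,\dots,n\}$, $f^G\in\mathcal{W}$ is defined by $f^G(x,y)=1$ if $(\lceil nx\rceil,\lceil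 ny\rceil)$ is an edge of $G$ and $f^G(x,y)=0$ otherwise; $\widetilde{G}:=\widetilde{f^G}\in\widetilde{\mathcal{W}}$. For $u\in[0,1]$, $I(u)=\frac12u\log u+\frac12(1-u)\log(1-u)$ (with $0\log 0=0$), and $I(\widetilde{h})=\iint_{[0,1]^2}I(h(x,y))\,dx\,dy$ where $h$ is any representative of $\widetilde{h}$; this is known to be well defined (independent of the representative) and lower semicontinuous on $\widetilde{\mathcal{W}}$. *)

(* Defs.v *)
From HB Require Import structures.
From mathcomp Require Import all_boot all_order all_algebra lra.
From mathcomp Require Import all_classical all_reals all_analysis measurable_realfun.

Set Implicit Arguments.
Unset Strict Implicit.
Unset Printing Implicit Defensive.

Import Order.TTheory GRing.Theory Num.Theory.
Import numFieldNormedType.Exports.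

Local Open Scope classical_set_scope.
Local Open Scope ring_scope.

Definition unitI {R : realType} : set R := `[0, 1].

Definition lebesgue2 (R : realType) :
    {measure set (measurableTypeR R * measurableTypeR R) -> \bar R} :=
  (@lebesgue_measure R \x @lebesgue_measure R)%E.

(* Functions on [0,1]^2 are total functions on R * R whose values outside
   [0,1]^2 are irrelevant: no definition below looks at them. *)
Record graphon (R : realType) := Graphon {
  graphon_fun :> R * R -> R ;
  graphon_measurable : measurable_fun (unitI `*` unitI) graphon_fun ;
  graphon_sym : forall x y, unitI x -> unitI y ->
    graphon_fun (x, y) = graphon_fun (y, x) ;
  graphon_range : forall x y, unitI x -> unitI y ->
    0 <= graphon_fun (x, y) <= 1 }.

HB.instance Definition _ (R : realType) := gen_eqMixin (graphon R).
HB.instance Definition _ (R : realType) := gen_choiceMixin (graphon R).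

Definition cut_dist {R : realType} (f g : graphon R) : R :=
  sup [set r | exists S A : set R,
    [/\ measurable S, S `<=` unitI, measurable A, A `<=` unitI &
      r = `| \int[lebesgue2 R]_(p in S `*` A) (f p - g p) |]].

(* mp_image (measurability of the inverse) makes the measure-preserving
   bijections a group; for Borel bijections of [0,1] it is automatic
   (Lusin-Souslin). *)
Record mp_bij (R : realType) := MpBij {
  mp_fun :> R -> R ;
  mp_bijective : set_bij unitI unitI mp_fun ;
  mp_measurable : measurable_fun unitI mp_fun ;
  mp_image : forall B, measurable B -> B `<=` unitI ->
    measurable (mp_fun @` B) ;
  mp_preserve : forall B, measurable B -> B `<=` unitI ->
    lebesgue_measure (unitI `&` mp_fun @^-1` B) = lebesgue_measure B }.

Section cut_distance.
Context {R : realType}.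
Implicit Types (f g h : graphon R) (s t : mp_bij R).

Let mR : measurableType _ := measurableTypeR R.
Let lam := @lebesgue_measure R.
Let lam2 := lebesgue2 R.

Lemma measurable_unitI : measurable (@unitI R).
Proof. exact: measurable_itv. Qed.

Lemma measurable_unitI2 : measurable (@unitI R `*` @unitI R).
Proof. by apply: measurableX; exact: measurable_unitI. Qed.

Lemma lebesgue2E (S A : set R) : measurable S -> measurable A ->
  lam2 (S `*` A) = (lam S * lam A)%E.
Proof. by move=> mS mA; rewrite /lam2 /lebesgue2 /= product_measure1E. Qed.

Lemma lebesgue2_rect (S A : set R) : measurable S -> S `<=` unitI ->
  measurable A -> A `<=` unitI -> (lam2 (S `*` A) <= 1)%E.
Proof.
move=> mS SI mA AI; rewrite lebesgue2E//.
have -> : (1 = lam unitI * lam unitI)%E.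
  by rewrite /lam /unitI lebesgue_measure_itv /= lte01 oppr0 adde0 mul1e.
apply: lee_pmul => //.
- by apply: le_measure; rewrite ?inE//; exact: measurable_unitI.
- by apply: le_measure; rewrite ?inE//; exact: measurable_unitI.
Qed.

Section rect.
Variables S A : set R.
Hypotheses (mS : measurable S) (SI : S `<=` unitI).
Hypotheses (mA : measurable A) (AI : A `<=` unitI).

Let mSA : measurable (S `*` A : set (mR * mR)).
Proof. exact: measurableX. Qed.

Let rectI p : (S `*` A) p -> unitI p.1 /\ unitI p.2.
Proof. by case: p => x y [/= /SI ? /AI]. Qed.

Lemma graphon_integrable f : lam2.-integrable (S `*` A) (EFin \o f).
Proof.
apply: measurable_bounded_integrable => //.
- by apply: le_lt_trans (lebesgue2_rect mS SI mA AI) _; rewrite ltry.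
- apply: measurable_funS (graphon_measurable f); first exact: measurable_unitI2.
  by move=> p /rectI.
- exists 1; split => // M M1 [x y] /rectI[/= xI yI].
  have /andP[f0 f1] := graphon_range f xI yI.
  by rewrite ger0_norm// (le_trans f1)// ltW.
Qed.

Lemma graphon_sub_integrable f g :
  lam2.-integrable (S `*` A) (EFin \o (fun p => f p - g p)).
Proof.
have := integrableB mSA (graphon_integrable f) (graphon_integrable g).
by apply: eq_integrable => // p _.
Qed.

Lemma rect_subE f g : \int[lam2]_(p in S `*` A) (f p - g p) =
  \int[lam2]_(p in S `*` A) f p - \int[lam2]_(p in S `*` A) g p.
Proof. exact: (RintegralB mSA (graphon_integrable f) (graphon_integrable g)). Qed.

Lemma rect_sub_le1 f g : `| \int[lam2]_(p in S `*` A) (f p - g p) | <= 1.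
Proof.
apply: (le_trans (le_normr_Rintegral mSA (graphon_sub_integrable f g))).
have c1 : lam2.-integrable (S `*` A) (EFin \o (cst 1 : R * R -> R)).
  apply: measurable_bounded_integrable => //.
  - by apply: le_lt_trans (lebesgue2_rect mS SI mA AI) _; rewrite ltry.
  - by exists 1; split => // M M1 x _ /=; rewrite normr1 ltW.
have : \int[lam2]_(p in S `*` A) `|f p - g p| <=
       \int[lam2]_(p in S `*` A) (cst 1 p).
  apply: le_Rintegral => //.
    have := integrable_abse (graphon_sub_integrable f g).
    by apply: eq_integrable.
  move=> [x y] /rectI[/= xI yI].
  have /andP[f0 f1] := graphon_range f xI yI.
  have /andP[g0 g1] := graphon_range g xI yI.
  by rewrite ler_norml; apply/andP; split; lra.
move=> /le_trans; apply; rewrite Rintegral_cst// mul1r.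
have := lebesgue2_rect mS SI mA AI.
by case: (lam2 (S `*` A)).
Qed.

End rect.

Lemma cut_dist_ub f g (S A : set R) : measurable S -> S `<=` unitI ->
  measurable A -> A `<=` unitI ->
  `| \int[lam2]_(p in S `*` A) (f p - g p) | <= cut_dist f g.
Proof.
move=> mS SI mA AI; apply: ub_le_sup; last by exists S, A.
by exists 1 => _ [S' [A' [? ? ? ? ->]]]; exact: rect_sub_le1.
Qed.

Lemma cut_dist_le f g (c : R) : (forall S A : set R, measurable S ->
    S `<=` unitI -> measurable A -> A `<=` unitI ->
    `| \int[lam2]_(p in S `*` A) (f p - g p) | <= c) ->
  cut_dist f g <= c.
Proof.
move=> H; apply: ge_sup; last by move=> _ [S [A [? ? ? ? ->]]]; exact: H.
by eexists; exists (set0 : set R), (set0 : set R); split.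
Qed.

Lemma cut_dist_ge0 f g : 0 <= cut_dist f g.
Proof.
have := @cut_dist_ub f g set0 set0 measurable0 (@sub0set _ _)
  measurable0 (@sub0set _ _).
exact: le_trans.
Qed.

Lemma cut_dist_eq0 f g : (forall x y, unitI x -> unitI y ->
  f (x, y) = g (x, y)) -> cut_dist f g = 0.
Proof.
move=> fg; apply/eqP; rewrite eq_le cut_dist_ge0 andbT.
apply: cut_dist_le => S A mS SI mA AI.
rewrite (@eq_Rintegral _ _ _ _ _ (cst 0)).
  by rewrite Rintegral_cst ?mul0r ?normr0//; exact: measurableX.
by move=> [x y]; rewrite inE => -[/= /SI xI /AI yI]; rewrite fg// subrr.
Qed.

Lemma cut_distxx f : cut_dist f f = 0.
Proof. exact: cut_dist_eq0. Qed.

Lemma cut_dist_sym f g : cut_dist f g = cut_dist g f.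
Proof.
suff H (u v : graphon R) : cut_dist u v <= cut_dist v u by apply/eqP; rewrite eq_le !H.
apply: cut_dist_le => S A mS SI mA AI.
apply: le_trans (cut_dist_ub v u mS SI mA AI).
by rewrite !rect_subE// distrC.
Qed.

Lemma cut_dist_triangle g f h : cut_dist f h <= cut_dist f g + cut_dist g h.
Proof.
apply: cut_dist_le => S A mS SI mA AI.
apply: le_trans (lerD (cut_dist_ub f g mS SI mA AI)
  (cut_dist_ub g h mS SI mA AI)).
rewrite !rect_subE//.
exact: ler_distD.
Qed.

Let ball f (e : R) : set (graphon R) := [set g | cut_dist f g < e].

Let ent : set_system (graphon R * graphon R) := entourage_ ball.

Let nbhs f : set_system (graphon R) := nbhs_ ent f.

Let nbhsE : nbhs = nbhs_ ent. Proof. by []. Qed.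

HB.instance Definition _ := hasNbhs.Build (graphon R) nbhs.

Let ball_center f (e : R) : 0 < e -> ball f e f.
Proof. by rewrite /ball/= cut_distxx. Qed.

Let ball_sym f g (e : R) : ball f e g -> ball g e f.
Proof. by rewrite /ball/= cut_dist_sym. Qed.

Let ball_triangle f g h (e1 e2 : R) :
  ball f e1 g -> ball g e2 h -> ball f (e1 + e2) h.
Proof.
rewrite /ball/= => fg gh.
by rewrite (le_lt_trans (cut_dist_triangle g _ _))// ltrD.
Qed.

Let entE : ent = entourage_ ball. Proof. by []. Qed.

HB.instance Definition _ := @Nbhs_isPseudoMetric.Build R (graphon R)
  ent nbhsE ball ball_center ball_sym ball_triangle entE.

Lemma ball_cut_distE f (e : R) :
  pseudometric_structure.ball f e = [set g | cut_dist f g < e].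
Proof. by []. Qed.

End cut_distance.

Section mp_bij_theory.
Context {R : realType}.
Implicit Types (f g h : graphon R) (s t : mp_bij R).

Let mR : measurableType _ := measurableTypeR R.
Let lam := @lebesgue_measure R.
Let lam2 := lebesgue2 R.

Lemma mp_bijI s x : unitI x -> unitI (s x).
Proof. by case: (mp_bijective s) => + _ _; apply. Qed.

Lemma mp_bij_inj s x y : unitI x -> unitI y -> s x = s y -> x = y.
Proof. by case: (mp_bijective s) => _ + _ xI yI; apply; rewrite inE. Qed.

Lemma mp_bij_surj s y : unitI y -> exists2 x, unitI x & s x = y.
Proof. by case: (mp_bijective s) => _ _; apply. Qed.

Lemma mp_bij_preimage s (B : set R) : measurable B ->
  measurable (unitI `&` s @^-1` B).
Proof. by apply: (mp_measurable s); exact: measurable_unitI. Qed.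

Lemma mp_bij_imageK s (B : set R) : B `<=` unitI ->
  unitI `&` s @^-1` (s @` B) = B.
Proof.
move=> BI; apply/seteqP; split => [x [xI [y By sxy]]|x Bx]; last first.
  by split; [exact: BI|exists x].
by rewrite (mp_bij_inj (s := s) xI (BI _ By))// sxy.
Qed.

Lemma mp_bij_preimageK s (B : set R) : B `<=` unitI ->
  s @` (unitI `&` s @^-1` B) = B.
Proof.
move=> BI; apply/seteqP; split => [_ [x [xI Bsx] <-]//|y By].
by have [x xI sxy] := mp_bij_surj s (BI _ By); exists x => //; split=> //=; rewrite sxy.
Qed.

Lemma mp_bij_imageI s (B : set R) : B `<=` unitI -> s @` B `<=` unitI.
Proof. by move=> BI _ [x Bx <-]; apply: mp_bijI; exact: BI. Qed.

Lemma lebesgue_mp_image s (B : set R) : measurable B -> B `<=` unitI ->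
  lebesgue_measure (s @` B) = lebesgue_measure B.
Proof.
move=> mB BI; rewrite -[in RHS](mp_bij_imageK s BI) mp_preserve//.
  exact: mp_image.
exact: mp_bij_imageI.
Qed.

Definition mp_id : mp_bij R.
Proof.
refine (@MpBij R idfun _ _ _ _).
- by split => // [x y _ _ //|x xI]; exists x.
- exact: measurable_id.
- by move=> B mB _; rewrite image_id.
- by move=> B mB BI; rewrite setIC; congr lebesgue_measure; apply: setIidl.
Defined.

Definition mp_comp s t : mp_bij R.
Proof.
refine (@MpBij R (s \o t) _ _ _ _).
- split.
  + by move=> x xI /=; do 2 apply: mp_bijI.
  + move=> x y; rewrite !inE => xI yI /= sxy.
    by apply: (mp_bij_inj (s := t)) => //; apply: (mp_bij_inj (s := s)) => //;
      exact: mp_bijI.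
  + move=> z zI; have [y yI <-] := mp_bij_surj s zI.
    by have [x xI <-] := mp_bij_surj t yI; exists x.
- move=> _ B mB.
  rewrite (_ : _ `&` _ = unitI `&` t @^-1` (unitI `&` s @^-1` B)).
    by do 2 apply: mp_bij_preimage.
  by apply/seteqP; split => x /= [xI]; [split => //; split => //; exact: mp_bijI
    |case].
- move=> B mB BI; rewrite -image_comp; apply: mp_image; first exact: mp_image.
  exact: mp_bij_imageI.
- move=> B mB BI.
  rewrite (_ : _ `&` _ = unitI `&` t @^-1` (unitI `&` s @^-1` B)); last first.
    by apply/seteqP; split => x /= [xI]; [split => //; split => //; exact: mp_bijI
      |case].
  by rewrite !mp_preserve//; exact: mp_bij_preimage.
Defined.

Let inv s := 'pinv_(fun=> 0) unitI s.

Let invK s x : unitI x -> inv s (s x) = x.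
Proof. by move=> xI; apply: pinvKV; [case: (mp_bijective s)|rewrite inE]. Qed.

Let Kinv s y : unitI y -> s (inv s y) = y.
Proof. by move=> /(mp_bij_surj s)[x xI <-]; rewrite invK. Qed.

Let invI s y : unitI y -> unitI (inv s y).
Proof. by move=> /(mp_bij_surj s)[x xI <-]; rewrite invK. Qed.

Let inv_preimage s B : unitI `&` inv s @^-1` B = s @` (unitI `&` B).
Proof.
apply/seteqP; split => [x [xI Btx]|_ [x [xI Bx] <-]].
  by exists (inv s x); [split => //; exact: invI|exact: Kinv].
by split; [exact: mp_bijI|rewrite /= invK].
Qed.

Let inv_image s B : B `<=` unitI -> inv s @` B = unitI `&` s @^-1` B.
Proof.
move=> BI; apply/seteqP; split => [_ [x Bx <-]|x [xI Bsx]].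
  by split; [apply: invI; exact: BI|rewrite /= Kinv//; exact: BI].
by exists (s x) => //; rewrite invK.
Qed.

Definition mp_inv s : mp_bij R.
Proof.
refine (@MpBij R (inv s) _ _ _ _).
- split.
  + exact: invI.
  + move=> x y; rewrite !inE => xI yI txy.
    by rewrite -(Kinv s xI) -(Kinv s yI) txy.
  + by move=> x xI; exists (s x); [exact: mp_bijI|exact: invK].
- move=> _ B mB; rewrite inv_preimage; apply: mp_image; last exact: subIsetl.
  by apply: measurableI => //; exact: measurable_unitI.
- by move=> B mB BI; rewrite inv_image//; exact: mp_bij_preimage.
- move=> B mB BI; rewrite inv_preimage lebesgue_mp_image//.
  + by congr lebesgue_measure; rewrite setIC; apply: setIidl.
  + by apply: measurableI => //; exact: measurable_unitI.
Defined.

Lemma mp_invK s x : unitI x -> mp_inv s (s x) = x.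
Proof. exact: invK. Qed.

Lemma mp_Kinv s x : unitI x -> s (mp_inv s x) = x.
Proof. by move=> /(mp_bij_surj s)[y yI <-]; rewrite mp_invK. Qed.

End mp_bij_theory.

Section graphon_action.
Context {R : realType}.
Implicit Types (f g h : graphon R) (s t : mp_bij R).

Let mR : measurableType _ := measurableTypeR R.
Let lam := @lebesgue_measure R.
Let lam2 := lebesgue2 R.

(* s extended by the identity outside [0,1] *)
Let ext s (x : mR) : mR := if x \in unitI then s x else x.

Let ext_preimage s (B : set R) : ext s @^-1` B =
  (unitI `&` s @^-1` (unitI `&` B)) `|` (B `\` unitI).
Proof.
apply/seteqP; split => x /=; rewrite /ext.
  case: ifPn => [|/negP]; rewrite inE => xI Bx; last by right.
  by left; split => //; split => //; exact: mp_bijI.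
case=> [[xI [_ Bx]]|[Bx xI]]; first by rewrite mem_set.
by rewrite memNset.
Qed.

Let ext_measurable s : measurable_fun [set: mR] (ext s).
Proof.
move=> _ B mB; rewrite setTI ext_preimage; apply: measurableU.
  apply: mp_bij_preimage; apply: measurableI => //; exact: measurable_unitI.
by apply: measurableD => //; exact: measurable_unitI.
Qed.

Let ext_preserve s (B : set mR) : measurable B ->
  lam (ext s @^-1` B) = lam B.
Proof.
move=> mB; have mIB : measurable (unitI `&` B : set R).
  by apply: measurableI => //; exact: measurable_unitI.
rewrite ext_preimage.
transitivity (lam (unitI `&` s @^-1` (unitI `&` B)) + lam (B `\` unitI))%E.
  apply: measureU.
  - exact: mp_bij_preimage.
  - by apply: measurableD => //; exact: measurable_unitI.
  - by rewrite -subset0 => x [[xI _] [_]].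
have -> : lam (unitI `&` s @^-1` (unitI `&` B)) = lam (unitI `&` B).
  by apply: mp_preserve => //; exact: subIsetl.
rewrite addeC setIC; apply/esym; apply: measureDI => //.
exact: measurable_unitI.
Qed.

Let ext2 s (p : mR * mR) : mR * mR := (ext s p.1, ext s p.2).

Let ext2_measurable s : measurable_fun [set: mR * mR] (ext2 s).
Proof.
by apply: measurable_fun_pair; apply: measurableT_comp (ext_measurable s) _.
Qed.

Let ext2_preserve s (B : set (mR * mR)) : measurable B ->
  pushforward lam2 (ext2 s) B = lam2 B.
Proof.
move=> mB; apply/esym.
pose m := measure_function_pushforward__canonical__measure_function_Measure
  lam2 (ext2_measurable s).
apply: (product_measure_unique (m' := m)) => // A C mA mC.
rewrite /m /= /pushforward.
rewrite (_ : _ @^-1` _ = (ext s @^-1` A) `*` (ext s @^-1` C))//.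
rewrite lebesgue2E.
- by congr (_ * _)%E; exact: ext_preserve.
- by rewrite -[X in measurable X]setTI; exact: ext_measurable.
- by rewrite -[X in measurable X]setTI; exact: ext_measurable.
Qed.

Definition act_fun (g : R * R -> R) s (p : R * R) : R := g (s p.1, s p.2).

Definition graphon_act g s : graphon R.
Proof.
refine (@Graphon R (act_fun g s) _ _ _).
- pose h := (g \_ (unitI `*` unitI)) \o ext2 s.
  apply: (@eq_measurable_fun _ _ _ _ _ h).
    move=> [x y]; rewrite inE => -[/= xI yI].
    rewrite /h /act_fun /= /ext2 /ext /= !mem_set// patchE ifT//.
    by rewrite inE; split; exact: mp_bijI.
  apply: measurable_funTS; apply: measurableT_comp (ext2_measurable s).
  apply/(measurable_restrictT _ _).1; first exact: measurable_unitI2.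
  exact: graphon_measurable.
- by move=> x y xI yI; apply: graphon_sym; exact: mp_bijI.
- by move=> x y xI yI; apply: graphon_range; exact: mp_bijI.
Defined.

Lemma rect_act f g s (S A : set R) : measurable S -> S `<=` unitI ->
  measurable A -> A `<=` unitI ->
  \int[lam2]_(p in S `*` A) (graphon_act f s p - graphon_act g s p) =
  \int[lam2]_(p in (s @` S) `*` (s @` A)) (f p - g p).
Proof.
move=> mS SI mA AI.
have mSA : measurable (S `*` A : set (mR * mR)) by exact: measurableX.
have mD : measurable ((s @` S) `*` (s @` A) : set (mR * mR)).
  by apply: measurableX; exact: mp_image.
pose h : mR * mR -> R := (fun p => f p - g p) \_ (unitI `*` unitI).
have mh : measurable_fun [set: mR * mR] h.
  apply/(measurable_restrictT _ _).1; first exact: measurable_unitI2.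
  apply: measurable_funB; exact: graphon_measurable.
have preD : ext2 s @^-1` ((s @` S) `*` (s @` A)) = S `*` A.
  have extP B x : B `<=` unitI -> (s @` B) (ext s x) <-> B x.
    move=> BI; rewrite /ext; case: ifPn => [|/negP]; rewrite inE => xI.
      by rewrite -[in X in _ <-> X](mp_bij_imageK s BI); split => [|[]].
    by split => [/(mp_bij_imageI BI)//|/BI].
  by apply/seteqP; split => -[x y] [] /extP-/(_ SI)? /extP-/(_ AI)?.
have hE p : (S `*` A) p -> h (ext2 s p) = graphon_act f s p - graphon_act g s p.
  case: p => x y [/= /SI xI /AI yI].
  rewrite /h /ext2 /ext /= !mem_set// patchE ifT//.
  by rewrite inE; split; exact: mp_bijI.
transitivity (\int[lam2]_(p in S `*` A) h (ext2 s p)).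
  by apply: eq_Rintegral => p; rewrite inE => /hE ->.
transitivity (\int[lam2]_(p in (s @` S) `*` (s @` A)) h p); last first.
  apply: eq_Rintegral => -[x y]; rewrite inE => -[/= sx sy].
  by rewrite /h patchE ifT// inE; split; exact: mp_bij_imageI sx || exact: mp_bij_imageI sy.
congr fine.
pose m := measure_function_pushforward__canonical__measure_function_Measure
  lam2 (ext2_measurable s).
transitivity (\int[m]_(p in (s @` S) `*` (s @` A)) (h p)%:E)%E; last first.
  by apply: eq_measure_integral => B mB _; exact: ext2_preserve.
apply/esym; rewrite -preD.
apply: (@integral_pushforward _ _ _ _ _ _ (ext2_measurable s) lam2 _ (EFin \o h)) => //.
  exact/measurable_EFinP.
rewrite preD.
have := graphon_sub_integrable mS SI mA AI (graphon_act f s) (graphon_act g s).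
by apply: eq_integrable => // p; rewrite inE => /hE /= ->.
Qed.

Lemma cut_dist_act f g s :
  cut_dist (graphon_act f s) (graphon_act g s) = cut_dist f g.
Proof.
apply/eqP; rewrite eq_le; apply/andP; split; apply: cut_dist_le => S A mS SI mA AI.
  rewrite rect_act//; apply: cut_dist_ub.
  - exact: mp_image.
  - exact: mp_bij_imageI.
  - exact: mp_image.
  - exact: mp_bij_imageI.
rewrite -(mp_bij_preimageK s SI) -(mp_bij_preimageK s AI) -rect_act//.
- by apply: cut_dist_ub => //; exact: mp_bij_preimage.
- exact: mp_bij_preimage.
- exact: mp_bij_preimage.
Qed.

End graphon_action.

Section cut_distance_act.
Context {R : realType}.
Implicit Types (f g h : graphon R) (s t : mp_bij R).

Lemma cut_dist_congr f f' g : (forall x y, unitI x -> unitI y ->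
  f (x, y) = f' (x, y)) -> cut_dist f g = cut_dist f' g.
Proof.
move=> ff'; apply/eqP; rewrite eq_le; apply/andP; split.
  by have := cut_dist_triangle f' f g; rewrite (cut_dist_eq0 ff') add0r.
have := cut_dist_triangle f f' g; rewrite (@cut_dist_eq0 _ f' f) ?add0r//.
by move=> x y xI yI; rewrite ff'.
Qed.

Definition orbit_dist f g : R :=
  inf [set cut_dist f (graphon_act g s) | s in [set: mp_bij R]].

Lemma orbit_dist_le f g s : orbit_dist f g <= cut_dist f (graphon_act g s).
Proof.
apply: ge_inf; last by exists s.
by exists 0 => _ [t _ <-]; exact: cut_dist_ge0.
Qed.

Lemma orbit_dist_ge f g (c : R) :
  (forall s, c <= cut_dist f (graphon_act g s)) -> c <= orbit_dist f g.
Proof.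
move=> H; apply: lb_le_inf; last by move=> _ [s _ <-].
by exists (cut_dist f (graphon_act g mp_id)), mp_id.
Qed.

Lemma orbit_dist_ge0 f g : 0 <= orbit_dist f g.
Proof. by apply: orbit_dist_ge => s; exact: cut_dist_ge0. Qed.

Lemma orbit_distP f g (c : R) : orbit_dist f g < c <->
  exists s, cut_dist f (graphon_act g s) < c.
Proof.
split=> [|[s]]; last exact: le_lt_trans (orbit_dist_le f g s).
move=> fgc; apply: contrapT => /forallNP H.
have : c <= orbit_dist f g by apply: orbit_dist_ge => s; rewrite leNgt; exact/negP.
by rewrite leNgt fgc.
Qed.

Lemma orbit_dist_le_cut_dist f g : orbit_dist f g <= cut_dist f g.
Proof.
apply: le_trans (orbit_dist_le f g mp_id) _.
by rewrite cut_dist_sym (@cut_dist_congr _ g) ?(cut_dist_sym g)//.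
Qed.

Lemma orbit_distxx f : orbit_dist f f = 0.
Proof.
apply/eqP; rewrite eq_le orbit_dist_ge0 andbT -(cut_distxx f).
exact: orbit_dist_le_cut_dist.
Qed.

Lemma orbit_dist_sym f g : orbit_dist f g = orbit_dist g f.
Proof.
suff H (u v : graphon R) : orbit_dist u v <= orbit_dist v u.
  by apply/eqP; rewrite eq_le !H.
apply: orbit_dist_ge => s; apply: le_trans (orbit_dist_le u v (mp_inv s)) _.
rewrite cut_dist_sym -(cut_dist_act _ _ s) (@cut_dist_congr _ v)//.
by move=> x y xI yI; change (v (mp_inv s (s x), mp_inv s (s y)) = v (x, y));
  rewrite !mp_invK.
Qed.

Lemma orbit_dist_triangle g f h :
  orbit_dist f h <= orbit_dist f g + orbit_dist g h.
Proof.
rewrite -lerBlDr; apply: orbit_dist_ge => s; rewrite lerBlDr -lerBlDl.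
apply: orbit_dist_ge => t; rewrite lerBlDl.
apply: le_trans (orbit_dist_le f h (mp_comp t s)) _.
apply: le_trans (cut_dist_triangle (graphon_act g s) _ _) _.
rewrite lerD2l -(cut_dist_act g _ s) cut_dist_sym
  (@cut_dist_congr _ (graphon_act (graphon_act h t) s))//.
by rewrite cut_dist_sym.
Qed.

End cut_distance_act.

Section graphon_quotient.
Context {R : realType}.
Implicit Types (f g h : graphon R) (s t : mp_bij R).

Definition graphon_orbit g : set (graphon R) := range (graphon_act g).

Definition orbit_closure g : set (graphon R) := closure (graphon_orbit g).

Lemma orbit_closureP f g : orbit_closure g f <-> orbit_dist f g = 0.
Proof.
split=> [clgf|fg0].
  apply/eqP; rewrite eq_le orbit_dist_ge0 andbT.
  apply/ler_addgt0Pl => e e0; rewrite addr0.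
  have [_ [[s _ <-]]] := clgf _ (nbhsx_ballx f e e0).
  rewrite ball_cut_distE => /ltW; exact/le_trans/orbit_dist_le.
move=> B /nbhs_ballP[e /= e0 feB].
have /orbit_distP[s fgs] : orbit_dist f g < e by rewrite fg0.
by exists (graphon_act g s); split; [exists s|exact: feB].
Qed.

Lemma orbit_closure_eqP f g : orbit_closure f = orbit_closure g <->
  orbit_dist f g = 0.
Proof.
split=> [fg|fg0].
  by apply/orbit_closureP; rewrite -fg; apply/orbit_closureP; exact: orbit_distxx.
apply/seteqP; split => h /orbit_closureP h0; apply/orbit_closureP; apply/eqP;
  rewrite eq_le orbit_dist_ge0 andbT.
  by apply: le_trans (orbit_dist_triangle f _ _) _; rewrite h0 fg0 addr0.
apply: le_trans (orbit_dist_triangle g _ _) _.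
by rewrite h0 orbit_dist_sym fg0 addr0.
Qed.

End graphon_quotient.

(* The quotient space: its points are the closures of the orbits. *)
Definition qgraphon (R : realType) : Type :=
  {A : set (graphon R) | exists g, A = orbit_closure g}.

HB.instance Definition _ (R : realType) := gen_eqMixin (qgraphon R).
HB.instance Definition _ (R : realType) := gen_choiceMixin (qgraphon R).

Definition graphon_class {R : realType} (g : graphon R) : qgraphon R :=
  exist _ (orbit_closure g) (ex_intro _ g erefl).

Definition graphon_repr {R : realType} (a : qgraphon R) : graphon R :=
  sval (cid (svalP a)).

Section qgraphon_metric.
Context {R : realType}.
Implicit Types (f g : graphon R) (a b c : qgraphon R).

Lemma graphon_classP f g : graphon_class f = graphon_class g <->
  orbit_dist f g = 0.
Proof.
rewrite -orbit_closure_eqP; split=> [/(congr1 sval)//|fg].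
by rewrite /graphon_class; apply: eq_exist.
Qed.

Lemma graphon_reprK a : graphon_class (graphon_repr a) = a.
Proof.
case: a => A Ag; rewrite /graphon_repr; case: cid => /= g Eg.
by rewrite /graphon_class; apply: eq_exist; rewrite -Eg.
Qed.

(* By cut_metricE below, any representatives may be used here. *)
Definition cut_metric a b : R := orbit_dist (graphon_repr a) (graphon_repr b).

Lemma cut_metricE f g :
  cut_metric (graphon_class f) (graphon_class g) = orbit_dist f g.
Proof.
rewrite /cut_metric.
set f' := graphon_repr _; set g' := graphon_repr _.
have f0 : orbit_dist f' f = 0 by apply/graphon_classP; exact: graphon_reprK.
have g0 : orbit_dist g' g = 0 by apply/graphon_classP; exact: graphon_reprK.
apply/eqP; rewrite eq_le; apply/andP; split.
  apply: le_trans (orbit_dist_triangle f _ _) _; rewrite f0 add0r.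
  apply: le_trans (orbit_dist_triangle g _ _) _.
  by rewrite (orbit_dist_sym g) g0 addr0.
apply: le_trans (orbit_dist_triangle f' _ _) _.
rewrite (orbit_dist_sym f) f0 add0r.
by apply: le_trans (orbit_dist_triangle g' _ _) _; rewrite g0 addr0.
Qed.

Let cut_metricxx a : cut_metric a a = 0.
Proof. exact: orbit_distxx. Qed.

Let cut_metric_positivity a b : cut_metric a b = 0 -> a = b.
Proof. by move=> /graphon_classP; rewrite !graphon_reprK. Qed.

Let cut_metric_sym a b : cut_metric a b = cut_metric b a.
Proof. exact: orbit_dist_sym. Qed.

Let cut_metric_triangle b a c : cut_metric a c <= cut_metric a b + cut_metric b c.
Proof. exact: orbit_dist_triangle. Qed.

HB.instance Definition _ := isMetric.Build R (qgraphon R)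
  cut_metricxx cut_metric_positivity cut_metric_sym cut_metric_triangle.

Lemma mdist_qgraphonE a b : mdist a b = cut_metric a b.
Proof. by []. Qed.

End qgraphon_metric.

(* A simple graph on 'I_n given by its edges; the vertex i : 'I_n is the
   vertex i.+1 of {1, ..., n}. *)
Definition sgraph (n : nat) : finType :=
  {E : {set {set 'I_n}} | [forall e in E, #|e| == 2%N]}.

Definition adjacent (n : nat) (G : sgraph n) (i j : 'I_n) : bool :=
  [set i; j]%SET \in val G.

Lemma adjacentC (n : nat) (G : sgraph n) (i j : 'I_n) :
  adjacent G i j = adjacent G j i.
Proof. by rewrite /adjacent finset.setUC. Qed.

Lemma adjacentxx (n : nat) (G : sgraph n) (i : 'I_n) : adjacent G i i = false.
Proof.
apply/negbTE/negP => Gii; have /forallP/(_ [set i; i]%SET) := valP G.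
by move: Gii; rewrite /adjacent => ->; rewrite finset.setUid cards1.
Qed.

Section graph_graphon.
Context {R : realType} (n : nat) (G : sgraph n).

Let cell (i : 'I_n) : set R := [set x | Num.ceil (n%:R * x) = (i.+1)%:Z].

Definition graph_fun (p : R * R) : R :=
  [exists i : 'I_n, exists j : 'I_n,
    [&& Num.ceil (n%:R * p.1) == (i.+1)%:Z,
        Num.ceil (n%:R * p.2) == (j.+1)%:Z & adjacent G i j]]%:R.

Let measurable_cell i : measurable (cell i).
Proof.
have mn : measurable_fun [set: R] (fun x : R => n%:R * x).
  exact: measurable_funM.
rewrite (_ : cell i = [set: R] `&`
    (fun x : R => n%:R * x) @^-1` `](i.+1%:Z - 1)%:~R, (i.+1%:Z)%:~R]).
  by apply: mn => //; exact: measurable_itv.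
rewrite setTI; apply/seteqP; split => x; rewrite /cell /= in_itv /= -ceil_eq.
  by move=> ->.
by move=> /eqP.
Qed.

Definition graph_graphon : graphon R.
Proof.
refine (@Graphon R graph_fun _ _ _).
- pose D : set (R * R) :=
    \bigcup_(ij in [set ij : 'I_n * 'I_n | adjacent G ij.1 ij.2])
      (cell ij.1 `*` cell ij.2).
  have mD : measurable D.
    apply: fin_bigcup_measurable; first exact: finite_finset.
    by move=> ij _; apply: measurableX; exact: measurable_cell.
  apply: (@eq_measurable_fun _ _ _ _ _ (\1_D : R * R -> R)); last first.
    by apply: measurable_funTS; exact: measurable_indic.
  move=> p _; rewrite indicE /graph_fun; congr (_%:R : R); congr nat_of_bool.
  apply/idP/idP => [|/existsP[i /existsP[j /and3P[/eqP ip /eqP jp Gij]]]].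
    rewrite inE => -[[i j] /= Gij [/= ip jp]].
    by apply/existsP; exists i; apply/existsP; exists j; rewrite ip jp !eqxx.
  by rewrite inE; exists (i, j).
- move=> x y _ _; rewrite /graph_fun /=; congr (_%:R : R); congr nat_of_bool.
  by apply/existsP/existsP => -[i /existsP[j /and3P[xi yj Gij]]];
    exists j; apply/existsP; exists i; rewrite xi yj adjacentC.
- by move=> x y _ _; rewrite /graph_fun ler0n lern1 leq_b1.
Defined.

End graph_graphon.

(* ln 0 = 0 in the library, so 0 log 0 = 0 *)
Definition entropy {R : realType} (u : R) : R :=
  2^-1 * u * ln u + 2^-1 * (1 - u) * ln (1 - u).

Definition graphon_rate {R : realType} (h : graphon R) : R :=
  \int[lebesgue2 R]_(p in unitI `*` unitI) entropy (h p).

(* I does not depend on the representative (Chatterjee-Varadhan), so a chosen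
   one is used. *)
Definition rate {R : realType} (a : qgraphon R) : R :=
  graphon_rate (graphon_repr a).

Definition psi {R : realType} (T : qgraphon R -> R) (n : nat) : R :=
  (n%:R ^+ 2)^-1 *
  ln (\sum_(G : sgraph n) expR (n%:R ^+ 2 * T (graphon_class (graph_graphon G)))).

(* Main.v *)
Require Import Defs.
From mathcomp Require Import all_boot all_order all_algebra fingroup perm.
From mathcomp Require Import all_classical all_reals all_analysis measurable_realfun.
From mathcomp Require Import ring lra zify.

Set Implicit Arguments.
Unset Strict Implicit.
Unset Printing Implicit Defensive.

Import Order.TTheory GRing.Theory Num.Theory.
Import numFieldNormedType.Exports.

Local Open Scope classical_set_scope.
Local Open Scope ring_scope.

(** Write N for the number of vertices. The partition function, the sum over
    graphs G of exp (N ^ 2 * T (G)), is estimated from both sides.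

    Lower bound (psi_lower). Given a graphon h, approximate it in L1 by a step
    graphon on the grid of mesh 1 / N (step_graphon_dense) and draw the edges
    independently with these probabilities. A Chernoff bound for each of the 4 ^ N
    rectangles shows that this random graph is close to h in the cut distance
    outside an event of vanishing probability (bad_graphs_prob), so that T of it
    is close to T (h) on average; its entropy is - N ^ 2 * I up to lower order
    terms (sum_graph_prob_ln). The Gibbs inequality (gibbs_le_lnsum) says that the
    logarithm of the partition function is at least N ^ 2 times the mean of T
    plus the entropy.

    Upper bound (psi_upper). A graph is close in the cut distance to its block
    densities w for some partition of its vertices into k classes, where k depends
    only on the precision (weak_regularity). There are at most k ^ N partitions
    and polynomially many block counts, which is subexponential in N ^ 2, and at
    most exp (- N ^ 2 * I (w)) graphs have given block densities w, because a graph
    has probability at least exp (N ^ 2 * I (w)) under independent edges with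
    probabilities w (graph_prob_block_weights). Hence psi is at most
    T (G) - I (w) + o(1) for some G and w that are close to each other
    (psi_le_block). As the precision improves, these pairs have a limit point h,
    T (G) tends to T (h) and I (h) is at most the lower limit of I (w), so
    T (h) - I (h) is at least the upper limit of psi.

    The limit point exists because the finite graphs form a relatively compact
    set in the space of classes. Total boundedness (graph_net): sort the vertices by
    class, which is a measure-preserving rearrangement of [0,1] (relabel_bij);
    a monotone colouring by k colours is well approximated on a grid whose size
    depends only on k and the precision. Completeness and semicontinuity come together (cut_limit):
    the graphons near the n-th term of a fast cut-Cauchy sequence whose rate is at
    most c form nested sets closed under midpoints, since cut balls and the
    sublevel sets of I are convex; elements of nearly minimal L2 norm converge in
    L1 by the parallelogram law, and I is continuous for the L1 distance. The
    same lemma shows that I depends on the class only (rate_graphon_class). *)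

(** * The entropy function *)

Section entropy_function.
Context {R : realType}.
Implicit Types a b u v t : R.

Lemma entropy0 : entropy (0 : R) = 0.
Proof. by rewrite /entropy subr0 ln1 !mulr0 mul0r addr0. Qed.

Lemma ln_le_sub1 u : 0 < u -> ln u <= u - 1.
Proof. by move=> u0; rewrite -[in ln u](subrKC 1 u) le_ln1Dx//; lra. Qed.

(** The non-negativity of relative entropy, one outcome at a time. *)
Lemma xlnx_tangent u v : 0 <= u -> 0 < v -> u * ln v + u - v <= u * ln u.
Proof.
move=> + v0; rewrite le_eqVlt => /predU1P[<-|u0]; first by rewrite !mul0r; lra.
have := ln_le_sub1 (divr_gt0 v0 u0); rewrite ln_div ?posrE// => H.
have : u * (ln v - ln u) <= u * (v / u - 1) by rewrite ler_wpM2l// ltW.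
rewrite !mulrBr mulrCA divff ?gt_eqF// !mulr1 => ?; lra.
Qed.

Lemma entropy_le0 u : 0 <= u <= 1 -> entropy u <= 0.
Proof.
move=> /andP[u0 u1]; rewrite /entropy -!mulrA.
have : u * ln u <= 0 by rewrite mulr_ge0_le0// ln_le0.
have : (1 - u) * ln (1 - u) <= 0.
  by rewrite mulr_ge0_le0 ?subr_ge0// ln_le0//; lra.
lra.
Qed.

Lemma entropy_geN1 u : 0 <= u <= 1 -> -1 <= entropy u.
Proof.
move=> /andP[u0 u1]; rewrite /entropy -!mulrA.
have := @xlnx_tangent u 1 u0 ltr01; rewrite ln1.
have : 0 <= 1 - u by lra.
move=> /xlnx_tangent/(_ ltr01); rewrite ln1; lra.
Qed.

Lemma xlnx_midconvex u v : 0 <= u -> 0 <= v ->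
  ((u + v) / 2) * ln ((u + v) / 2) <= (u * ln u + v * ln v) / 2.
Proof.
move=> u0 v0; have [/eqP|uv] := eqVneq ((u + v) / 2) 0.
  rewrite mulf_eq0 invr_eq0 pnatr_eq0 orbF paddr_eq0// => /andP[/eqP-> /eqP->].
  by rewrite addr0 !mul0r addr0 mul0r.
have w0 : 0 < (u + v) / 2 by rewrite lt0r uv/= divr_ge0// addr_ge0.
have := xlnx_tangent u0 w0; have := xlnx_tangent v0 w0.
set w := _ / 2 in w0 uv *; set l := ln w.
have -> : w * l = (u * l + v * l) / 2 by rewrite /w; lra.
rewrite /w; lra.
Qed.

Lemma entropy_midconvex u v : 0 <= u <= 1 -> 0 <= v <= 1 ->
  entropy ((u + v) / 2) <= (entropy u + entropy v) / 2.
Proof.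
move=> /andP[u0 u1] /andP[v0 v1]; rewrite /entropy -!mulrA.
have := xlnx_midconvex u0 v0.
have u1' : 0 <= 1 - u by lra.
have v1' : 0 <= 1 - v by lra.
have := xlnx_midconvex u1' v1'.
have -> : (1 - u + (1 - v)) / 2 = 1 - (u + v) / 2 by lra.
lra.
Qed.

(** Downwards the function x ln x drops by at most - t ln t, where t = b - a,
    and this is bounded by its tangent at t = eta; upwards it grows by at most t.
    A bound that is affine in b - a can be integrated. *)
Lemma xlnx_modulus (eta : R) a b : 0 < eta <= 1 -> 0 <= a -> a <= b -> b <= 1 ->
  `| a * ln a - b * ln b | <= eta + (b - a) * (1 - ln eta).
Proof.
move=> /andP[e0 e1] a0 ab b1.
have le0 : ln eta <= 0 by exact: ln_le0.
have [->|/eqP bNa] := eqVneq b a; first by rewrite !subrr normr0 mul0r addr0 ltW.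
have altb : a < b by rewrite lt_neqAle ab andbT; apply/eqP => /esym.
have b0 : 0 < b by lra.
have t0 : 0 < b - a by lra.
have lb0 : ln b <= 0 by exact: ln_le0.
have H1 : b * ln b - a * ln a <= b - a.
  have := xlnx_tangent a0 b0.
  have : (b - a) * ln b <= 0 by rewrite mulr_ge0_le0// ltW.
  rewrite mulrBl; lra.
have H2 : a * ln a - b * ln b <= - ((b - a) * ln (b - a)).
  have -> : b * ln b = a * ln b + (b - a) * ln b by lra.
  have : (b - a) * ln (b - a) <= (b - a) * ln b.
    by apply: ler_wpM2l; [exact: ltW|rewrite ler_ln ?posrE//; lra].
  have : a * ln a <= a * ln b.
    have [->|aN0] := eqVneq a 0; first by rewrite !mul0r.
    have a0' : 0 < a by rewrite lt0r aN0.
    by apply: ler_wpM2l => //; rewrite ler_ln ?posrE.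
  lra.
have H3 := xlnx_tangent (ltW t0) e0.
have H4 : 0 <= (b - a) * - ln eta by rewrite mulr_ge0 ?oppr_ge0// ltW.
have H5 : (b - a) * (1 - ln eta) = (b - a) - (b - a) * ln eta.
  by rewrite mulrBr mulr1.
rewrite H5 ler_norml; apply/andP; split; lra.
Qed.

Lemma entropy_modulus (eta : R) a b : 0 < eta <= 1 ->
  0 <= a <= 1 -> 0 <= b <= 1 ->
  `| entropy a - entropy b | <= eta + (1 - ln eta) * `| a - b |.
Proof.
move=> e01; wlog ab : a b / a <= b => [H a01 b01|].
  have [/H|/ltW/H] := leP a b; first exact.
  by rewrite distrC (distrC b a); exact.
move=> /andP[a0 a1] /andP[b0 b1].
have := xlnx_modulus e01 a0 ab b1.
have b1' : 0 <= 1 - b by lra.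
have ab' : 1 - b <= 1 - a by lra.
have a1' : 1 - a <= 1 by lra.
have := xlnx_modulus e01 b1' ab' a1'.
have -> : 1 - a - (1 - b) = b - a by lra.
rewrite (distrC a b) (@ger0_norm _ (b - a)) ?subr_ge0// => H1 H2.
rewrite /entropy -!mulrA.
set x := a * ln a in H2 *; set y := b * ln b in H2 *.
set z := (1 - b) * _ in H1 *; set w := (1 - a) * _ in H1 *.
have -> : 2^-1 * x + 2^-1 * w - (2^-1 * y + 2^-1 * z) =
  2^-1 * (x - y) - 2^-1 * (z - w) by lra.
apply: (le_trans (ler_normB _ _)); rewrite !normrM (@ger0_norm _ 2^-1); lra.
Qed.

Lemma measurable_entropy : measurable_fun [set: R] (@entropy R).
Proof.
apply: measurable_funD; apply: measurable_funM.
- exact: measurable_funM.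
- exact: measurable_ln.
- by apply: measurable_funM => //; exact: measurable_funB.
- by apply: measurableT_comp (@measurable_ln R) _; exact: measurable_funB.
Qed.

End entropy_function.

(** * Bounded measurable functions on the unit square *)

Section unit_square.
Context {R : realType}.
Implicit Types (f g h : graphon R) (phi chi : R * R -> R) (S A N : set R).

Definition square : set (R * R) := unitI `*` unitI.

Definition bounded_measurable phi :=
  measurable_fun square phi /\
  exists M, forall p, square p -> `|phi p| <= M.

Definition mean phi : R := \int[lebesgue2 R]_(p in square) phi p.

Lemma measurable_square : measurable square.
Proof. exact: measurable_unitI2. Qed.
Hint Resolve measurable_square : core.

Lemma lebesgue_unitI : lebesgue_measure (@unitI R) = 1%E.
Proof. by rewrite /unitI lebesgue_measure_itv /= lte01 oppr0 adde0. Qed.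

Lemma lebesgue2_square : lebesgue2 R square = 1%E.
Proof.
rewrite /square lebesgue2E ?lebesgue_unitI ?mule1//; exact: measurable_unitI.
Qed.

Lemma bm_integrable phi : bounded_measurable phi ->
  (lebesgue2 R).-integrable square (EFin \o phi).
Proof.
move=> [mphi [M phiM]]; apply: measurable_bounded_integrable => //.
  by rewrite lebesgue2_square ltry.
exists M; split; first exact: num_real.
by move=> K MK p /phiM /le_trans; apply; exact: ltW.
Qed.

Lemma EFin_mean phi : bounded_measurable phi ->
  (mean phi)%:E = (\int[lebesgue2 R]_(p in square) (phi p)%:E)%E.
Proof.
move=> /bm_integrable iphi; rewrite /mean /Rintegral fineK//.
by apply: (integrable_fin_num _ iphi); exact: measurable_square.
Qed.

Lemma bm_cst (c : R) : bounded_measurable (cst c).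
Proof. by split=> //; exists `|c|. Qed.

Lemma bmD phi chi : bounded_measurable phi -> bounded_measurable chi ->
  bounded_measurable (fun p => phi p + chi p).
Proof.
move=> [m1 [M1 H1]] [m2 [M2 H2]]; split; first exact: measurable_funD.
exists (M1 + M2) => p sp; apply: (le_trans (ler_normD _ _)).
by rewrite lerD ?H1 ?H2.
Qed.

Lemma bmM phi chi : bounded_measurable phi -> bounded_measurable chi ->
  bounded_measurable (fun p => phi p * chi p).
Proof.
move=> [m1 [M1 H1]] [m2 [M2 H2]]; split; first exact: measurable_funM.
by exists (M1 * M2) => p sp; rewrite normrM ler_pM ?H1 ?H2.
Qed.

Lemma bmN phi : bounded_measurable phi ->
  bounded_measurable (fun p => - phi p).
Proof.
move=> [m1 [M1 H1]]; split; first exact: measurableT_comp.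
by exists M1 => p sp; rewrite normrN H1.
Qed.

Lemma bmB phi chi : bounded_measurable phi -> bounded_measurable chi ->
  bounded_measurable (fun p => phi p - chi p).
Proof. by move=> b1 b2; apply: bmD => //; exact: bmN. Qed.

Lemma bmZ (c : R) phi : bounded_measurable phi ->
  bounded_measurable (fun p => c * phi p).
Proof. by move=> ?; apply: bmM => //; exact: bm_cst. Qed.

Lemma bm_norm phi : bounded_measurable phi ->
  bounded_measurable (fun p => `|phi p|).
Proof.
move=> [m1 [M1 H1]]; split; first exact: measurableT_comp.
by exists M1 => p sp; rewrite normr_id H1.
Qed.

Lemma bm_sum (I : Type) (r : seq I) (F : I -> R * R -> R) :
  (forall i, bounded_measurable (F i)) ->
  bounded_measurable (fun p => \sum_(i <- r) F i p).
Proof.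
move=> bF; elim: r => [|i r IH].
  by under eq_fun do rewrite big_nil; exact: bm_cst.
by under eq_fun do rewrite big_cons; exact: bmD.
Qed.

Lemma bm_graphon f : bounded_measurable f.
Proof.
split; first exact: graphon_measurable.
exists 1 => -[x y] [/= xI yI].
by have /andP[f0 f1] := graphon_range f xI yI; rewrite ger0_norm.
Qed.
Hint Resolve bm_graphon : core.

Lemma bm_indic (B : set (R * R)) : measurable B -> bounded_measurable (\1_B).
Proof.
move=> mB; split.
  by apply: measurable_funTS; exact: measurable_indic.
by exists 1 => p _; rewrite indicE ger0_norm// lern1 leq_b1.
Qed.

Lemma graphon_entropy_range f p : square p -> -1 <= entropy (f p) <= 0.
Proof.
case: p => x y [/= xI yI]; have H := graphon_range f xI yI.
by rewrite entropy_geN1//= entropy_le0.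
Qed.

Lemma bm_entropy f : bounded_measurable (fun p => entropy (f p)).
Proof.
split.
  apply: measurableT_comp; first exact: measurable_entropy.
  exact: graphon_measurable.
exists 1 => p /(graphon_entropy_range f) /andP[H1 H2].
by rewrite ler_norml H1/= (le_trans H2).
Qed.
Hint Resolve bm_entropy : core.

Lemma eq_mean phi chi : (forall p, square p -> phi p = chi p) ->
  mean phi = mean chi.
Proof. by move=> H; apply: eq_Rintegral => p; rewrite inE; exact: H. Qed.

Lemma meanD phi chi : bounded_measurable phi -> bounded_measurable chi ->
  mean (fun p => phi p + chi p) = mean phi + mean chi.
Proof. by move=> *; apply: RintegralD => //; exact: bm_integrable. Qed.

Lemma meanB phi chi : bounded_measurable phi -> bounded_measurable chi ->
  mean (fun p => phi p - chi p) = mean phi - mean chi.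
Proof. by move=> *; apply: RintegralB => //; exact: bm_integrable. Qed.

Lemma meanZ (c : R) phi : bounded_measurable phi ->
  mean (fun p => c * phi p) = c * mean phi.
Proof. by move=> *; apply: RintegralZl => //; exact: bm_integrable. Qed.

Lemma mean_cst (c : R) : mean (fun=> c) = c.
Proof. by rewrite /mean Rintegral_cst// lebesgue2_square mulr1. Qed.

Lemma mean_sum (I : Type) (r : seq I) (F : I -> R * R -> R) :
  (forall i, bounded_measurable (F i)) ->
  mean (fun p => \sum_(i <- r) F i p) = \sum_(i <- r) mean (F i).
Proof.
move=> bF; elim: r => [|i r IH].
  by rewrite big_nil -[RHS]mean_cst; apply: eq_mean => p _; rewrite big_nil.
rewrite big_cons -IH -meanD//; last exact: bm_sum.
by apply: eq_mean => p _; rewrite big_cons.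
Qed.

Lemma mean_le phi chi : bounded_measurable phi -> bounded_measurable chi ->
  (forall p, square p -> phi p <= chi p) -> mean phi <= mean chi.
Proof. by move=> *; apply: le_Rintegral => //; exact: bm_integrable. Qed.

Lemma mean_ge0 phi : (forall p, square p -> 0 <= phi p) -> 0 <= mean phi.
Proof. by move=> H; apply: Rintegral_ge0. Qed.

Lemma mean_norm phi : bounded_measurable phi ->
  `| mean phi | <= mean (fun p => `|phi p|).
Proof. by move=> ?; apply: le_normr_Rintegral => //; exact: bm_integrable. Qed.

Lemma mean_indic (B : set (R * R)) : measurable B -> B `<=` square ->
  mean (\1_B) = fine (lebesgue2 R B).
Proof.
move=> mB BI; rewrite /mean /Rintegral integral_indic//.
by rewrite (setIidl BI).
Qed.

Lemma lebesgue_fin S : measurable S -> S `<=` unitI ->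
  lebesgue_measure S \is a fin_num.
Proof.
move=> mS SI; rewrite ge0_fin_numE//; apply: (@le_lt_trans _ _ 1%E); last first.
  exact: ltry.
by rewrite -lebesgue_unitI le_measure ?inE//; exact: measurable_unitI.
Qed.

Lemma mean_rect S A : measurable S -> S `<=` unitI -> measurable A ->
  A `<=` unitI -> mean (\1_(S `*` A)) =
  fine (lebesgue_measure S) * fine (lebesgue_measure A).
Proof.
move=> mS SI mA AI; rewrite mean_indic.
- by rewrite lebesgue2E// fineM// lebesgue_fin.
- exact: measurableX.
- by move=> p [/SI ? /AI ?].
Qed.

Lemma Rintegral_rect phi S A : S `<=` unitI -> A `<=` unitI ->
  \int[lebesgue2 R]_(p in S `*` A) phi p =
  mean (fun p => phi p * \1_(S `*` A) p).
Proof.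
move=> SI AI; rewrite /mean.
have -> : S `*` A = square `&` (S `*` A).
  by apply/esym/setIidr => p [/SI ? /AI ?].
rewrite Rintegral_mkcondr setIidr; last by move=> p [/SI ? /AI ?].
apply: eq_Rintegral => p _; rewrite patchE indicE.
by case: ifPn => _; rewrite ?mulr1 ?mulr0.
Qed.

(** A substitute for the Cauchy-Schwarz inequality without square roots. *)
Lemma mean_norm_le_sqr phi (t : R) : 0 < t -> bounded_measurable phi ->
  mean (fun p => phi p ^+ 2) <= t ^+ 2 -> mean (fun p => `|phi p|) <= t.
Proof.
move=> t0 bphi H.
have b2 : bounded_measurable (fun p => phi p ^+ 2) by apply: bmM.
have : mean (fun p => `|phi p|) <=
    mean (fun p => t / 2 + (2 * t)^-1 * phi p ^+ 2).
  apply: mean_le; first exact: bm_norm.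
    by apply: bmD; [exact: bm_cst|exact: bmZ].
  move=> p _; rewrite -(real_normK (num_real (phi p))); set z := `|phi p|.
  rewrite -subr_ge0.
  have -> : t / 2 + (2 * t)^-1 * z ^+ 2 - z = (2 * t)^-1 * (t - z) ^+ 2.
    by field; rewrite gt_eqF.
  by rewrite mulr_ge0 ?sqr_ge0// invr_ge0; lra.
move/le_trans; apply; rewrite meanD; [|exact: bm_cst|exact: bmZ].
rewrite mean_cst meanZ//.
apply: (@le_trans _ _ (t / 2 + (2 * t)^-1 * t ^+ 2)).
  by rewrite lerD2l ler_wpM2l// invr_ge0; lra.
by rewrite le_eqVlt; apply/orP; left; apply/eqP; field; rewrite gt_eqF.
Qed.

Lemma mean_bounded_convergence (F : nat -> R * R -> R) phi (M : R) :
  (forall k, bounded_measurable (F k)) -> bounded_measurable phi ->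
  (forall k p, square p -> `|F k p| <= M) ->
  {ae lebesgue2 R, forall p, square p -> F ^~ p @ \oo --> phi p} ->
  forall e : R, 0 < e -> exists K, forall k, (K <= k)%N ->
    mean (fun p => `|F k p - phi p|) <= e.
Proof.
move=> bF bphi FM Fphi e e0.
have mF k : measurable_fun square (fun p => (F k p)%:E).
  by apply/measurable_EFinP; case: (bF k).
have mphi : measurable_fun square (fun p => (phi p)%:E).
  by apply/measurable_EFinP; case: bphi.
have dom : {ae lebesgue2 R, forall p k, square p -> (`|(F k p)%:E| <= M%:E)%E}.
  by apply: aeW => p k sp; rewrite /= lee_fin FM.
have cvgE : {ae lebesgue2 R, forall p, square p ->
    EFin \o F ^~ p @ \oo --> (phi p)%:E}.
  apply: (@filterS _ _ (ae_filter_ringOfSetsType (lebesgue2 R)) _ _ _ Fphi).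
  move=> p H /H cF; apply/cvg_EFin; first exact: nearW.
  exact: cF.
have [_ H _] := @dominated_convergence _ _ _ (lebesgue2 R) square measurable_square
  (fun k p => (F k p)%:E) (fun p => (phi p)%:E) (fun=> M%:E) mF mphi cvgE
  (bm_integrable (bm_cst M)) dom.
have eE k : (\int[lebesgue2 R]_(p in square) `|(F k p)%:E - (phi p)%:E|)%E
    = (mean (fun p => `|F k p - phi p|))%:E.
  rewrite EFin_mean; last by apply: bm_norm; exact: bmB.
  by apply: eq_integral => p _; rewrite -EFinB abse_EFin.
move: H; under eq_fun do rewrite eE.
move=> /fine_cvgP[_ /cvgrPdist_le/(_ _ e0)[K _ H]].
exists K => k /H /=; rewrite sub0r normrN ger0_norm//.
exact: mean_ge0.
Qed.

Definition l1_dist f g := mean (fun p => `|f p - g p|).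

Lemma cut_dist_le_l1 f g : cut_dist f g <= l1_dist f g.
Proof.
apply: cut_dist_le => S A mS SI mA AI.
rewrite Rintegral_rect//.
have mSA : measurable (S `*` A) by exact: measurableX.
have b1 : bounded_measurable (fun p => f p - g p) by exact: bmB.
have b2 : bounded_measurable (fun p => (f p - g p) * \1_(S `*` A) p).
  by apply: bmM => //; exact: bm_indic.
apply: (le_trans (mean_norm b2)); apply: mean_le; [exact: bm_norm..|].
move=> p _; rewrite normrM ler_piMr// indicE ger0_norm// lern1 leq_b1//.
Qed.

Lemma l1_dist_ge0 f g : 0 <= l1_dist f g.
Proof. by apply: mean_ge0 => p _. Qed.

(** Grid conventions and monotone colourings are only correct when no coordinate
    lies in a small set N; this is the cost of the remaining pairs of
    coordinates, which fill two strips. *)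
Lemma mean_exception phi N (d M : R) : bounded_measurable phi ->
  measurable N -> N `<=` unitI -> 0 <= d -> 0 <= M ->
  (forall p, square p -> `|phi p| <= M) ->
  (forall x y, unitI x -> unitI y -> ~ N x -> ~ N y -> `|phi (x, y)| <= d) ->
  mean (fun p => `|phi p|) <= d + 2 * M * fine (lebesgue_measure N).
Proof.
move=> bphi mN NI d0 M0 HM Hd.
have mI := @measurable_unitI R.
have b1 : bounded_measurable (\1_(N `*` unitI)).
  by apply: bm_indic; exact: measurableX.
have b2 : bounded_measurable (\1_(unitI `*` N)).
  by apply: bm_indic; exact: measurableX.
pose u p := d + (M * \1_(N `*` unitI) p + M * \1_(unitI `*` N) p) : R.
have bu : bounded_measurable u.
  by apply: bmD; [exact: bm_cst|apply: bmD; exact: bmZ].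
have -> : d + 2 * M * fine (lebesgue_measure N) = mean u.
  rewrite /u meanD ?mean_cst; [|exact: bm_cst|by apply: bmD; exact: bmZ].
  rewrite meanD; [|exact: bmZ|exact: bmZ].
  rewrite !meanZ// !mean_rect// lebesgue_unitI /=; lra.
apply: mean_le => //; first exact: bm_norm.
move=> [x y] [/= xI yI]; rewrite /u !indicE.
have [xN|xN] := pselect (N x).
  rewrite (_ : (x, y) \in N `*` unitI)/=; last by rewrite inE.
  apply: (le_trans (HM (x, y) _)) => //.
  by rewrite mulr1 -[leLHS]add0r lerD// lerDl mulr_ge0.
have [yN|yN] := pselect (N y).
  rewrite [in X in _ + (_ + X)](_ : (x, y) \in unitI `*` N)/=; last by rewrite inE.
  apply: (le_trans (HM (x, y) _)) => //.
  by rewrite mulr1 -[leLHS]add0r lerD// lerDr mulr_ge0.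
apply: (le_trans (Hd _ _ xI yI xN yN)).
by rewrite lerDl addr_ge0// mulr_ge0.
Qed.

Lemma l1_dist_exception f g N (d : R) : measurable N -> N `<=` unitI -> 0 <= d ->
  (forall x y, unitI x -> unitI y -> ~ N x -> ~ N y ->
    `|f (x, y) - g (x, y)| <= d) ->
  l1_dist f g <= d + 2 * fine (lebesgue_measure N).
Proof.
move=> mN NI d0 H; rewrite -[X in X * fine _]mulr1.
apply: mean_exception => //; first exact: bmB.
move=> [x y] [/= xI yI].
have /andP[f0 f1] := graphon_range f xI yI.
have /andP[g0 g1] := graphon_range g xI yI.
by rewrite ler_norml; apply/andP; split; lra.
Qed.

Lemma graphon_rate_mean f : graphon_rate f = mean (fun p => entropy (f p)).
Proof. by []. Qed.

Lemma graphon_rate_range f : -1 <= graphon_rate f <= 0.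
Proof.
rewrite graphon_rate_mean; apply/andP; split.
  rewrite -[leLHS]mean_cst; apply: mean_le => //; first exact: bm_cst.
  by move=> p /(graphon_entropy_range f)/andP[].
rewrite -[leRHS]mean_cst; apply: mean_le => //; first exact: bm_cst.
by move=> p /(graphon_entropy_range f)/andP[].
Qed.

(** The rate is continuous for the L1 distance, although it is only lower
    semicontinuous for the cut distance. *)
Lemma graphon_rate_modulus f g (eta : R) : 0 < eta <= 1 ->
  `| graphon_rate f - graphon_rate g | <= eta + (1 - ln eta) * l1_dist f g.
Proof.
move=> e01; rewrite !graphon_rate_mean -meanB//.
have bfg : bounded_measurable (fun p => f p - g p) by exact: bmB.
have be : bounded_measurable (fun p => entropy (f p) - entropy (g p)).
  exact: bmB.
apply: (le_trans (mean_norm be)).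
rewrite /l1_dist -meanZ; last exact: bm_norm.
rewrite -[X in X + mean _](mean_cst eta) -meanD; last 2 first.
- exact: bm_cst.
- by apply: bmZ; exact: bm_norm.
apply: mean_le; first exact: bm_norm.
  by apply: bmD; [exact: bm_cst|apply: bmZ; exact: bm_norm].
move=> [x y] [/= xI yI]; apply: entropy_modulus => //; exact: graphon_range.
Qed.

End unit_square.
#[global] Hint Resolve measurable_square bm_graphon bm_entropy : core.

(** * Completeness of the space of graphons in the L1 distance *)

Section l1_limit.
Context {R : realType}.
Variable g : nat -> graphon R.

Let range01 (p : R * R) : square p -> forall k, 0 <= g k p <= 1.
Proof. by case: p => x y [/= xI yI] k; exact: graphon_range. Qed.

Let ub_range (p : R * R) : square p -> has_ubound (range (fun k => g k p)).
Proof. by move=> sp; exists 1 => _ [k _ <-]; have /andP[] := range01 sp k. Qed.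

Let lb_range (p : R * R) : square p -> has_lbound (range (fun k => g k p)).
Proof. by move=> sp; exists 0 => _ [k _ <-]; have /andP[] := range01 sp k. Qed.

Let sups_range (p : R * R) n : square p -> 0 <= sups (fun k => g k p) n <= 1.
Proof.
move=> sp; have ubS : has_ubound (sdrop (fun k => g k p) n).
  by exists 1 => _ [k _ <-]; have /andP[] := range01 sp k.
apply/andP; split.
  apply: (@le_trans _ _ (g n p)); first by have /andP[] := range01 sp n.
  by apply: ub_le_sup => //; exists n => /=.
apply: ge_sup; first by exists (g n p), n => /=.
by move=> _ [k _ <-]; have /andP[] := range01 sp k.
Qed.

Definition limsup_fun (p : R * R) : R := limn_sup (fun k => g k p).

Let limsup_range (p : R * R) : square p -> 0 <= limsup_fun p <= 1.
Proof.
move=> sp; rewrite /limsup_fun /limn_sup (cvg_lim _ (cvg_sups_inf (ub_range sp) (lb_range sp)))//.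
have lbS : has_lbound (range (sups (fun k => g k p))).
  by exists 0 => _ [k _ <-]; have /andP[] := sups_range k sp.
apply/andP; split.
  apply: lb_le_inf; first by exists (sups (fun k => g k p) 0), 0%N.
  by move=> _ [k _ <-]; have /andP[] := sups_range k sp.
apply: (@le_trans _ _ (sups (fun k => g k p) 0)).
  by apply: ge_inf => //; exists 0%N.
by have /andP[] := sups_range 0 sp.
Qed.

(** The upper limit is symmetric and [0,1]-valued at every point of the square,
    not merely almost everywhere, so it needs no correction on a null set. *)
Definition limsup_graphon : graphon R.
Proof.
refine (@Graphon R limsup_fun _ _ _).
- apply: measurable_fun_limn_sup => [p /ub_range//|p /lb_range//|n].
  exact: graphon_measurable.
- move=> x y xI yI; rewrite /limsup_fun; congr limn_sup.
  by apply/funext => k; exact: graphon_sym.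
- by move=> x y xI yI; apply: limsup_range.
Defined.

Hypothesis gg : forall k, l1_dist (g k) (g k.+1) <= 2^-1 ^+ k.

Let sum_half_le2 n : \sum_(0 <= k < n) (2^-1 : R) ^+ k <= 2.
Proof.
suff : \sum_(0 <= k < n) (2^-1 : R) ^+ k = 2 - 2 * 2^-1 ^+ n.
  move=> ->; have : 0 <= (2^-1 : R) ^+ n by rewrite exprn_ge0.
  lra.
elim: n => [|n IH]; first by rewrite big_geq// expr0; lra.
by rewrite big_nat_recr//= IH exprS; lra.
Qed.

Let diff k (p : R * R) : R := `|g k p - g k.+1 p|.

Let bm_diff k : bounded_measurable (diff k).
Proof. by apply: bm_norm; exact: bmB. Qed.

Let diff_series_integrable : (lebesgue2 R).-integrable square
  (fun p => \sum_(k <oo) (diff k p)%:E)%E.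
Proof.
have mdiff k : measurable_fun square (fun p => (diff k p)%:E).
  by apply/measurable_EFinP; case: (bm_diff k).
have dge0 k p : square p -> (0 <= (diff k p)%:E)%E.
  by move=> _; rewrite lee_fin normr_ge0.
apply/integrableP; split.
  apply: (ge0_emeasurable_sum (P := xpredT)) => [k p sp _|k _]; first exact: dge0.
  exact: mdiff.
have -> : (\int[lebesgue2 R]_(p in square) `|\sum_(k <oo) (diff k p)%:E| =
    \int[lebesgue2 R]_(p in square) (\sum_(k <oo) (diff k p)%:E))%E.
  apply: eq_integral => p; rewrite inE => sp.
  by rewrite gee0_abs// nneseries_ge0// => k _ _; exact: dge0.
rewrite (integral_nneseries (lebesgue2 R) measurable_square mdiff (fun k p => @dge0 k p)).
apply: (@le_lt_trans _ _ (2 : R)%:E); last exact: ltry.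
apply: lime_le.
  by apply: is_cvg_nneseries => n _ _; apply: integral_ge0 => p; exact: dge0.
apply: nearW => n; apply: (@le_trans _ _ (\sum_(0 <= k < n) (2^-1 : R) ^+ k)%:E).
  rewrite -sumEFin; apply: lee_sum => k _.
  by rewrite -EFin_mean// lee_fin; exact: gg.
by rewrite lee_fin.
Qed.

Let ae_cvg : {ae lebesgue2 R, forall p, square p ->
  (fun k => g k p) @ \oo --> limsup_fun p}.
Proof.
have := @integrable_ae _ _ _ (lebesgue2 R) square measurable_square _
  diff_series_integrable.
apply: filterS => p H sp; have {H} Hfin := H sp.
have dge0 k : (0 <= (diff k p)%:E)%E by rewrite lee_fin normr_ge0.
suff cg : cvgn (fun k => g k p).
  by rewrite /limsup_fun cvg_limn_supE.
have -> : (fun k => g k p) =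
    (fun k => g 0 p + series (telescope (fun k => g k p)) k).
  by apply/funext => k; exact: eq_sum_telescope.
apply: is_cvgD; first exact: is_cvg_cst.
apply: normed_cvg; apply: nondecreasing_is_cvgn.
  by apply: nondecreasing_series => n _ _; exact: normr_ge0.
exists (fine (\sum_(k <oo) (diff k p)%:E)) => _ [n _ <-].
rewrite -lee_fin fineK//.
apply: le_trans (nneseries_lim_ge (P := xpredT) n (fun k _ _ => dge0 k)).
rewrite sumEFin lee_fin /normed_series_of /series /=.
by apply: ler_sum => k _; rewrite /telescope/= /diff distrC.
Qed.

(** The increments are summable, so the sequence converges almost everywhere and
    the upper limit is its limit there. *)
Lemma l1_limit (e : R) : 0 < e ->
  exists K, forall k, (K <= k)%N -> l1_dist (g k) limsup_graphon <= e.
Proof.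
move=> e0.
apply: (mean_bounded_convergence (M := 1) (F := fun k p => g k p)
  (phi := limsup_graphon)) => //.
by move=> k p sp; have /andP[? ?] := range01 sp k; rewrite ger0_norm.
Qed.

End l1_limit.

(** * Limits of cut-Cauchy sequences *)

Section midpoint.
Context {R : realType}.
Implicit Types f g h : graphon R.

Definition midpoint g h : graphon R.
Proof.
refine (@Graphon R (fun p => (g p + h p) / 2) _ _ _).
- apply: measurable_funM => //.
  by apply: measurable_funD; exact: graphon_measurable.
- by move=> x y xI yI /=; rewrite (graphon_sym g xI yI) (graphon_sym h xI yI).
- move=> x y xI yI; have := graphon_range g xI yI.
  by have := graphon_range h xI yI; lra.
Defined.

Lemma midpointE g h p : midpoint g h p = (g p + h p) / 2.
Proof. by []. Qed.

Lemma cut_dist_midpoint f g h :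
  cut_dist f (midpoint g h) <= (cut_dist f g + cut_dist f h) / 2.
Proof.
apply: cut_dist_le => S A mS SI mA AI.
have Hg := cut_dist_ub f g mS SI mA AI.
have Hh := cut_dist_ub f h mS SI mA AI.
rewrite !Rintegral_rect// in Hg Hh *.
have bSA : bounded_measurable (\1_(S `*` A)) by apply: bm_indic; exact: measurableX.
have bg : bounded_measurable (fun p => (f p - g p) * \1_(S `*` A) p).
  by apply: bmM => //; exact: bmB.
have bh : bounded_measurable (fun p => (f p - h p) * \1_(S `*` A) p).
  by apply: bmM => //; exact: bmB.
rewrite (@eq_mean _ _ (fun p => 2^-1 * ((f p - g p) * \1_(S `*` A) p) +
  2^-1 * ((f p - h p) * \1_(S `*` A) p))); last by move=> p _; rewrite midpointE; field.
rewrite meanD; [|exact: bmZ|exact: bmZ].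
rewrite !meanZ//; apply: (le_trans (ler_normD _ _)).
rewrite !normrM (@ger0_norm _ 2^-1)// -mulrDr mulrC.
by apply: ler_pM; rewrite ?addr_ge0// lerD.
Qed.

Lemma graphon_rate_midpoint g h :
  graphon_rate (midpoint g h) <= (graphon_rate g + graphon_rate h) / 2.
Proof.
rewrite !graphon_rate_mean.
have -> : (mean (fun p => entropy (g p)) + mean (fun p => entropy (h p))) / 2 =
  mean (fun p => 2^-1 * entropy (g p) + 2^-1 * entropy (h p)).
  rewrite (meanD (bmZ _ (bm_entropy g)) (bmZ _ (bm_entropy h))).
  by rewrite (meanZ _ (bm_entropy g)) (meanZ _ (bm_entropy h)); lra.
apply: mean_le => //; first by apply: bmD; exact: bmZ.
move=> [x y] [/= xI yI].
have := entropy_midconvex (graphon_range g xI yI) (graphon_range h xI yI); lra.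
Qed.

Definition sq_norm g := mean (fun p => g p ^+ 2).

Lemma bm_sqr (phi : R * R -> R) : bounded_measurable phi ->
  bounded_measurable (fun p => phi p ^+ 2).
Proof. by move=> b; apply: bmM. Qed.

Lemma sq_norm_range g : 0 <= sq_norm g <= 1.
Proof.
apply/andP; split; first by apply: mean_ge0 => p _; exact: sqr_ge0.
rewrite -[leRHS]mean_cst; apply: mean_le; [exact: bm_sqr|exact: bm_cst|].
move=> [x y] [/= xI yI]; have /andP[g0 g1] := graphon_range g xI yI.
by rewrite expr_le1.
Qed.

Lemma sq_norm_parallelogram g h : mean (fun p => (g p - h p) ^+ 2) =
  2 * sq_norm g + 2 * sq_norm h - 4 * sq_norm (midpoint g h).
Proof.
rewrite /sq_norm -!meanZ -?meanD -?meanB; first by apply: eq_mean => p _; rewrite midpointE; field.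
all: repeat (first [exact: bm_graphon | apply: bmD | apply: bmZ | apply: bm_sqr]).
Qed.

End midpoint.

Section cut_limit.
Context {R : realType}.
Variables (f : nat -> graphon R) (c : R).
Hypothesis ff : forall k, cut_dist (f k) (f k.+1) <= 2^-1 ^+ k.
Hypothesis fc : forall k, graphon_rate (f k) <= c.

Let half_ge0 k : 0 <= (2^-1 : R) ^+ k. Proof. by rewrite exprn_ge0. Qed.

Let D n : set (graphon R) :=
  [set g | cut_dist (f n) g <= 2 * 2^-1 ^+ n /\ graphon_rate g <= c].

Let D_f n : D n (f n).
Proof. by split => //; rewrite cut_distxx mulr_ge0. Qed.

Let D_nested m n : (m <= n)%N -> D n `<=` D m.
Proof.
elim: n => [|n IH]; first by rewrite leqn0 => /eqP->.
rewrite leq_eqVlt => /predU1P[->//|]; rewrite ltnS => /IH; apply: subset_trans.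
move=> g [H1 H2]; split => //.
have := cut_dist_triangle (f n.+1) (f n) g; have := ff n.
rewrite exprS in H1; lra.
Qed.

Let D_mid n g h : D n g -> D n h -> D n (midpoint g h).
Proof.
move=> [g1 g2] [h1 h2]; split.
  by have := cut_dist_midpoint (f n) g h; lra.
by have := graphon_rate_midpoint g h; lra.
Qed.

Let a n := inf [set sq_norm g | g in D n].

Let a_le n g : D n g -> a n <= sq_norm g.
Proof.
move=> Dg; apply: ge_inf; last by exists g.
by exists 0 => _ [h _ <-]; have /andP[] := sq_norm_range h.
Qed.

Let a_near n (t : R) : 0 < t -> exists2 g, D n g & sq_norm g <= a n + t.
Proof.
move=> t0; have : has_inf [set sq_norm g | g in D n].
  split; first by exists (sq_norm (f n)), (f n).
  by exists 0 => _ [h _ <-]; have /andP[] := sq_norm_range h.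
by move=> /(inf_adherent t0)[_ [g Dg <-] /ltW]; exists g.
Qed.

Let a_mono m n : (m <= n)%N -> a m <= a n.
Proof.
move=> mn; apply: lb_le_inf; first by exists (sq_norm (f n)), (f n).
by move=> _ [g /(D_nested mn)/a_le + <-].
Qed.

Let ainf := sup (range a).

Let a_ub : has_ubound (range a).
Proof.
by exists 1 => _ [n _ <-]; apply: (le_trans (a_le (D_f n)));
  have /andP[] := sq_norm_range (f n).
Qed.

Let a_ainf n : a n <= ainf.
Proof. by apply: ub_le_sup => //; exists n. Qed.

(* By the parallelogram law two elements that are within del k of minimal differ
   by at most 8 * del k in squared norm. *)
Let del k : R := (2^-1 ^+ k) ^+ 2 / 8.

Let del_gt0 k : 0 < del k.
Proof. by rewrite divr_gt0// exprn_gt0// exprn_gt0// invr_gt0. Qed.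

Let near_minimiser k : exists ng : nat * graphon R,
  [/\ (k <= ng.1)%N, D ng.1 ng.2, ainf - del k <= a ng.1 &
      sq_norm ng.2 <= ainf + del k].
Proof.
have hs : has_sup (range a) by split => //; exists (a 0), 0%N.
have [_ [n _ <-] an] := sup_adherent (del_gt0 k) hs.
have [g Dg ag] := a_near (maxn n k) (del_gt0 k).
exists (maxn n k, g); split => //=; first exact: leq_maxr.
  by apply: (le_trans (ltW an)); apply: a_mono; exact: leq_maxl.
by have := a_ainf (maxn n k); lra.
Qed.

(** The sets D n of graphons near f n of small rate are nested and closed under
    midpoints, so by the parallelogram law elements of nearly minimal L2 norm
    form a Cauchy sequence. This trades cut convergence, which says nothing
    about the rate, for L1 convergence, along which the rate is continuous. *)
Lemma cut_limit : exists2 h : graphon R,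
  (forall k, cut_dist (f k) h <= 2 * 2^-1 ^+ k) & graphon_rate h <= c.
Proof.
have /choice[ng ngP] := near_minimiser.
pose g k := (ng k).2.
have gg k : l1_dist (g k) (g k.+1) <= 2^-1 ^+ k.
  apply: mean_norm_le_sqr; [by rewrite exprn_gt0// invr_gt0|exact: bmB|].
  rewrite sq_norm_parallelogram.
  have [_ D1 a1 s1] := ngP k; have [_ D2 a2 s2] := ngP k.+1.
  have del_le : del k.+1 <= del k.
    rewrite /del ler_pM2r ?invr_gt0// ler_sqr ?nnegrE//.
    by rewrite exprS ler_piMl//; lra.
  have Dmin : D (minn (ng k).1 (ng k.+1).1) (midpoint (g k) (g k.+1)).
    by apply: D_mid; [apply: D_nested D1; exact: geq_minl|
      apply: D_nested D2; exact: geq_minr].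
  have amin : ainf - del k <= a (minn (ng k).1 (ng k.+1).1).
    by rewrite /minn; case: ifP => _; lra.
  have := a_le Dmin; rewrite /g in s1 s2 *.
  have -> : (2^-1 ^+ k) ^+ 2 = 8 * del k by rewrite /del; field.
  lra.
have lim := l1_limit gg; set h := limsup_graphon g in lim.
exists h => [k|].
  apply/ler_addgt0Pr => e e0; have [K HK] := lim e e0.
  have := HK (maxn K k) (leq_maxl _ _).
  have [k1 D1 _ _] := ngP (maxn K k).
  have : D k (g (maxn K k)).
    by apply: D_nested D1; rewrite (leq_trans _ k1)// leq_maxr.
  case=> + _.
  have := cut_dist_triangle (g (maxn K k)) (f k) h.
  have := cut_dist_le_l1 (g (maxn K k)) h.
  lra.
apply/ler_addgt0Pr => e e0.
pose eta : R := Num.min (e / 2) 1.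
have eta01 : 0 < eta <= 1 by rewrite /eta lt_min ge_min lexx orbT ltr01 divr_gt0.
have M0 : 0 < 1 - ln eta.
  by case/andP: eta01 => _ /ln_le0; lra.
have [|K HK] := lim (e / 2 / (1 - ln eta)); first by rewrite !divr_gt0.
have := graphon_rate_modulus (g K) h eta01.
have : (1 - ln eta) * l1_dist (g K) h <= e / 2.
  by rewrite mulrC -ler_pdivlMr//; exact: HK.
have : eta <= e / 2 by rewrite /eta ge_min lexx.
have [_ [_ +] _ _] := ngP K; rewrite -/(g K).
rewrite ler_norml => ? ? ? /andP[? ?]; lra.
Qed.

End cut_limit.

(** * Step graphons on a regular grid *)

Section bilinear_extreme_points.
Context {R : realType} {I J : finType}.
Implicit Types d : I -> J -> R.

Lemma sum_le_positive_part (K : finType) (c s : K -> R) :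
  (forall k, 0 <= s k <= 1) ->
  \sum_k s k * c k <= \sum_(k in [set k | 0 < c k]%SET) c k.
Proof.
move=> s01; rewrite [leRHS]big_mkcond/=; apply: ler_sum => k _; rewrite inE.
have /andP[s0 s1] := s01 k; case: ifPn => [ck|]; first by rewrite ler_piMl// ltW.
by rewrite -leNgt => ck; rewrite mulr_ge0_le0.
Qed.

(** A bilinear form on a product of cubes is maximal at vertices. *)
Lemma bilinear_le d (B : R) (s : I -> R) (t : J -> R) :
  (forall (S : {set I}) (A : {set J}),
    \sum_(i in S) \sum_(j in A) d i j <= B) ->
  (forall i, 0 <= s i <= 1) -> (forall j, 0 <= t j <= 1) ->
  \sum_i \sum_j d i j * (s i * t j) <= B.
Proof.
move=> dB s01 t01.
pose c i := \sum_j d i j * t j.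
have -> : \sum_i \sum_j d i j * (s i * t j) = \sum_i s i * c i.
  by apply: eq_bigr => i _; rewrite mulr_sumr; apply: eq_bigr => j _; ring.
apply: (le_trans (sum_le_positive_part c s01)).
set S := [set i | _]%SET; rewrite /c exchange_big/=.
have -> : \sum_j \sum_(i in S) d i j * t j = \sum_j t j * (\sum_(i in S) d i j).
  by apply: eq_bigr => j _; rewrite mulr_sumr; apply: eq_bigr => i _; ring.
apply: (le_trans (sum_le_positive_part _ t01)).
by rewrite exchange_big.
Qed.

Lemma bilinear_norm_le d (B : R) (s : I -> R) (t : J -> R) :
  (forall (S : {set I}) (A : {set J}),
    `|\sum_(i in S) \sum_(j in A) d i j| <= B) ->
  (forall i, 0 <= s i <= 1) -> (forall j, 0 <= t j <= 1) ->
  `|\sum_i \sum_j d i j * (s i * t j)| <= B.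
Proof.
move=> dB s01 t01; rewrite ler_norml; apply/andP; split; last first.
  by apply: bilinear_le => // S A; have := dB S A; rewrite ler_norml => /andP[].
rewrite lerNl -sumrN.
under eq_bigr do rewrite -sumrN.
under eq_bigr do under eq_bigr do rewrite -mulNr.
apply: bilinear_le => // S A.
under eq_bigr do rewrite sumrN.
rewrite sumrN lerNl.
by have := dB S A; rewrite ler_norml => /andP[].
Qed.

End bilinear_extreme_points.

Section grid.
Context {R : realType}.
Variable n : nat.
Let N := n.+1.
Let mR : measurableType _ := measurableTypeR R.

(** The cells are ]i / N, (i + 1) / N], as in the graphon of a graph; the point
    0, which lies in none of them, joins the first one. *)
Definition cell (x : R) : 'I_N := inord (`|Num.ceil (N%:R * x)|%N.-1).

Let N0 : 0 < N%:R :> R. Proof. by rewrite ltr0n. Qed.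

Lemma cell_eq (x : R) (i : 'I_N) : unitI x ->
  (cell x == i) = ((i%:R < N%:R * x) && (N%:R * x <= i%:R + 1)) ||
                  ((x == 0) && (i == ord0)).
Proof.
rewrite /unitI/= in_itv/= => /andP[x0 x1].
have [->|xN0] := eqVneq x 0.
  rewrite mulr0 ltNge ler0n/= /cell mulr0 ceil0 -val_eqE/= inordK//.
  by rewrite -val_eqE eq_sym.
rewrite andFb orbF; have {}x0 : 0 < x by rewrite lt_def xN0.
have xN : N%:R * x <= N%:R by rewrite ler_piMr// ltW.
have c0 : 0 < Num.ceil (N%:R * x) by rewrite ceil_gt0 mulr_gt0.
have cN : Num.ceil (N%:R * x) <= N%:Z by rewrite ceil_le_int.
have : (Num.ceil (N%:R * x) == i.+1%:Z) =
  (i%:R < N%:R * x) && (N%:R * x <= i%:R + 1).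
  have e1 : (i.+1%:Z - 1)%:~R = i%:R :> R by rewrite -addn1 PoszD addrK.
  have e2 : i.+1%:Z%:~R = i%:R + 1 :> R by rewrite natr1.
  by rewrite ceil_eq e1 e2.
move=> <-; rewrite /cell -val_eqE/= inordK; last first.
  by move: c0 cN; rewrite /N; case: (Num.ceil _) => // k; rewrite /=; lia.
by move: c0; case: (Num.ceil _) => // k; case: k => //= k _; apply/eqP/eqP; lia.
Qed.

Lemma ceil_cell (x : R) (i : 'I_N) : unitI x -> x != 0 ->
  (Num.ceil (N%:R * x) == i.+1%:Z) = (cell x == i).
Proof.
move=> xI xN0; rewrite cell_eq// (negPf xN0) orbF.
have e1 : (i.+1%:Z - 1)%:~R = i%:R :> R by rewrite -addn1 PoszD addrK.
have e2 : i.+1%:Z%:~R = i%:R + 1 :> R by rewrite natr1.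
by rewrite ceil_eq e1 e2.
Qed.

Definition cell_set (i : 'I_N) : set R := unitI `&` [set x | cell x = i].

Lemma cell_setE (i : 'I_N) : cell_set i =
  if i == ord0 then [set` `[0, N%:R^-1]]
  else [set` `](i%:R / N%:R), ((i%:R + 1) / N%:R)]].
Proof.
have iN : i%:R + 1 <= N%:R :> R by rewrite natr1 ler_nat.
apply/seteqP; split => [x [xI /eqP]|x].
  rewrite cell_eq// => /orP[/andP[i1 i2]|/andP[/eqP-> ->]]; last first.
    by rewrite /= in_itv/= lexx invr_ge0 ltW.
  case: ifPn => [/eqP i0|i0]; rewrite /= in_itv/=.
    move: i2 xI; rewrite i0 add0r /unitI/= in_itv/= => i2 /andP[-> _].
    by rewrite -[X in _ <= X]mul1r ler_pdivlMr// mulrC.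
  by rewrite ltr_pdivrMr// ler_pdivlMr// mulrC i1.
have i0 : 0 <= i%:R :> R by rewrite ler0n.
case: ifPn => [/eqP iE|iN0]; rewrite /= in_itv/=.
  move=> /andP[x0 x1].
  have x1' : N%:R * x <= 1 by rewrite mulrC -ler_pdivlMr// mul1r.
  have xI : unitI x.
    by rewrite /unitI/= in_itv/= x0/= (le_trans x1)// invf_le1// ler1n.
  split => //; apply/eqP; rewrite cell_eq// iE eqxx andbT add0r x1' andbT.
  by move: x0; rewrite le_eqVlt => /predU1P[<-|x0]; rewrite ?eqxx ?orbT// mulr_gt0.
rewrite ltr_pdivrMr// ler_pdivlMr// ![x * _]mulrC => /andP[x0 x1].
have xI : unitI x.
  rewrite /unitI/= in_itv/= -(pmulr_rge0 _ N0) (le_trans i0 (ltW x0))/=.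
  by rewrite -(ler_pM2l N0) mulr1 (le_trans x1).
by split => //; apply/eqP; rewrite cell_eq// x0 x1.
Qed.

Lemma measurable_cell_set i : measurable (cell_set i).
Proof. by rewrite cell_setE; case: ifP => _; exact: measurable_itv. Qed.

Lemma cell_setI i : cell_set i `<=` unitI.
Proof. by move=> x []. Qed.

Lemma lebesgue_cell_set i : lebesgue_measure (cell_set i) = (N%:R^-1)%:E.
Proof.
rewrite cell_setE; case: ifPn => [/eqP iE|iN0]; rewrite lebesgue_measure_itv/=.
  by rewrite lte_fin invr_gt0 N0 oppr0 adde0.
rewrite lte_fin ltr_pM2r ?invr_gt0// ltrDl ltr01 -EFinD; congr EFin.
by rewrite -mulrBl addrAC subrr add0r mul1r.
Qed.

Let meas S i := fine (lebesgue_measure (S `&` cell_set i)) : R.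

Let meas_range S i : measurable S -> 0 <= N%:R * meas S i <= 1.
Proof.
move=> mS; rewrite mulr_ge0 ?fine_ge0//= /meas mulrC -ler_pdivlMr// mul1r.
have -> : N%:R^-1 = fine (lebesgue_measure (cell_set i)) :> R.
  by rewrite lebesgue_cell_set.
have mSc : measurable (S `&` cell_set i).
  by apply: measurableI => //; exact: measurable_cell_set.
apply: fine_le.
- by apply: lebesgue_fin => // x [_ /cell_setI].
- by rewrite lebesgue_cell_set.
- by apply: le_measure; rewrite ?inE//; exact: measurable_cell_set.
Qed.

Lemma cell_decomp (phi : 'I_N -> 'I_N -> R) S A (p : R * R) : square p ->
  phi (cell p.1) (cell p.2) * \1_(S `*` A) p =
  \sum_i \sum_j phi i j * \1_((S `&` cell_set i) `*` (A `&` cell_set j)) p.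
Proof.
case: p => x y [/= xI yI].
rewrite (bigD1 (cell x))//= (bigD1 (cell y))//=.
rewrite big1 => [|j jc]; last first.
  rewrite indicE memNset ?mulr0// => -[_ [_ [_ /= yj]]].
  by rewrite yj eqxx in jc.
rewrite addr0 big1 ?addr0 => [|i ic]; last first.
  rewrite big1// => j _; rewrite indicE memNset ?mulr0// => -[[_ [_ /= xj]] _].
  by rewrite xj eqxx in ic.
congr (_ * _); rewrite !indicE; congr (nat_of_bool _)%:R.
by apply/idP/idP; rewrite !inE => -[] /=; [move=> xS yA; do 2 split|
  move=> [xS _] [yA _]; split].
Qed.

Lemma bm_cell (phi : 'I_N -> 'I_N -> R) :
  bounded_measurable (fun p => phi (cell p.1) (cell p.2)).
Proof.
have H : bounded_measurable (fun p => \sum_i \sum_j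
    phi i j * \1_((unitI `&` cell_set i) `*` (unitI `&` cell_set j)) p).
  apply: bm_sum => i; apply: bm_sum => j; apply: bmZ; apply: bm_indic.
  have mI := @measurable_unitI R.
  by apply: measurableX; apply: measurableI => //; exact: measurable_cell_set.
have E p : square p -> phi (cell p.1) (cell p.2) = \sum_i \sum_j
    phi i j * \1_((unitI `&` cell_set i) `*` (unitI `&` cell_set j)) p.
  by move=> sp; rewrite -cell_decomp// indicE mem_set// mulr1.
case: H => mH [M HM]; split; last by exists M => p sp; rewrite E// HM.
apply: eq_measurable_fun mH => p; rewrite inE => sp.
by rewrite E.
Qed.

Lemma mean_cell_rect (phi : 'I_N -> 'I_N -> R) S A :
  measurable S -> S `<=` unitI -> measurable A -> A `<=` unitI ->
  mean (fun p => phi (cell p.1) (cell p.2) * \1_(S `*` A) p) =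
  \sum_i \sum_j phi i j * (meas S i * meas A j).
Proof.
move=> mS SI mA AI; rewrite (eq_mean (@cell_decomp phi S A)).
have mSc i : measurable (S `&` cell_set i).
  by apply: measurableI => //; exact: measurable_cell_set.
have mAc i : measurable (A `&` cell_set i).
  by apply: measurableI => //; exact: measurable_cell_set.
have b i j : bounded_measurable
    (\1_((S `&` cell_set i) `*` (A `&` cell_set j)) : R * R -> R).
  by apply: bm_indic; exact: measurableX.
rewrite mean_sum => [|i]; last by apply: bm_sum => j; exact: bmZ.
apply: eq_bigr => i _; rewrite mean_sum => [|j]; last exact: bmZ.
apply: eq_bigr => j _; rewrite meanZ// mean_rect//.
- by move=> x [_ /cell_setI].
- by move=> x [_ /cell_setI].
Qed.

Lemma mean_cell (phi : 'I_N -> 'I_N -> R) :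
  mean (fun p => phi (cell p.1) (cell p.2)) =
  (N%:R ^+ 2)^-1 * \sum_i \sum_j phi i j.
Proof.
have mI := @measurable_unitI R.
have measE i : meas unitI i = N%:R^-1.
  by rewrite /meas (setIidr (@cell_setI i)) lebesgue_cell_set.
transitivity (mean (fun p => phi (cell p.1) (cell p.2) * \1_(unitI `*` unitI) p)).
  by apply: eq_mean => p sp; rewrite indicE mem_set// mulr1.
rewrite mean_cell_rect// mulr_sumr; apply: eq_bigr => i _.
rewrite mulr_sumr; apply: eq_bigr => j _; rewrite !measE; field.
by rewrite gt_eqF.
Qed.

Record weights := Weights {
  wt :> 'I_N -> 'I_N -> R ;
  wt_sym : forall i j, wt i j = wt j i ;
  wt_range : forall i j, 0 <= wt i j <= 1 }.

Definition step_graphon (w : weights) : graphon R.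
Proof.
refine (@Graphon R (fun p => w (cell p.1) (cell p.2)) _ _ _).
- by case: (bm_cell w).
- by move=> x y _ _; exact: wt_sym.
- by move=> x y _ _; exact: wt_range.
Defined.

Lemma graphon_rate_step (w : weights) : graphon_rate (step_graphon w) =
  (N%:R ^+ 2)^-1 * \sum_i \sum_j entropy (w i j).
Proof.
by rewrite graphon_rate_mean (mean_cell (fun i j => entropy (w i j))).
Qed.

(** The integral over a rectangle is a bilinear form in the fractions of the
    cells that the two sides cover, so unions of cells are the extreme case. *)
Lemma cut_dist_step (v w : weights) (e : R) :
  (forall S A : {set 'I_N},
    `|\sum_(i in S) \sum_(j in A) (v i j - w i j)| <= e * N%:R ^+ 2) ->
  cut_dist (step_graphon v) (step_graphon w) <= e.
Proof.
move=> H; apply: cut_dist_le => S A mS SI mA AI; rewrite Rintegral_rect//.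
rewrite (mean_cell_rect (fun i j => v i j - w i j))//.
rewrite -(@ler_pM2r _ (N%:R ^+ 2)) ?exprn_gt0//.
rewrite -[X in _ * X <= _]ger0_norm ?exprn_ge0// -normrM mulr_suml.
have -> : \sum_i (\sum_j (v i j - w i j) * (meas S i * meas A j)) * N%:R ^+ 2 =
  \sum_i \sum_j (v i j - w i j) * ((N%:R * meas S i) * (N%:R * meas A j)).
  by apply: eq_bigr => i _; rewrite mulr_suml; apply: eq_bigr => j _; ring.
by apply: bilinear_norm_le => // i; exact: meas_range.
Qed.

End grid.

(** * Approximation of graphons by step graphons *)

Section swap.
Context {R : realType}.

Let mR : measurableType _ := measurableTypeR R.
Let tau (p : mR * mR) : mR * mR := (p.2, p.1).

Let mtau : measurable_fun [set: mR * mR] tau.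
Proof. exact: measurable_fun_pair. Qed.

Let tau_preserve (B : set (mR * mR)) : measurable B ->
  pushforward (lebesgue2 R) tau B = lebesgue2 R B.
Proof.
move=> mB; apply/esym.
pose m := measure_function_pushforward__canonical__measure_function_Measure
  (lebesgue2 R) mtau.
apply: (product_measure_unique (m' := m)) => // A C mA mC.
rewrite /m /= /pushforward.
rewrite (_ : _ @^-1` _ = C `*` A); last first.
  by apply/seteqP; split => -[x y] [].
by rewrite lebesgue2E// muleC.
Qed.

Lemma mean_swap (phi : R * R -> R) : bounded_measurable phi ->
  mean (fun p => phi (p.2, p.1)) = mean phi.
Proof.
move=> bphi; have iphi := bm_integrable bphi.
have mphi : measurable_fun square phi by case: bphi.
pose h : mR * mR -> R := phi \_ square.
have mh : measurable_fun [set: mR * mR] h.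
  by apply/(measurable_restrictT _ _).1 => //; exact: measurable_square.
have mphi' : measurable_fun square (fun p : mR * mR => phi (p.2, p.1)).
  apply: (@eq_measurable_fun _ _ _ _ _ (h \o tau)).
    move=> [x y]; rewrite inE => -[/= xI yI].
    by rewrite /h patchE mem_set.
  by apply: measurable_funTS; apply: measurableT_comp => //; exact: mtau.
have bphi' : bounded_measurable (fun p : R * R => phi (p.2, p.1)).
  split => //; case: bphi => _ [M HM]; exists M => -[x y] [/= xI yI].
  by apply: HM.
congr fine.
pose m := measure_function_pushforward__canonical__measure_function_Measure
  (lebesgue2 R) mtau.
transitivity (\int[m]_(p in square) (h p)%:E)%E; last first.
  transitivity (\int[lebesgue2 R]_(p in square) (h p)%:E)%E.
    by apply: eq_measure_integral => B mB _; exact: tau_preserve.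
  by apply: eq_integral => p ps; rewrite /h patchE ps.
have pre : tau @^-1` square = square by apply/seteqP; split => -[x y] [].
apply/esym; transitivity (\int[lebesgue2 R]_(p in square) (h (tau p))%:E)%E.
  rewrite -[in RHS]pre.
  apply: (@integral_pushforward _ _ _ _ _ _ mtau
    (lebesgue2 R) _ (EFin \o h)) => //.
  - exact/measurable_EFinP.
  - rewrite pre; have := bm_integrable bphi'.
    apply: eq_integrable; first exact: measurable_square.
    by move=> [x y]; rewrite inE => -[/= xI yI]; rewrite /h patchE mem_set.
  - exact: measurable_square.
by apply: eq_integral => -[x y]; rewrite inE => -[/= xI yI]; rewrite /h patchE mem_set.
Qed.

End swap.

Section grid_approximation.
Context {R : realType}.
Implicit Types (phi chi : R * R -> R) (X Y : set R) (B : set (R * R)).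

(** Asking for every sufficiently fine grid, and not just for one, makes the class
    closed under sums without a common refinement. *)
Definition grid_approximable phi := forall e : R, 0 < e ->
  exists N, forall n, (N <= n)%N ->
    exists v : 'I_n.+1 -> 'I_n.+1 -> R,
      mean (fun p => `|phi p - v (cell n p.1) (cell n p.2)|) <= e.

Let bm_err phi n (v : 'I_n.+1 -> 'I_n.+1 -> R) : bounded_measurable phi ->
  bounded_measurable (fun p => `|phi p - v (cell n p.1) (cell n p.2)|).
Proof. by move=> b; apply: bm_norm; apply: bmB => //; exact: bm_cell. Qed.

Lemma grid_approximable_cst (c : R) : grid_approximable (cst c).
Proof.
move=> e e0; exists 0%N => n _; exists (fun _ _ => c).
rewrite (@eq_mean _ _ (cst 0)) ?mean_cst ?ltW// => p _ /=.
by rewrite subrr normr0.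
Qed.

Lemma grid_approximableD phi chi :
  bounded_measurable phi -> bounded_measurable chi ->
  grid_approximable phi -> grid_approximable chi ->
  grid_approximable (fun p => phi p + chi p).
Proof.
move=> bphi bchi Hphi Hchi e e0; have e20 : 0 < e / 2 by rewrite divr_gt0.
have [N1 H1] := Hphi _ e20; have [N2 H2] := Hchi _ e20.
exists (maxn N1 N2) => n; rewrite geq_max => /andP[/H1[v Hv] /H2[w Hw]].
exists (fun i j => v i j + w i j).
rewrite [leRHS](splitr e); apply: le_trans (lerD Hv Hw).
rewrite -meanD; [|exact: bm_err|exact: bm_err].
apply: mean_le.
- by apply: (@bm_err _ n (fun i j => v i j + w i j)); exact: bmD.
- by apply: bmD; exact: bm_err.
- by move=> p _; rewrite opprD addrACA ler_normD.
Qed.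

Lemma grid_approximableZ (c : R) phi : bounded_measurable phi ->
  grid_approximable phi -> grid_approximable (fun p => c * phi p).
Proof.
move=> bphi Hphi e e0.
have c0 : 0 < `|c| + 1 by rewrite ltr_wpDl.
have [|N H] := Hphi (e / (`|c| + 1)); first by rewrite divr_gt0.
exists N => n /H[v Hv]; exists (fun i j => c * v i j).
rewrite (@eq_mean _ _ (fun p => `|c| * `|phi p - v (cell n p.1) (cell n p.2)|)).
  rewrite meanZ; last exact: bm_err.
  move: Hv; rewrite ler_pdivlMr// => Hv; apply: le_trans Hv.
  by rewrite mulrC ler_wpM2l ?mean_ge0// lerDl.
by move=> p _; rewrite -mulrBr normrM.
Qed.

Lemma grid_approximable_lim phi : bounded_measurable phi ->
  (forall e : R, 0 < e -> exists chi, [/\ bounded_measurable chi,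
    grid_approximable chi & mean (fun p => `|phi p - chi p|) <= e]) ->
  grid_approximable phi.
Proof.
move=> bphi H e e0; have e20 : 0 < e / 2 by rewrite divr_gt0.
have [chi [bchi Hchi d]] := H _ e20; have [N HN] := Hchi _ e20.
exists N => n /HN[v Hv]; exists v.
rewrite [leRHS](splitr e); apply: le_trans (lerD d Hv).
rewrite -meanD; [|by apply: bm_norm; exact: bmB|exact: bm_err].
apply: mean_le; first exact: bm_err.
  by apply: bmD; [apply: bm_norm; exact: bmB|exact: bm_err].
by move=> p _; rewrite (le_trans _ (ler_normD _ _))// addrA subrK.
Qed.

Lemma grid_approximable_sum (I : Type) (r : seq I) (F : I -> R * R -> R) :
  (forall i, bounded_measurable (F i)) -> (forall i, grid_approximable (F i)) ->
  grid_approximable (fun p => \sum_(i <- r) F i p).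
Proof.
move=> bF HF; elim: r => [|i r IH].
  by under eq_fun do rewrite big_nil; exact: grid_approximable_cst.
under eq_fun do rewrite big_cons.
by apply: grid_approximableD => //; exact: bm_sum.
Qed.

Let clamp (x : R) := Num.max 0 (Num.min x 1).

Let clamp_range x : 0 <= clamp x <= 1.
Proof. by rewrite /clamp le_max lexx/= ge_max ler01 ge_min lexx orbT. Qed.

Let clamp_near (a x : R) : 0 <= a <= 1 -> `|a - clamp x| <= `|a - x|.
Proof.
move=> /andP[a0 a1]; rewrite /clamp /Num.max /Num.min.
case: (ltP x 1) => x1; last first.
  by rewrite ltr01 [leLHS]distrC [leRHS]distrC !ger0_norm; lra.
by case: ltP => // x0; rewrite subr0 !ger0_norm; lra.
Qed.

Lemma grid_approximable_range phi : bounded_measurable phi ->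
  (forall p, square p -> 0 <= phi p <= 1) -> grid_approximable phi ->
  forall e : R, 0 < e -> exists N, forall n, (N <= n)%N ->
    exists2 v : 'I_n.+1 -> 'I_n.+1 -> R, forall i j, 0 <= v i j <= 1 &
      mean (fun p => `|phi p - v (cell n p.1) (cell n p.2)|) <= e.
Proof.
move=> bphi phi01 H e e0; have [N HN] := H e e0.
exists N => n /HN[v Hv]; exists (fun i j => clamp (v i j)) => [i j|].
  exact: clamp_range.
apply: le_trans Hv; apply: mean_le.
- exact: (@bm_err _ n (fun i j => clamp (v i j))).
- exact: bm_err.
- by move=> p /phi01; exact: clamp_near.
Qed.

Lemma grid_approximableM phi chi :
  bounded_measurable phi -> bounded_measurable chi ->
  (forall p, square p -> 0 <= phi p <= 1) ->
  (forall p, square p -> 0 <= chi p <= 1) ->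
  grid_approximable phi -> grid_approximable chi ->
  grid_approximable (fun p => phi p * chi p).
Proof.
move=> bphi bchi phi01 chi01 Hphi Hchi e e0.
have e20 : 0 < e / 2 by rewrite divr_gt0.
have [N1 H1] := grid_approximable_range bphi phi01 Hphi e20.
have [N2 H2] := grid_approximable_range bchi chi01 Hchi e20.
exists (maxn N1 N2) => n; rewrite geq_max => /andP[/H1[v v01 Hv] /H2[w w01 Hw]].
exists (fun i j => v i j * w i j).
rewrite [leRHS](splitr e); apply: le_trans (lerD Hv Hw).
rewrite -meanD; [|exact: bm_err|exact: bm_err].
apply: mean_le.
- by apply: (@bm_err _ n (fun i j => v i j * w i j)); exact: bmM.
- by apply: bmD; exact: bm_err.
move=> p sp; set a := v _ _; set b := w _ _.
have -> : phi p * chi p - a * b = (phi p - a) * chi p + a * (chi p - b) by ring.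
apply: (le_trans (ler_normD _ _)); rewrite !normrM.
have /andP[? ?] := chi01 p sp; have /andP[? ?] := v01 (cell n p.1) (cell n p.2).
by rewrite lerD// ?ler_piMr ?ler_piMl// ger0_norm.
Qed.

Lemma grid_approximable_setC B : measurable B ->
  grid_approximable (\1_B) -> grid_approximable (\1_(~` B)).
Proof.
move=> mB HB; have bB := bm_indic mB.
rewrite (_ : \1_(~` B) = (fun p => cst 1 p + -1 * \1_B p) :> (R * R -> R)).
  apply: grid_approximableD; first exact: bm_cst.
  - exact: bmZ.
  - exact: grid_approximable_cst.
  - exact: grid_approximableZ.
apply/funext => p; rewrite !indicE in_setC mulN1r /cst.
by case: (p \in B); rewrite /= ?subrr ?subr0.
Qed.

(** With grid_approximable_setC this makes the approximable sets a Dynkin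
    system. *)
Lemma grid_approximable_bigcup (F : nat -> set (R * R)) :
  (forall k, measurable (F k)) -> trivIset [set: nat] F ->
  (forall k, grid_approximable (\1_(F k))) ->
  grid_approximable (\1_(\bigcup_k F k)).
Proof.
move=> mF tF HF.
have bF k : bounded_measurable (\1_(F k) : R * R -> R) by exact: bm_indic.
have bU : bounded_measurable (\1_(\bigcup_k F k) : R * R -> R).
  by apply: bm_indic; exact: bigcup_measurable.
pose S k (p : R * R) := \sum_(0 <= i < k) \1_(F i) p : R.
have bS k : bounded_measurable (S k) by exact: bm_sum.
have S1 k p j : F j p -> S k p = (j < k)%N%:R.
  move=> Fjp; rewrite /S; elim: k => [|k IH]; first by rewrite big_geq.
  rewrite big_nat_recr//= IH indicE; have [->|kj] := eqVneq k j.
    by rewrite mem_set// ltnn ltnSn add0r.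
  rewrite memNset ?addr0; first by rewrite ltnS [in RHS]leq_eqVlt eq_sym (negPf kj).
  by move=> Fkp; move/eqP: kj; apply; apply: tF => //; exists p.
have S0 k p : ~ (\bigcup_k F k) p -> S k p = 0.
  move=> Up; rewrite /S big1// => i _; rewrite indicE memNset// => Fip.
  by apply: Up; exists i.
apply: grid_approximable_lim => // e e0.
have SM k p : square p -> `|S k p| <= 1.
  move=> _; have [[j _ /S1 ->]|/S0->] := pselect ((\bigcup_k F k) p).
    by case: (j < k)%N; rewrite ?normr1 ?normr0.
  by rewrite normr0.
have Scvg : {ae lebesgue2 R, forall p, square p ->
    S ^~ p @ \oo --> (\1_(\bigcup_k F k) p : R)}.
  apply: aeW => p _; have [[j _ Fjp]|Up] := pselect ((\bigcup_k F k) p).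
    rewrite indicE mem_set; last by exists j.
    apply: cvg_near_cst; exists j.+1 => // k /= jk.
    by rewrite (S1 _ _ _ Fjp) jk.
  rewrite indicE memNset//; apply: cvg_near_cst; exists 0%N => // k _.
  by rewrite S0.
have [K HK] := mean_bounded_convergence bS bU SM Scvg e0.
exists (S K); split => //; first exact: grid_approximable_sum.
have := HK _ (leqnn K); rewrite (@eq_mean _ _ (fun p => `|\1_(\bigcup_k F k) p - S K p|))//.
by move=> p _; rewrite distrC.
Qed.

End grid_approximation.

Section step_graphon_approximation.
Context {R : realType}.
Implicit Types (phi chi : R * R -> R) (X Y : set R) (B : set (R * R)).

Let mR : measurableType _ := measurableTypeR R.

Lemma exists_invn_le (e : R) : 0 < e ->
  exists N, forall n, (N <= n)%N -> (n.+1%:R)^-1 <= e.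
Proof.
move=> e0; exists (Num.truncn e^-1) => n Nn.
rewrite -[leRHS]invrK lef_pV2 ?posrE ?invr_gt0 ?ltr0n//.
apply: (le_trans (ltW (truncnS_gt _))).
by rewrite ler_nat.
Qed.

(** Only the cell that contains a is cut by the line of abscissa a. *)
Lemma grid_approximable_ray (a : R) :
  grid_approximable (\1_(`]-oo, a[%classic `*` [set: R]) : R * R -> R).
Proof.
move=> e e0; have e20 : 0 < e / 2 by rewrite divr_gt0.
have [N HN] := exists_invn_le e20.
exists N => n Nn; exists (fun i _ => (i%:R + 1 <= n.+1%:R * a)%R%:R).
have n0 : 0 < n.+1%:R :> R by rewrite ltr0n.
pose E : set R := unitI `&` `[a - n.+1%:R^-1, a].
have mE : measurable E.
  by apply: measurableI; [exact: measurable_unitI|exact: measurable_itv].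
have EI : E `<=` unitI by move=> x [].
have lE : fine (lebesgue_measure E) <= n.+1%:R^-1.
  have : (lebesgue_measure E <= (n.+1%:R^-1)%:E)%E.
    apply: (@le_trans _ _ (lebesgue_measure (`[a - n.+1%:R^-1, a] : set R))).
      by apply: le_measure; rewrite ?inE// => x [].
    rewrite lebesgue_measure_itv/= lte_fin ltrBlDr ltrDl invr_gt0 n0 -EFinD lee_fin.
    by rewrite opprD opprK addrA subrr add0r.
  by rewrite -{1}(fineK (lebesgue_fin mE EI)) lee_fin.
set phi := (\1__ : R * R -> R).
have bphi : bounded_measurable phi.
  by apply: bm_indic; apply: measurableX => //; exact: measurable_itv.
pose u (p : R * R) : R := phi p - ((cell n p.1)%:R + 1 <= n.+1%:R * a)%R%:R.
have bu : bounded_measurable u.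
  apply: bmB => //.
  exact: (bm_cell (fun i _ : 'I_n.+1 => (i%:R + 1 <= n.+1%:R * a)%R%:R)).
apply: (@le_trans _ _ (0 + 2 * 1 * fine (lebesgue_measure E))); last first.
  by rewrite add0r mulr1 -ler_pdivlMl// mulrC (le_trans lE)// HN.
have uE x y : u (x, y) = (x < a)%R%:R - ((cell n x)%:R + 1 <= n.+1%:R * a)%R%:R.
  rewrite /u /phi indicE; congr (_ - _); congr (nat_of_bool _)%:R.
  by apply/idP/idP; rewrite !inE/= in_itv/=; [case|].
apply: (mean_exception bu) => //.
  move=> [x y] _; rewrite uE; case: (x < a); case: (_ + 1 <= _);
    by rewrite /= ?subrr ?subr0 ?sub0r ?normrN ?normr0 ?normr1 ?ler01.
move=> x y xI yI xE _; rewrite uE.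
have := cell_eq (cell n x) xI; rewrite eqxx => /esym.
set i := cell n x => iP.
have x_le : n.+1%:R * x <= i%:R + 1.
  by case/orP: iP => [/andP[]//|/andP[/eqP-> /eqP->]]; rewrite mulr0 add0r.
have x_ge : i%:R <= n.+1%:R * x.
  by case/orP: iP => [/andP[/ltW]//|/andP[/eqP-> /eqP->]]; rewrite mulr0.
have [xa|ax] := ltP x a.
  have xlt : x < a - n.+1%:R^-1.
    by rewrite ltNge; apply/negP => ?; apply: xE; split => //=; rewrite in_itv/= (ltW xa) andbT.
  have : i%:R + 1 <= n.+1%:R * a.
    apply: (@le_trans _ _ (n.+1%:R * (x + n.+1%:R^-1))).
      by rewrite mulrDr divff ?gt_eqF// lerD2r.
    by rewrite ler_pM2l// -lerBrDr ltW.
  by move=> ->; rewrite subrr normr0.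
have alt : a < x.
  rewrite lt_neqAle ax andbT; apply/eqP => aE; apply: xE; split => //=.
  by rewrite in_itv/= -aE lexx andbT lerBlDr lerDl invr_ge0.
have /negbTE -> : ~~ (i%:R + 1 <= n.+1%:R * a).
  by rewrite -ltNge (lt_le_trans _ x_le)// ltr_pM2l.
by rewrite subrr normr0.
Qed.

Lemma grid_approximable_swap phi : bounded_measurable phi ->
  grid_approximable phi -> grid_approximable (fun p => phi (p.2, p.1)).
Proof.
move=> bphi H e e0; have [N HN] := H e e0.
exists N => n /HN[v Hv]; exists (fun i j => v j i).
have b : bounded_measurable (fun p => `|phi p - v (cell n p.1) (cell n p.2)|).
  by apply: bm_norm; apply: bmB => //; exact: bm_cell.
by rewrite -(mean_swap b) in Hv.
Qed.

Let setX_setC X : (~` X) `*` [set: R] = ~` (X `*` [set: R]).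
Proof.
apply/seteqP; split => -[x y] /=; first by move=> [? _] [].
by move=> H; split => // Xx; exact: H.
Qed.

Lemma grid_approximable_strip X : measurable X ->
  grid_approximable (\1_(X `*` [set: R]) : R * R -> R).
Proof.
have mE : @measurable _ mR = <<s @RGenInftyO.G R >> := RGenInftyO.measurableE R.
have := @dynkin_induction _ mR (@RGenInftyO.G R)
  (fun X => grid_approximable (\1_(X `*` [set: R]) : R * R -> R)) mE.
move=> H mX; apply: H; last by rewrite -mE.
- move=> _ _ [x ->] [y ->]; exists (Num.min x y).
  by apply/seteqP; split => z /=; rewrite !in_itv/= lt_min => /andP.
- rewrite setXTT indicT; exact: grid_approximable_cst.
- move=> _ [a ->]; exact: grid_approximable_ray.
- move=> S mS HS; rewrite setX_setC//; apply: grid_approximable_setC => //.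
  exact: measurableX.
- move=> F mF tF HF; rewrite setX_bigcupl; apply: grid_approximable_bigcup => //.
    by move=> k; apply: measurableX; [exact: mF|exact: measurableT].
  move=> i j _ _ [[x y] [[/= Fix _] [Fjx _]]].
  by apply: tF => //; exists x.
Qed.

(** Products of approximable functions being approximable, strips give all
    rectangles, which generate the measurable sets of the plane. *)
Lemma grid_approximable_set B : measurable B ->
  grid_approximable (\1_B : R * R -> R).
Proof.
have mE : @measurable _ (mR * mR)%type =
    <<s [set A `*` B | A in @measurable _ mR & B in @measurable _ mR] >>.
  exact: measurable_prod_measurableType.
move=> mB; apply: (@dynkin_induction _ (mR * mR)%type _
  (fun B => grid_approximable (\1_B : R * R -> R)) mE); last by rewrite -mE.
- move=> _ _ [X1 mX1 [Y1 mY1 <-]] [X2 mX2 [Y2 mY2 <-]].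
  exists (X1 `&` X2); first exact: measurableI.
  by exists (Y1 `&` Y2); [exact: measurableI|rewrite setXI].
- rewrite indicT; exact: grid_approximable_cst.
- move=> _ [X mX [Y mY <-]].
  rewrite (_ : \1_(X `*` Y) = (fun p => \1_(X `*` [set: R]) p *
    \1_(Y `*` [set: R]) (p.2, p.1)) :> (R * R -> R)); last first.
    apply/funext => -[x y]; rewrite !indicE -natrM mulnb; congr (nat_of_bool _)%:R.
    apply/idP/andP; rewrite !inE => -[] //=.
    by move=> [? _] [? _].
  have bX : bounded_measurable (\1_(X `*` [set: R]) : R * R -> R).
    by apply: bm_indic; exact: measurableX.
  have bY : bounded_measurable (\1_(Y `*` [set: R]) : R * R -> R).
    by apply: bm_indic; exact: measurableX.
  have bY' : bounded_measurable (fun p : R * R => \1_(Y `*` [set: R]) (p.2, p.1) : R).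
    rewrite (_ : (fun _ => _) = \1_([set: R] `*` Y)); last first.
      apply/funext => -[x y]; rewrite !indicE; congr (nat_of_bool _)%:R.
      by apply/idP/idP; rewrite !inE => -[].
    by apply: bm_indic; exact: measurableX.
  have r01 (C : set (R * R)) p : 0 <= (\1_C p : R) <= 1.
    by rewrite indicE ler0n lern1 leq_b1.
  apply: grid_approximableM => //.
    exact: grid_approximable_strip.
  apply: (grid_approximable_swap bY); exact: grid_approximable_strip.
- by move=> S mS HS; exact: grid_approximable_setC.
- by move=> F mF tF HF; exact: grid_approximable_bigcup.
Qed.

Let layer_sum (z : R) K : 0 <= z ->
  [/\ \sum_(0 <= j < K) (j.+1%:R <= z)%R%:R <= z,
      \sum_(0 <= j < K) (j.+1%:R <= z)%R%:R <= K%:R :> R &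
      Num.min (z - 1) K%:R <= \sum_(0 <= j < K) (j.+1%:R <= z)%R%:R].
Proof.
move=> z0; elim: K => [|K [IH1 IH2 IH3]].
  by rewrite big_geq//; split => //; rewrite ge_min lexx orbT.
rewrite big_nat_recr//=; set S := \sum_(0 <= j < K) _ in IH1 IH2 IH3 *.
rewrite -natr1; have [Kz|zK] := leP (K%:R + 1) z.
  rewrite ge_min in IH3; rewrite /= ge_min; split; [lra|lra|].
  by apply/orP; right; case/orP: IH3; lra.
rewrite /= addr0; split; [lra|lra|].
by rewrite ge_min in IH3; rewrite ge_min; apply/orP; left; case/orP: IH3; lra.
Qed.

(** A graphon is within 1 / K of the average of the indicators of its K
    superlevel sets. *)
Lemma grid_approximable_graphon (h : graphon R) : grid_approximable h.
Proof.
apply: grid_approximable_lim => // e e0.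
have [K HK] := exists_invn_le e0.
have {}HK := HK _ (leqnn K).
have K0 : 0 < K.+1%:R :> R by rewrite ltr0n.
pose B j : set (R * R) := square `&` [set p | j.+1%:R <= K.+1%:R * h p].
have mB j : measurable (B j).
  have mh : measurable_fun square (fun p => K.+1%:R * h p).
    by case: (bmZ K.+1%:R (bm_graphon h)).
  have := mh measurable_square `[j.+1%:R, +oo[%classic (measurable_itv _).
  rewrite (_ : _ `&` _ = B j)//.
  by apply/seteqP; split => p [sp] /=; rewrite in_itv/= andbT.
pose chi p := K.+1%:R^-1 * \sum_(0 <= j < K.+1) (\1_(B j) p : R).
have bB j : bounded_measurable (\1_(B j) : R * R -> R) by exact: bm_indic.
have bchi : bounded_measurable chi by apply: bmZ; exact: bm_sum.
exists chi; split => //.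
  apply: grid_approximableZ; first exact: bm_sum.
  by apply: grid_approximable_sum => // j; exact: grid_approximable_set.
apply: (le_trans _ HK); rewrite -[leRHS]mean_cst; apply: mean_le.
- by apply: bm_norm; exact: bmB.
- exact: bm_cst.
move=> [x y] [/= xI yI]; have /andP[h0 h1] := graphon_range h xI yI.
have z0 : 0 <= K.+1%:R * h (x, y) by rewrite mulr_ge0.
have [+ _] := layer_sum K.+1 z0; rewrite /chi.
have -> : \sum_(0 <= j < K.+1) (j.+1%:R <= K.+1%:R * h (x, y))%R%:R =
  \sum_(0 <= j < K.+1) (\1_(B j) (x, y) : R).
  apply: eq_bigr => j _; rewrite indicE; congr (nat_of_bool _)%:R.
  by apply/idP/idP; rewrite inE /B/=; [split|case].
set S := \sum_(0 <= j < K.+1) _; rewrite ge_min => S1 S2.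
have {}S2 : K.+1%:R * h (x, y) - 1 <= S.
  case/orP: S2 => // S2; apply: (le_trans _ S2).
  by have : K.+1%:R * h (x, y) <= K.+1%:R by [rewrite ler_piMr]; lra.
rewrite -(ler_pM2l K0) divff ?gt_eqF// -[X in X * _]ger0_norm// -normrM mulrBr.
by rewrite mulrA divff ?gt_eqF// mul1r ler_norml; apply/andP; split; lra.
Qed.

Theorem step_graphon_dense (h : graphon R) (e : R) : 0 < e ->
  exists N, forall n, (N <= n)%N ->
    exists w : weights n, l1_dist h (step_graphon w) <= e.
Proof.
move=> e0.
have h01 p : square p -> 0 <= h p <= 1.
  by case: p => x y [/= xI yI]; exact: graphon_range.
have [N HN] := grid_approximable_range (bm_graphon h) h01
  (grid_approximable_graphon h) e0.
exists N => n /HN[v v01 Hv].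
have s i j : (v i j + v j i) / 2 = (v j i + v i j) / 2 by rewrite addrC.
have r i j : 0 <= (v i j + v j i) / 2 <= 1.
  by have := v01 i j; have := v01 j i; lra.
exists (Weights s r).
have b : bounded_measurable (fun p => `|h p - v (cell n p.1) (cell n p.2)|).
  by apply: bm_norm; apply: bmB => //; exact: bm_cell.
have b' : bounded_measurable (fun p => `|h p - v (cell n p.2) (cell n p.1)|).
  by apply: bm_norm; apply: bmB => //; exact: (bm_cell (fun i j => v j i)).
have Hv' : mean (fun p => `|h p - v (cell n p.2) (cell n p.1)|) <= e.
  rewrite -(mean_swap b) in Hv; apply: le_trans Hv; rewrite le_eqVlt.
  apply/orP; left; apply/eqP; apply: eq_mean => -[x y] [/= xI yI].
  by rewrite (graphon_sym h xI yI).
apply: (@le_trans _ _ (mean (fun p =>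
    2^-1 * `|h p - v (cell n p.1) (cell n p.2)| +
    2^-1 * `|h p - v (cell n p.2) (cell n p.1)|))); last first.
  by rewrite (meanD (bmZ _ b) (bmZ _ b')) (meanZ _ b) (meanZ _ b'); lra.
apply: mean_le; first by apply: bm_norm; exact: bmB.
  by apply: bmD; exact: bmZ.
move=> p _; rewrite /=; set x := v _ _; set y := v _ _.
have -> : h p - (x + y) / 2 = 2^-1 * (h p - x) + 2^-1 * (h p - y) by field.
by apply: (le_trans (ler_normD _ _)); rewrite !normrM (@ger0_norm _ 2^-1).
Qed.

End step_graphon_approximation.

(** * The rate depends only on the class of a graphon *)

Section rate_of_class.
Context {R : realType}.
Implicit Types f g h : graphon R.

Lemma half_pow_small (e : R) : 0 < e ->
  exists K, forall k, (K <= k)%N -> (2^-1 : R) ^+ k <= e.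
Proof.
move=> /exists_invn_le[K HK]; exists K => k /HK; apply: le_trans.
rewrite exprVn lef_pV2 ?posrE ?ltr0n ?exprn_gt0//.
by rewrite -natrX ler_nat ltn_expl.
Qed.

(** The difference u = f - g integrates to 0 over all rectangles, hence is
    orthogonal to all step functions; these approximate u, so u ^ 2 has
    integral 0. *)
Lemma cut_dist0_l1 f g : cut_dist f g = 0 -> l1_dist f g = 0.
Proof.
move=> fg0; pose u p := f p - g p : R.
have bu : bounded_measurable u by exact: bmB.
have u1 p : square p -> `|u p| <= 1.
  case: p => x y [/= xI yI].
  have := graphon_range f xI yI; have := graphon_range g xI yI.
  by rewrite /u ler_norml; lra.
have orth n (v : 'I_n.+1 -> 'I_n.+1 -> R) :
    mean (fun p => u p * v (cell n p.1) (cell n p.2)) = 0.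
  pose C (i : 'I_n.+1) : set R := unitI `&` cell_set i.
  have mC i : measurable (C i).
    by apply: measurableI; [exact: measurable_unitI|exact: measurable_cell_set].
  have CI i : C i `<=` unitI by move=> x [].
  have b i j : bounded_measurable (fun p => u p * \1_(C i `*` C j) p).
    by apply: bmM => //; apply: bm_indic; exact: measurableX.
  rewrite (@eq_mean _ _ (fun p => \sum_i \sum_j v i j *
      (u p * \1_(C i `*` C j) p))); last first.
    move=> p sp; have := cell_decomp v unitI unitI sp.
    rewrite indicE mem_set// mulr1 => ->; rewrite mulr_sumr.
    apply: eq_bigr => i _; rewrite mulr_sumr; apply: eq_bigr => j _.
    by rewrite mulrCA.
  rewrite mean_sum => [|i]; last by apply: bm_sum => j; exact: bmZ.
  rewrite big1// => i _; rewrite mean_sum => [|j]; last exact: bmZ.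
  rewrite big1// => j _; rewrite meanZ// -Rintegral_rect//.
  have := cut_dist_ub f g (mC i) (@CI i) (mC j) (@CI j).
  by rewrite fg0 normr_le0 => /eqP->; rewrite mulr0.
have bu2 : bounded_measurable (fun p => u p ^+ 2) by apply: bmM.
have small (e : R) : 0 < e -> mean (fun p => u p ^+ 2) <= e.
  move=> e0.
  have au : grid_approximable u.
    rewrite (_ : u = fun p => f p + -1 * g p); last first.
      by apply/funext => p; rewrite mulN1r.
    apply: grid_approximableD => //; first exact: bmZ.
      exact: grid_approximable_graphon.
    by apply: grid_approximableZ => //; exact: grid_approximable_graphon.
  have [N HN] := au e e0; have [v Hv] := HN _ (leqnn N).
  have bv : bounded_measurable (fun p : R * R => v (cell N p.1) (cell N p.2)).
    exact: bm_cell.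
  apply: le_trans Hv; rewrite -[leLHS]subr0 -(orth N v) -meanB//; last exact: bmM.
  apply: mean_le; [by apply: bmB => //; exact: bmM|by apply: bm_norm; exact: bmB|].
  move=> p sp; rewrite expr2 -mulrBr; apply: (le_trans (ler_norm _)).
  by rewrite normrM ler_piMl// u1.
apply/eqP; rewrite eq_le l1_dist_ge0 andbT; apply/ler_addgt0Pr => e e0.
rewrite add0r; apply: mean_norm_le_sqr => //.
by apply: small; rewrite exprn_gt0.
Qed.

Lemma graphon_rate_cut0 f g : cut_dist f g = 0 -> graphon_rate f = graphon_rate g.
Proof.
move=> /cut_dist0_l1 fg0; apply/eqP; rewrite -subr_eq0 -normr_le0.
apply/ler_addgt0Pr => e e0; rewrite add0r.
apply: (@le_trans _ _ (Num.min e 1)); last by rewrite ge_min lexx.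
have := @graphon_rate_modulus _ f g (Num.min e 1).
rewrite fg0 mulr0 addr0; apply.
by rewrite lt_min e0 ltr01 ge_min lexx orbT.
Qed.

(** The entropy of a graphon takes values in [-1, 0], so its opposite is again a
    graphon: the invariance of the rate under rearrangement becomes that of an
    integral over a rectangle. *)
Definition entropy_graphon g : graphon R.
Proof.
refine (@Graphon R (fun p => - entropy (g p)) _ _ _).
- by case: (bmN (bm_entropy g)).
- by move=> x y xI yI; rewrite (graphon_sym g xI yI).
- move=> x y xI yI.
  have := @graphon_entropy_range _ g (x, y) (conj xI yI); lra.
Defined.

Definition zero_graphon : graphon R.
Proof.
refine (@Graphon R (cst 0) _ _ _) => //.
by move=> x y _ _; rewrite lexx ler01.
Defined.

Lemma graphon_rate_act g (s : mp_bij R) :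
  graphon_rate (graphon_act g s) = graphon_rate g.
Proof.
have mI := @measurable_unitI R.
have := rect_act (entropy_graphon g) zero_graphon s mI (@subset_refl _ _)
  mI (@subset_refl _ _).
have -> : s @` unitI = unitI.
  apply/seteqP; split => [_ [x xI <-]|y yI]; first exact: mp_bijI.
  by have [x xI <-] := mp_bij_surj s yI; exists x.
have E f : mean (fun p => entropy (f p)) = - mean (fun p => entropy_graphon f p - 0).
  rewrite -mulN1r -meanZ; last by apply: bmB => //; exact: bm_cst.
  by apply: eq_mean => p _; rewrite subr0 mulN1r opprK.
move=> H; rewrite !graphon_rate_mean.
apply: (etrans (E (graphon_act g s))); apply: (etrans _ (esym (E g))).
by congr (- _).
Qed.

(** Rearrangements of g, which all have the rate of g, converge to f in the cut
    distance, and cut_limit finds a limit whose rate is not larger. *)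
Lemma graphon_rate_le_orbit f g : orbit_dist f g = 0 ->
  graphon_rate f <= graphon_rate g.
Proof.
move=> fg0.
have ex k : exists s, cut_dist f (graphon_act g s) < 2^-1 ^+ k.+1.
  by apply/orbit_distP; rewrite fg0 exprn_gt0.
have [s Hs] := choice ex.
pose F k := graphon_act g (s k).
have {}Hs k : cut_dist f (F k) < 2^-1 ^+ k.+1 by exact: Hs.
have FF k : cut_dist (F k) (F k.+1) <= 2^-1 ^+ k.
  have := cut_dist_triangle f (F k) (F k.+1); rewrite (cut_dist_sym (F k) f).
  have := Hs k; have := Hs k.+1; rewrite !exprS.
  have : 0 <= (2^-1 : R) ^+ k by rewrite exprn_ge0.
  lra.
have Fc k : graphon_rate (F k) <= graphon_rate g by rewrite graphon_rate_act.
have [h fh hc] := cut_limit FF Fc.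
rewrite (_ : graphon_rate f = graphon_rate h)//; apply: graphon_rate_cut0.
apply/eqP; rewrite eq_le cut_dist_ge0 andbT; apply/ler_addgt0Pr => e e0.
have e40 : 0 < e / 4 by rewrite divr_gt0.
have [K HK] := half_pow_small e40.
have := cut_dist_triangle (F K) f h; have := fh K; have := Hs K.
have := HK _ (leqnn K); rewrite exprS.
have : 0 <= (2^-1 : R) ^+ K by rewrite exprn_ge0.
lra.
Qed.

Lemma rate_graphon_class g : rate (graphon_class g) = graphon_rate g.
Proof.
rewrite /rate; set f := graphon_repr _.
have fg : orbit_dist f g = 0 by apply/graphon_classP; exact: graphon_reprK.
apply/eqP; rewrite eq_le graphon_rate_le_orbit//=.
by rewrite graphon_rate_le_orbit// orbit_dist_sym.
Qed.

End rate_of_class.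

(** * Relabelling the vertices of a step graphon *)

Section translation.
Context {R : realType}.
Let mR : measurableType _ := measurableTypeR R.
Let tr (t : R) (x : mR) : mR := x + t.

Lemma measurable_translation t : measurable_fun [set: mR] (tr t).
Proof. exact: measurable_funD. Qed.

Lemma lebesgue_measure_translation (t : R) (A : set R) : measurable A ->
  lebesgue_measure ((fun x => x + t) @^-1` A) = lebesgue_measure A.
Proof.
move=> mA; apply/esym.
pose m := measure_function_pushforward__canonical__measure_function_Measure
  (@lebesgue_measure R) (measurable_translation t).
apply: (lebesgue_measure_unique (mu := m)) => // X [[a b] _ <-].
rewrite /m /= /pushforward.
have -> : tr t @^-1` `]a, b]%classic = `]a - t, b - t]%classic :> set R.
  by apply/seteqP; split => x /=; rewrite !in_itv/= ltrBlDr lerBrDr.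
rewrite !lebesgue_measure_itv/= !lte_fin ltrD2r.
by case: ifP => // _; rewrite -!EFinB; congr EFin; ring.
Qed.

End translation.

Section relabelling.
Context {R : realType}.
Variable n : nat.
Let N := n.+1.
Let N0 : 0 < N%:R :> R. Proof. by rewrite ltr0n. Qed.
Implicit Type s : {perm 'I_N}.

Let ocell (i : 'I_N) : set R := `](i%:R / N%:R), ((i%:R + 1) / N%:R)].

Let ocellP (i : 'I_N) (x : R) :
  ocell i x <-> (i%:R < N%:R * x) && (N%:R * x <= i%:R + 1).
Proof. by rewrite /ocell/= in_itv/= ltr_pdivrMr// ler_pdivlMr// ![x * _]mulrC. Qed.

Let ocell_unit (i : 'I_N) (x : R) : ocell i x -> [/\ unitI x, x != 0 & cell n x = i].
Proof.
move=> /ocellP/andP[x0 x1].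
have i0 : 0 <= i%:R :> R by rewrite ler0n.
have iN : i%:R + 1 <= N%:R :> R by rewrite natr1 ler_nat.
have xpos : 0 < x by rewrite -(pmulr_rgt0 _ N0) (le_lt_trans i0).
have xI : unitI x.
  by rewrite /unitI/= in_itv/= ltW//= -(ler_pM2l N0) mulr1 (le_trans x1).
split => //; first by rewrite gt_eqF.
by apply/eqP; rewrite cell_eq// x0 x1.
Qed.

Let cell_ocell (x : R) : unitI x -> x != 0 -> ocell (cell n x) x.
Proof.
move=> xI xN0; apply/ocellP.
by have := cell_eq (cell n x) xI; rewrite eqxx (negPf xN0) orbF => <-.
Qed.

Let shift s (i : 'I_N) : R := ((s i)%:R - i%:R) / N%:R.

Let relabel s (x : R) : R := if x == 0 then 0 else x + shift s (cell n x).

Let shift_ocell s i x : ocell i x <-> ocell (s i) (x + shift s i).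
Proof.
have e : N%:R * (x + shift s i) = N%:R * x + ((s i)%:R - i%:R).
  by rewrite mulrDr /shift mulrCA divff ?gt_eqF// mulr1.
split=> /ocellP/andP[H1 H2]; apply/ocellP; rewrite e in H1 H2 *; apply/andP; split; lra.
Qed.

Let relabel_ocell s x : unitI x -> x != 0 -> ocell (s (cell n x)) (relabel s x).
Proof.
move=> xI xN0; rewrite /relabel (negPf xN0).
by apply/(shift_ocell s (cell n x) x).1; exact: cell_ocell.
Qed.

Let cell_relabel s x : unitI x -> x != 0 -> cell n (relabel s x) = s (cell n x).
Proof. by move=> xI xN0; have [] := ocell_unit (relabel_ocell s xI xN0). Qed.

Let relabel0 s : relabel s 0 = 0. Proof. by rewrite /relabel eqxx. Qed.

Let relabelI s x : unitI x -> unitI (relabel s x).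
Proof.
move=> xI; have [->|xN0] := eqVneq x 0; last first.
  by have [] := ocell_unit (relabel_ocell s xI xN0).
by rewrite relabel0 /unitI/= in_itv/= lexx ler01.
Qed.

Let relabelK s x : unitI x -> relabel s^-1%g (relabel s x) = x.
Proof.
move=> xI; have [->|xN0] := eqVneq x 0; first by rewrite !relabel0.
have [_ rN0 rc] := ocell_unit (relabel_ocell s xI xN0).
rewrite {1}/relabel (negPf rN0) rc /shift permK /relabel (negPf xN0) /shift.
by rewrite -addrA -mulrDl addrA subrK subrr mul0r addr0.
Qed.

Let relabelVK s x : unitI x -> relabel s (relabel s^-1%g x) = x.
Proof. by move=> xI; rewrite -{1}[s]invgK relabelK. Qed.

Let measurable_ocell i : measurable (ocell i).
Proof. exact: measurable_itv. Qed.

Let ocells (A : set R) : A `<=` unitI ->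
  A `\` [set 0] = \big[setU/set0]_(i < N) (A `&` ocell i).
Proof.
move=> AI; rewrite -bigcup_mkord_ord; apply/seteqP; split => [x [Ax x0]|x].
  have xN0 : x != 0 by apply/eqP.
  exists (nat_of_ord (cell n x)) => /=; first exact: ltn_ord.
  rewrite inord_val; split => //; apply: cell_ocell => //; exact: AI.
move=> [i /= iN [Ax /ocell_unit[_ xN0 _]]]; split => //.
exact/eqP.
Qed.

Let trivIset_ocells (A : set R) : trivIset [set: 'I_N] (fun i => A `&` ocell i).
Proof.
move=> i j _ _ [x [[_ /ocell_unit[_ _ <-]] [_ /ocell_unit[_ _ <-]]]].
by [].
Qed.

Let lebesgue_ocells (A : set R) : measurable A -> A `<=` unitI ->
  lebesgue_measure A = (\sum_(i < N) lebesgue_measure (A `&` ocell i))%E.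
Proof.
move=> mA AI.
have mAi i : measurable (A `&` ocell i) by exact: measurableI.
rewrite -(measure_bigsetU_ord lebesgue_measure xpredT mAi (@trivIset_ocells A)).
rewrite -ocells//.
have mA0 : measurable (A `\` [set 0]) by apply: measurableD.
have ms : measurable ([set 0] : set R) by exact: measurable_set1.
apply/eqP; rewrite eq_le; apply/andP; split; last first.
  by apply: le_measure; [exact: mem_set|exact: mem_set|move=> x []].
rewrite -[leRHS]adde0 -(lebesgue_measure_set1 (0 : R)).
have := measureU2 (@lebesgue_measure R) mA0 ms; apply: le_trans.
apply: le_measure; [exact: mem_set|by apply: mem_set; exact: measurableU|].
move=> x Ax; have [x0|x0] := pselect (x = 0); [by right|by left].
Qed.

Let preimage_ocell s (B : set R) i :
  unitI `&` relabel s @^-1` B `&` ocell i =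
  (fun x => x + shift s i) @^-1` (B `&` ocell (s i)).
Proof.
apply/seteqP; split => x /=.
  move=> [[xI Bx] ox]; have [_ xN0 xc] := ocell_unit ox.
  move: Bx; rewrite /relabel (negPf xN0) xc => Bx.
  by split => //; exact/(shift_ocell s i x).1.
move=> [Bx /(shift_ocell s i x).2 ox]; have [xI xN0 xc] := ocell_unit ox.
by split => //; split => //; rewrite /relabel (negPf xN0) xc.
Qed.

Let measurable_relabel s : measurable_fun unitI (relabel s).
Proof.
move=> _ B mB.
have -> : unitI `&` relabel s @^-1` B =
    (unitI `&` relabel s @^-1` B `&` [set 0]) `|`
    \big[setU/set0]_(i < N) (unitI `&` relabel s @^-1` B `&` ocell i).
  rewrite -ocells; last by move=> x [].
  by rewrite setUC setDE -setIUr setUC setUv setIT.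
apply: measurableU.
  have [B0|B0] := pselect (B 0).
    rewrite (_ : _ `&` _ = [set 0])//; apply/seteqP; split => x; first by case.
    move=> /= ->; split => //; split; last by rewrite relabel0.
    by rewrite /unitI/= in_itv/= lexx ler01.
  rewrite (_ : _ `&` _ = set0)//; apply/seteqP; split => x //.
  by move=> [[_ /= +] /= x0]; rewrite x0 relabel0.
apply: bigsetU_measurable => i _; rewrite preimage_ocell.
rewrite -[X in measurable X]setTI; apply: measurable_translation => //.
by apply: measurableI; [exact: mB|exact: measurable_ocell].
Qed.

Let relabel_image s (B : set R) : B `<=` unitI ->
  relabel s @` B = unitI `&` relabel s^-1%g @^-1` B.
Proof.
move=> BI; apply/seteqP; split => [_ [x Bx <-]|x [xI Bx]].
  by split; [apply: relabelI; exact: BI|rewrite /= relabelK//; exact: BI].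
by exists (relabel s^-1%g x) => //; exact: relabelVK.
Qed.

Let lebesgue_preimage s (B : set R) : measurable B -> B `<=` unitI ->
  lebesgue_measure (unitI `&` relabel s @^-1` B) = lebesgue_measure B.
Proof.
move=> mB BI; have mP : measurable (unitI `&` relabel s @^-1` B).
  by apply: measurable_relabel => //; exact: measurable_unitI.
rewrite (lebesgue_ocells mP); last by move=> x [].
rewrite (lebesgue_ocells mB BI) [RHS](reindex_inj (@perm_inj _ s))/=.
apply: eq_bigr => i _; rewrite preimage_ocell lebesgue_measure_translation//.
exact: measurableI.
Qed.

(** The piecewise translation that permutes the cells of the grid. *)
Definition relabel_bij s : mp_bij R.
Proof.
refine (@MpBij R (relabel s) _ _ _ _).
- split; first exact: relabelI.
  + move=> x y; rewrite !inE => xI yI sxy.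
    by rewrite -(relabelK s xI) -(relabelK s yI) sxy.
  + by move=> y yI; exists (relabel s^-1%g y); [exact: relabelI|exact: relabelVK].
- exact: measurable_relabel.
- move=> B mB BI; rewrite relabel_image//; apply: measurable_relabel => //.
  exact: measurable_unitI.
- exact: lebesgue_preimage.
Defined.

Definition permute_weights s (w : @weights R n) : @weights R n.
Proof.
refine (@Weights R n (fun i j => w (s i) (s j)) _ _) => i j.
- exact: wt_sym.
- exact: wt_range.
Defined.

Lemma orbit_dist_permute s (w : @weights R n) :
  orbit_dist (step_graphon (permute_weights s w)) (step_graphon w) = 0.
Proof.
apply/eqP; rewrite eq_le orbit_dist_ge0 andbT.
apply: (le_trans (orbit_dist_le _ _ (relabel_bij s))).
apply: (le_trans (cut_dist_le_l1 _ _)).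
apply: (@le_trans _ _ (0 + 2 * fine (lebesgue_measure [set 0 : R]))); last first.
  by rewrite lebesgue_measure_set1 mulr0 addr0.
apply: l1_dist_exception => //.
  by move=> x /= ->; rewrite /unitI/= in_itv/= lexx ler01.
move=> x y xI yI /eqP xN0 /eqP yN0.
have -> : step_graphon (permute_weights s w) (x, y) =
  w (s (cell n x)) (s (cell n y)) by [].
have -> : graphon_act (step_graphon w) (relabel_bij s) (x, y) =
  w (cell n (relabel s x)) (cell n (relabel s y)) by [].
by rewrite !cell_relabel// subrr normr0.
Qed.

End relabelling.

(** * A finite net for block-constant step graphons *)

Section block_net.
Context {R : realType}.

Lemma cell_mono n (x y : R) : unitI x -> unitI y -> x <= y ->
  (cell n x <= cell n y)%N.
Proof.
move=> xI yI xy; have := cell_eq (cell n x) xI; have := cell_eq (cell n y) yI.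
rewrite !eqxx => /esym Hy /esym /orP[/andP[x0 _]|/andP[_ /eqP->]//].
case/orP: Hy => [/andP[_ y1]|/andP[/eqP y0 _]]; last first.
  exfalso; move: x0; rewrite ltNge => /negP; apply.
  apply: (@le_trans _ _ 0); last exact: ler0n.
  by rewrite mulr_ge0_le0// -y0.
rewrite -ltnS -(ltr_nat R) -natr1 (lt_le_trans x0)//.
by rewrite (le_trans _ y1)// ler_wpM2l.
Qed.

Definition cell_end n (a : 'I_n.+1) : R := (a%:R + 1) / n.+1%:R.

Lemma cell_endI n (a : 'I_n.+1) : unitI (cell_end a).
Proof.
rewrite /unitI/= in_itv/= /cell_end divr_ge0//= ?addr_ge0//.
by rewrite ler_pdivrMr ?ltr0n// mul1r natr1 ler_nat.
Qed.

Lemma le_cell_end n (x : R) : unitI x -> x <= cell_end (cell n x).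
Proof.
move=> xI; rewrite /cell_end ler_pdivlMr ?ltr0n// mulrC.
have := cell_eq (cell n x) xI; rewrite eqxx => /esym/orP[/andP[_ //]|].
by move=> /andP[/eqP-> _]; rewrite mulr0 addr_ge0.
Qed.

Lemma cell_end_lt n (a : 'I_n.+1) (x : R) : unitI x -> (a < cell n x)%N ->
  cell_end a <= x.
Proof.
move=> xI ax; rewrite /cell_end ler_pdivrMr ?ltr0n// [x * _]mulrC.
have := cell_eq (cell n x) xI; rewrite eqxx => /esym/orP[/andP[x0 _]|].
  by rewrite (le_trans _ (ltW x0))// natr1 ler_nat.
by move=> /andP[_ /eqP c0]; rewrite c0 in ax.
Qed.

Lemma exists_sorting_perm n k (c : 'I_n -> 'I_k) :
  exists s : {perm 'I_n}, forall i j : 'I_n, (i <= j)%N -> (c (s i) <= c (s j))%N.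
Proof.
pose le_c (i j : 'I_n) := (c i <= c j)%N.
have tot : total le_c by move=> i j; exact: leq_total.
have tr : transitive le_c by move=> j i l; exact: leq_trans.
have rf : reflexive le_c by move=> i; exact: leqnn.
have sz : size (sort le_c (ord_tuple n)) == n by rewrite size_sort size_tuple.
have /tuple_permP[s sE] : perm_eq (Tuple sz) (ord_tuple n) by rewrite perm_sort.
exists s => i j ij.
have sN (l : 'I_n) : nth i (sort le_c (ord_tuple n)) l = s l.
  have -> : sort le_c (ord_tuple n) = Tuple sz by [].
  by rewrite sE -(tnth_nth i [tuple _ | _ < n] l) tnth_mktuple tnth_ord_tuple.
rewrite -[s i]sN -[s j]sN.
apply: (sorted_leq_nth tr rf i (sort_sorted tot _)) => //.
- by rewrite inE (eqP sz).
- by rewrite inE (eqP sz).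
Qed.

Section net.
Variables (L : nat).
Let M := L.+1.
Let M0 : 0 < M%:R :> R. Proof. by rewrite ltr0n. Qed.

Definition net_weights (r : {ffun 'I_M * 'I_M -> 'I_M.+1}) : @weights R L.
Proof.
refine (@Weights R L (fun i j => ((r (i, j))%:R + (r (j, i))%:R) / (2 * M%:R)) _ _).
- by move=> i j; rewrite addrC.
- move=> i j; rewrite divr_ge0 ?addr_ge0 ?mulr_ge0//=.
  rewrite ler_pdivrMr ?mulr_gt0// mul1r mulr2n mulrDl mul1r lerD//.
    by rewrite ler_nat -ltnS.
  by rewrite ler_nat -ltnS.
Defined.

Lemma round_weights (u : @weights R L) :
  exists r, forall i j, `|u i j - net_weights r i j| <= M%:R^-1.
Proof.
exists [ffun ij => inord (Num.truncn (M%:R * u ij.1 ij.2))] => i j /=.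
rewrite !ffunE/= (wt_sym u j i); set x := u i j.
have /andP[x0 x1] := wt_range u i j.
have Mx0 : 0 <= M%:R * x by rewrite mulr_ge0.
have /andP[t0 t1] := truncn_itv Mx0.
rewrite inordK; last first.
  rewrite ltnS -(ler_nat R) (le_trans t0)// ler_piMr//.
set t := (Num.truncn _)%:R in t0 *.
have -> : x - (t + t) / (2 * M%:R) = M%:R^-1 * (M%:R * x - t).
  by field; rewrite gt_eqF.
rewrite normrM ger0_norm ?invr_ge0// ler_piMr ?invr_ge0//.
by rewrite -natr1 in t1; rewrite ger0_norm ?subr_ge0// lerBlDr addrC ltW.
Qed.

Section monotone.
Variables (n k : nat) (c : 'I_n.+1 -> 'I_k) (w : @weights R n).
Hypothesis c_mono : forall i j : 'I_n.+1, (i <= j)%N -> (c i <= c j)%N.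
Hypothesis w_block : forall i i' j j', c i = c i' -> c j = c j' -> w i j = w i' j'.

Let col (x : R) := c (cell n x).

Let bad : {set 'I_M} :=
  [set a | `[< exists x : R, [/\ unitI x, cell L x = a &
                              (col x < col (cell_end a))%N] >]]%SET.

(** The colour at the right end of a cell exceeds all earlier colours when the
    cell is not monochromatic, so each colour accounts for at most one such
    cell. *)
Let card_bad : (#|bad| <= k)%N.
Proof.
rewrite -[X in (_ <= X)%N]card_ord.
have inj : {in bad &, injective (fun a => col (cell_end a))}.
  move=> a b abad bbad /= ab.
  wlog ltab : a b abad bbad ab / (a < b)%N => [H|].
    have [ab'|ba|/val_inj//] := ltngtP a b; first exact: H.
    by apply/esym; apply: H.
  move: bbad; rewrite inE => /asboolP[x [xI xb]].
  rewrite -ab ltnNge => /negP[]; apply: c_mono; apply: cell_mono => //.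
    exact: cell_endI.
  by apply: cell_end_lt => //; rewrite xb.
by rewrite -(card_in_imset inj); apply: max_card.
Qed.

Let not_bad x : unitI x -> cell L x \notin bad -> col x = col (cell_end (cell L x)).
Proof.
move=> xI; rewrite inE => /asboolPn H; apply/val_inj/eqP; rewrite eqn_leq.
rewrite c_mono/=; last first.
  by apply: cell_mono => //; [exact: cell_endI|exact: le_cell_end].
by rewrite leqNgt; apply/negP => ?; apply: H; exists x.
Qed.

Let sample : @weights R L.
Proof.
refine (@Weights R L (fun a b => w (cell n (cell_end a)) (cell n (cell_end b))) _ _).
- by move=> a b; exact: wt_sym.
- by move=> a b; exact: wt_range.
Defined.

Lemma monotone_block_net : exists r,
  l1_dist (step_graphon w) (step_graphon (net_weights r)) <= (2 * k%:R + 1) / M%:R.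
Proof.
have [r Hr] := round_weights sample; exists r.
pose phi (a b : 'I_M) : R := M%:R^-1 + ((a \in bad)%:R + (b \in bad)%:R).
apply: (@le_trans _ _ (mean (fun p => phi (cell L p.1) (cell L p.2)))); last first.
  rewrite mean_cell /phi.
  have -> : \sum_(i < L.+1) \sum_(j < L.+1) (M%:R^-1 + ((i \in bad)%:R + (j \in bad)%:R))
      = M%:R + 2 * M%:R * #|bad|%:R :> R.
    have E : \sum_(i < L.+1) (i \in bad)%:R = #|bad|%:R :> R.
      by rewrite -sum1_card natr_sum [RHS]big_mkcond/=; apply: eq_bigr => i _; case: ifP.
    have E1 i : \sum_(j < L.+1) (M%:R^-1 + ((i \in bad)%:R + (j \in bad)%:R)) =
        1 + (M%:R * (i \in bad)%:R + #|bad|%:R) :> R.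
      rewrite big_split/= big_split/= !sumr_const card_ord E.
      by rewrite -[_^-1 *+ _]mulr_natl -[(i \in bad)%:R *+ _]mulr_natl divff ?gt_eqF.
    under eq_bigr do rewrite E1.
    rewrite big_split/= big_split/= !sumr_const card_ord -mulr_sumr E.
    by rewrite -/M -[#|bad|%:R *+ M]mulr_natl; ring.
  have -> : (L.+1%:R ^+ 2)^-1 * (M%:R + 2 * M%:R * #|bad|%:R) =
     (2 * #|bad|%:R + 1) / M%:R :> R by rewrite -/M; field; rewrite gt_eqF.
  by rewrite ler_pM2r ?invr_gt0// lerD2r ler_pM2l// ler_nat.
apply: mean_le; [by apply: bm_norm; exact: bmB|exact: bm_cell|].
move=> [x y] [/= xI yI].
set a := cell L x; set b := cell L y.
suff : `|w (cell n x) (cell n y) - net_weights r a b| <= phi a b by [].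
have w01 := wt_range w (cell n x) (cell n y).
have n01 := wt_range (net_weights r) a b.
have d1 : `|w (cell n x) (cell n y) - net_weights r a b| <= 1.
  by rewrite ler_norml; lra.
have Mi : 0 <= M%:R^-1 :> R by rewrite invr_ge0.
rewrite /phi; have [abad|agood] := boolP (a \in bad).
  by apply: (le_trans d1); case: (b \in bad); rewrite /=; lra.
have [bbad|bgood] := boolP (b \in bad).
  by apply: (le_trans d1); rewrite /=; lra.
rewrite /= !addr0; have := Hr a b.
rewrite (w_block (not_bad xI agood) (not_bad yI bgood)).
exact.
Qed.

End monotone.

End net.

(** Relabelling sorts the colours at no cost for orbit_dist. A monotone colouring
    is then sampled at the cell ends of a grid whose size depends on k and e only,
    and the sampled weights are rounded. *)
Theorem block_net k (e : R) : 0 < e -> exists L, forall n (c : 'I_n.+1 -> 'I_k)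
    (w : @weights R n),
  (forall i i' j j', c i = c i' -> c j = c j' -> w i j = w i' j') ->
  exists r, orbit_dist (step_graphon w) (step_graphon (@net_weights L r)) <= e.
Proof.
move=> e0; have k0 : 0 < 2 * k%:R + 1 :> R by rewrite ltr_wpDl// mulr_ge0.
have [|L HL] := @exists_invn_le R (e / (2 * k%:R + 1)); first by rewrite divr_gt0.
have {HL} := HL _ (leqnn L); rewrite ler_pdivlMr// mulrC => HL.
exists L => n c w w_block.
have [s c_mono] := exists_sorting_perm c.
have [|r Hr] := @monotone_block_net L n k (c \o s) (permute_weights s w) c_mono.
  by move=> i i' j j' /= ci cj; exact: w_block.
exists r; apply: (le_trans (orbit_dist_triangle
  (step_graphon (permute_weights s w)) _ _)).
rewrite orbit_dist_sym orbit_dist_permute add0r.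
apply: (le_trans (orbit_dist_le_cut_dist _ _)).
apply: (le_trans (cut_dist_le_l1 _ _)).
exact: (le_trans Hr).
Qed.

End block_net.

(** * Weak regularity *)

Section class_average.
Context {R : realType} {X : finType}.
Implicit Types (C : eqType) (f g : X -> R).

(** The conditional expectation of f on the partition into colour classes. *)
Definition class_avg C (d : X -> C) f x : R :=
  (\sum_(y | d y == d x) f y) / #|[pred y | d y == d x]|%:R.

Lemma class_size_gt0 C (d : X -> C) x : 0 < #|[pred y | d y == d x]|%:R :> R.
Proof. by rewrite ltr0n; apply/card_gt0P; exists x; rewrite inE. Qed.

Lemma class_avg_const C (d : X -> C) f x y : d x = d y ->
  class_avg d f x = class_avg d f y.
Proof. by rewrite /class_avg => ->. Qed.

Lemma class_avg_kernel C C' (d : X -> C) (d' : X -> C') f :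
  (forall x y, (d x == d y) = (d' x == d' y)) ->
  class_avg d f =1 class_avg d' f.
Proof.
move=> dd' x; rewrite /class_avg; congr (_ / _%:R); first exact: eq_bigl.
by apply: eq_card => y; rewrite !inE.
Qed.

Lemma class_avg_range C (d : X -> C) f : (forall x, 0 <= f x <= 1) ->
  forall x, 0 <= class_avg d f x <= 1.
Proof.
move=> f01 x; rewrite divr_ge0 ?sumr_ge0//=; last first.
  by move=> y _; have /andP[] := f01 y.
rewrite ler_pdivrMr ?class_size_gt0// mul1r -sum1_card natr_sum.
by apply: ler_sum => y _; have /andP[] := f01 y.
Qed.

Lemma class_avg_proj C (d : X -> C) f g :
  (forall x y, d x = d y -> g x = g y) ->
  \sum_x class_avg d f x * g x = \sum_x f x * g x.
Proof.
move=> gd; rewrite /class_avg.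
under eq_bigr do rewrite mulr_suml mulr_suml big_mkcond/=.
rewrite exchange_big/=; apply: eq_bigr => y _; rewrite -big_mkcond/=.
rewrite (eq_bigr (fun=> f y * g y / #|[pred z | d z == d y]|%:R)); last first.
  by move=> x /eqP yx; rewrite (gd _ _ yx) yx mulrAC.
rewrite sumr_const -[_ / _ *+ _]mulr_natr.
rewrite (eq_card (B := [pred z | d z == d y])); last first.
  by move=> x; rewrite !inE eq_sym.
by rewrite divfK// gt_eqF// class_size_gt0.
Qed.

Lemma class_avg_pythagoras C C' (d : X -> C) (d' : X -> C') f :
  (forall x y, d' x = d' y -> d x = d y) ->
  \sum_x class_avg d' f x ^+ 2 = \sum_x class_avg d f x ^+ 2 +
    \sum_x (class_avg d' f x - class_avg d f x) ^+ 2.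
Proof.
move=> d'd; pose a x := class_avg d f x; pose b x := class_avg d' f x.
have ab : \sum_x b x * a x = \sum_x a x * a x.
  rewrite (class_avg_proj f (g := a)) => [|x y /d'd]; last exact: class_avg_const.
  by rewrite (class_avg_proj f (g := a))// => x y; exact: class_avg_const.
have -> : \sum_x (class_avg d' f x - class_avg d f x) ^+ 2 =
    \sum_x b x ^+ 2 - 2 * \sum_x b x * a x + \sum_x a x * a x.
  rewrite mulr_sumr -sumrB -big_split/=; apply: eq_bigr => x _.
  by rewrite -/(a x) -/(b x); ring.
have -> : \sum_x class_avg d f x ^+ 2 = \sum_x a x * a x.
  by apply: eq_bigr => x _; rewrite expr2.
by rewrite ab; rewrite -/b; ring.
Qed.

Definition energy C (d : X -> C) f : R := \sum_x class_avg d f x ^+ 2.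

Lemma energy_ge0 C (d : X -> C) f : 0 <= energy d f.
Proof. by apply: sumr_ge0 => x _; exact: sqr_ge0. Qed.

Lemma energy_le C (d : X -> C) f : (forall x, 0 <= f x <= 1) ->
  energy d f <= #|X|%:R.
Proof.
move=> f01; rewrite -sum1_card natr_sum; apply: ler_sum => x _.
have /andP[a0 a1] := class_avg_range d f01 x.
by rewrite expr_le1.
Qed.

(** As g is constant on the classes of d', it has the same correlation with f
    minus the d-average as with the difference of the two averages, whose squared
    norm is the gain of energy by class_avg_pythagoras. *)
Lemma energy_increment C C' (d : X -> C) (d' : X -> C') f g (e : R) : 0 < e ->
  (forall x y, d' x = d' y -> d x = d y) ->
  (forall x y, d' x = d' y -> g x = g y) -> (forall x, `|g x| <= 1) ->
  e * #|X|%:R < `|\sum_x (f x - class_avg d f x) * g x| ->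
  energy d f + e ^+ 2 * #|X|%:R <= energy d' f.
Proof.
move=> e0 d'd gd g1 H; rewrite /energy (class_avg_pythagoras f d'd) lerD2l.
pose u x := class_avg d' f x - class_avg d f x.
have E : \sum_x (f x - class_avg d f x) * g x = \sum_x u x * g x.
  rewrite /u; under eq_bigr do rewrite mulrBl.
  by under [RHS]eq_bigr do rewrite mulrBl; rewrite !sumrB (class_avg_proj f gd).
have : e * #|X|%:R < \sum_x ((2 * e)^-1 * u x ^+ 2 + e / 2).
  apply: (lt_le_trans H); rewrite E; apply: (le_trans (ler_norm_sum _ _ _)).
  apply: ler_sum => x _; rewrite normrM.
  apply: (@le_trans _ _ `|u x|); first by rewrite ler_piMr.
  rewrite -(real_normK (num_real (u x))); set z := `|u x|.
  rewrite -subr_ge0.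
  have -> : (2 * e)^-1 * z ^+ 2 + e / 2 - z = (2 * e)^-1 * (e - z) ^+ 2.
    by field; rewrite gt_eqF.
  by rewrite mulr_ge0 ?sqr_ge0// invr_ge0; lra.
rewrite big_split/= sumr_const -[e / 2 *+ _]mulr_natr -mulr_sumr.
have -> : \sum_x (class_avg d' f x - class_avg d f x) ^+ 2 = \sum_x u x ^+ 2 by [].
set U := \sum_x _; set m := #|X|%:R => H1.
have : e * m / 2 < (2 * e)^-1 * U by lra.
rewrite mulrC ltr_pdivlMl; last lra.
by move=> /ltW; rewrite expr2 (_ : 2 * e * (2^-1 * (e * m)) = e * e * m)//; field.
Qed.

End class_average.

Section regularity.
Context {R : realType}.

(** The two booleans record membership in the two sets of each refinement. *)
Fixpoint colours m : finType :=
  if m is m'.+1 then (colours m' * (bool * bool))%type else unit.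

Definition pair_colour n (C : eqType) (c : 'I_n -> C) (p : 'I_n * 'I_n) : C * C :=
  (c p.1, c p.2).

Definition regular_colouring n (C : eqType) (c : 'I_n -> C)
    (f : 'I_n * 'I_n -> R) (e : R) :=
  forall S A : {set 'I_n}, `|\sum_(i in S) \sum_(j in A)
    (f (i, j) - class_avg (pair_colour c) f (i, j))| <= e * n%:R ^+ 2.

Lemma regular_colouring_kernel n (C C' : eqType) (c : 'I_n -> C) (c' : 'I_n -> C')
    f e : (forall i j, (c i == c j) = (c' i == c' j)) ->
  regular_colouring c f e -> regular_colouring c' f e.
Proof.
move=> cc' H S A; rewrite (_ : \sum_(i in S) _ =
  \sum_(i in S) \sum_(j in A) (f (i, j) - class_avg (pair_colour c) f (i, j)))//.
apply: eq_bigr => i _; apply: eq_bigr => j _; congr (_ - _).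
by apply: class_avg_kernel => x y; rewrite !xpair_eqE !cc'.
Qed.

Lemma regular_or_energetic n (f : 'I_n * 'I_n -> R) (e : R) m : 0 < e ->
  exists c : 'I_n -> colours m, regular_colouring c f e \/
    m%:R * (e ^+ 2 * n%:R ^+ 2) <= energy (pair_colour c) f.
Proof.
move=> e0; elim: m => [|m [c IH]].
  by exists (fun=> tt); right; rewrite mul0r energy_ge0.
have [reg|nreg] := pselect (regular_colouring c f e).
  exists (fun i => (c i, (true, true))); left.
  by apply: regular_colouring_kernel reg => i j; rewrite xpair_eqE eqxx andbT.
case: IH => // IH; move: nreg => /existsNP[S /existsNP[A /negP]].
rewrite -ltNge => SA.
exists (fun i => (c i, (i \in S, i \in A))); right.
set c' := fun i => _.
have card2 : #|{: 'I_n * 'I_n}|%:R = n%:R ^+ 2 :> R.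
  by rewrite card_prod card_ord natrM expr2.
pose g (p : 'I_n * 'I_n) : R := ((p.1 \in S) && (p.2 \in A))%:R.
have := @energy_increment R _ _ _ (pair_colour c) (pair_colour c') f g e e0.
rewrite card2 => /(_ _ _ _ _)/(le_trans _); apply.
- by rewrite -natr1 mulrDl mul1r lerD2r.
- by move=> [i j] [i' j']; rewrite /pair_colour/= => -[-> _ _ -> _ _].
- by move=> [i j] [i' j']; rewrite /pair_colour/g/= => -[_ -> _ _ _ ->].
- by move=> p; rewrite /g; case: (_ && _); rewrite ?normr1 ?normr0.
- apply: (lt_le_trans SA); rewrite le_eqVlt; apply/orP; left; apply/eqP.
  congr `|_|; rewrite big_mkcond/=.
  transitivity (\sum_i \sum_j
      (f (i, j) - class_avg (pair_colour c) f (i, j)) * g (i, j)); last first.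
    by rewrite pair_bigA; apply: eq_bigr => -[i j].
  apply: eq_bigr => i _; rewrite /g/=; case: (i \in S) => /=; last first.
    by rewrite big1// => j _; rewrite mulr0.
  rewrite big_mkcond/=; apply: eq_bigr => j _.
  by case: (j \in A); rewrite ?mulr1 ?mulr0.
Qed.

(** Each failure of regularity raises the energy by e ^ 2 * n ^ 2 when the
    colouring is refined by the two offending sets, and the energy never exceeds
    n ^ 2; the number of refinements, hence of colours, depends on e only. *)
Lemma weak_regularity (e : R) : 0 < e -> exists k, forall n
    (f : 'I_n -> 'I_n -> R), (forall i j, 0 <= f i j <= 1) ->
  exists c : 'I_n -> 'I_k, regular_colouring c (fun p => f p.1 p.2) e.
Proof.
move=> e0; pose m := (Num.truncn (e ^- 2)).+1; exists #|colours m| => n f f01.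
have [c Hc] := regular_or_energetic (fun p => f p.1 p.2) m e0.
exists (fun i => enum_rank (c i)).
apply: (@regular_colouring_kernel n _ _ c) => [i j|].
  by rewrite (inj_eq enum_rank_inj).
case: Hc => // H S A.
have := le_trans H (energy_le _ (fun p => f01 p.1 p.2)).
rewrite card_prod card_ord natrM -expr2 => {}H.
have m1 : 1 < m%:R * e ^+ 2.
  by rewrite -ltr_pdivrMr ?exprn_gt0// mul1r /m truncnS_gt.
have : n%:R ^+ 2 <= 0 :> R.
  rewrite leNgt; apply/negP => n0; move: H; rewrite mulrA ger_pMl// leNgt.
  by rewrite m1.
rewrite real_exprn_even_le0//= pnatr_eq0 => /eqP n0.
rewrite big1 ?normr0 => [|i]; first by rewrite mulr_ge0 ?exprn_ge0// ltW.
by have := ltn_ord i; rewrite [X in (_ < X)%N]n0.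
Qed.

End regularity.

(** * Random graphs with independent edges *)

Section edges.
Context {R : realType}.
Variable n : nat.
Implicit Types (e : {set 'I_n}) (G : sgraph n).

Let pair_set (p : 'I_n * 'I_n) : {set 'I_n} := [set p.1; p.2]%SET.

Lemma sum_ordered_pairs (a b : 'I_n) (f : 'I_n * 'I_n -> R) : a != b ->
  \sum_(p | (p.1 != p.2) && (pair_set p == [set a; b]%SET)) f p =
  f (a, b) + f (b, a).
Proof.
move=> ab; rewrite (bigD1 (a, b))/= ?ab ?eqxx//; congr (_ + _).
rewrite (bigD1 (b, a))/=; last first.
  by rewrite eq_sym ab /pair_set/= finset.setUC eqxx xpair_eqE negb_and eq_sym ab.
rewrite big1 ?addr0// => -[x y]/= /andP[/andP[/andP[xy /eqP xyE] n1] n2].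
exfalso; have xab : x \in [set a; b]%SET by rewrite -xyE /pair_set !inE eqxx.
have yab : y \in [set a; b]%SET by rewrite -xyE /pair_set !inE eqxx orbT.
move: xab yab xy n1 n2; rewrite !inE !xpair_eqE.
by do 2 (case/orP => /eqP->); rewrite ?eqxx.
Qed.

Lemma sum_edges (f : {set 'I_n} -> R) :
  \sum_(e : {set 'I_n} | #|e| == 2) f e =
  2^-1 * \sum_i \sum_(j | i != j) f [set i; j]%SET.
Proof.
rewrite pair_big_dep/=.
rewrite (partition_big pair_set (fun e => #|e| == 2%N))/=; last first.
  by move=> p p12; rewrite cards2 p12.
rewrite mulr_sumr; apply: eq_bigr => e /cards2P[a [b [ab ->]]].
rewrite (eq_bigr (fun=> f [set a; b]%SET)); last first.
  by move=> p /andP[_ /eqP <-].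
by rewrite (sum_ordered_pairs (fun=> _) ab); lra.
Qed.

(** The value at the edge {i, j} of a symmetric function of (i, j). *)
Definition edge_val (f : 'I_n -> 'I_n -> R) e : R :=
  2^-1 * \sum_(p | (p.1 != p.2) && (pair_set p == e)) f p.1 p.2.

Lemma edge_valE f i j : (forall i j, f i j = f j i) -> i != j ->
  edge_val f [set i; j]%SET = f i j.
Proof.
move=> fs ij; rewrite /edge_val (sum_ordered_pairs (fun p => f p.1 p.2) ij)/=.
by rewrite (fs j i); lra.
Qed.

(** Independence of the edges: expanding the product over all sets of vertices
    gives all families of sets, and those that contain a set that is not a pair
    are given weight 0. *)
Lemma sum_graphs_prod (F : {set 'I_n} -> bool -> R) :
  \sum_(G : sgraph n) \prod_(e : {set 'I_n} | #|e| == 2) F e (e \in val G) =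
  \prod_(e : {set 'I_n} | #|e| == 2) (F e true + F e false).
Proof.
pose F1 e : R := if #|e| == 2 then F e true else 0.
pose F0 e : R := if #|e| == 2 then F e false else 1.
have -> : \prod_(e : {set 'I_n} | #|e| == 2) (F e true + F e false) =
    \prod_(e : {set 'I_n}) (F1 e + F0 e).
  rewrite big_mkcond/=; apply: eq_bigr => e _; rewrite /F1 /F0.
  by case: ifP => _; rewrite ?add0r.
rewrite bigA_distr/=.
pose P (E : {set {set 'I_n}}) := [forall e in E, #|e| == 2].
rewrite (bigID P)/= [X in _ = _ + X]big1 ?addr0; last first.
  move=> J /forall_inPn[e eJ e2]; rewrite (bigD1 e)//= eJ /F1 (negPf e2).
  by rewrite mul0r.
rewrite (reindex_omap (val : sgraph n -> {set {set 'I_n}}) insub)/=; last first.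
  by move=> J PJ; rewrite insubT.
rewrite [RHS](eq_bigl xpredT); last first.
  by move=> -[J PJ]; rewrite [val _]/= insubT/= eqxx andbT; exact: PJ.
apply: eq_bigr => G _; rewrite [LHS]big_mkcond/=; apply: eq_bigr => e _.
rewrite /F1 /F0; case: ifP => e2; first by case: ifP.
case: ifP => // eG; have /forall_inP/(_ e eG) := valP G.
by rewrite e2.
Qed.

End edges.

Section bernoulli_graph.
Context {R : realType}.
Variable n : nat.
Let N := n.+1.
Implicit Types (w : @weights R n) (G : sgraph N) (e : {set 'I_N}).

Definition edge_factor (p : R) (b : bool) : R := if b then p else 1 - p.

(** The probability of G when the pairs {i, j} are independent edges of
    probability w i j. *)
Definition graph_prob w G : R :=
  \prod_(e : {set 'I_N} | #|e| == 2) edge_factor (edge_val w e) (e \in val G).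

Lemma edge_weight_range w e : #|e| == 2 -> 0 <= edge_val w e <= 1.
Proof.
by move=> /cards2P[i [j [ij ->]]]; rewrite edge_valE ?wt_range//; exact: wt_sym.
Qed.

Lemma graph_prob_ge0 w G : 0 <= graph_prob w G.
Proof.
apply: prodr_ge0 => e /(edge_weight_range w)/andP[w0 w1].
by rewrite /edge_factor; case: ifP; rewrite ?subr_ge0.
Qed.

Lemma sum_graph_prob w : \sum_G graph_prob w G = 1.
Proof.
rewrite (sum_graphs_prod (fun e b => edge_factor (edge_val w e) b)).
by rewrite big1// => e _; rewrite /edge_factor addrCA subrr addr0.
Qed.

Lemma ln_prod (I : finType) (P : pred I) (F : I -> R) :
  (forall i, P i -> 0 < F i) ->
  ln (\prod_(i | P i) F i) = \sum_(i | P i) ln (F i).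
Proof.
move=> F0.
suff [] : 0 < \prod_(i | P i) F i /\
  ln (\prod_(i | P i) F i) = \sum_(i | P i) ln (F i) by [].
elim/big_ind2 : _ => [|x1 x2 y1 y2 [x0 <-] [y0 <-]|i Pi].
- by rewrite ln1.
- by rewrite mulr_gt0// lnM ?posrE.
- by split => //; exact: F0.
Qed.

Lemma ln_edge_factor (p : R) (b : bool) :
  ln (edge_factor p b) = b%:R * ln p + (1 - b%:R) * ln (1 - p).
Proof. by case: b; rewrite /= ?subrr ?subr0 ?mul0r ?mul1r ?addr0 ?add0r. Qed.

Lemma sum_offdiag (f : 'I_N -> 'I_N -> R) :
  \sum_i \sum_(j | i != j) f i j = \sum_i \sum_j f i j - \sum_i f i i.
Proof.
rewrite -sumrB; apply: eq_bigr => i _.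
rewrite [X in _ = X - _](bigD1 i)//= [RHS]addrC addKr.
by apply: eq_bigl => j; rewrite eq_sym.
Qed.

Definition adj G (i j : 'I_N) : R := (Defs.adjacent G i j)%:R.

Lemma adj_range G i j : 0 <= adj G i j <= 1.
Proof. by rewrite /adj ler0n lern1 leq_b1. Qed.

Lemma adj_sym G i j : adj G i j = adj G j i.
Proof. by rewrite /adj Defs.adjacentC. Qed.

Definition adj_weights G : @weights R n := Weights (adj_sym G) (adj_range G).

Lemma ln_graph_prob w G :
  (forall e, #|e| == 2 -> 0 < edge_factor (edge_val w e) (e \in val G)) ->
  ln (graph_prob w G) = 2^-1 * \sum_i \sum_(j | i != j)
    (adj G i j * ln (w i j) + (1 - adj G i j) * ln (1 - w i j)).
Proof.
move=> pos; rewrite ln_prod// sum_edges; congr (_ * _).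
apply: eq_bigr => i _; apply: eq_bigr => j ij.
by rewrite ln_edge_factor edge_valE//; exact: wt_sym.
Qed.

Lemma orbit_dist_graph G :
  orbit_dist (graph_graphon G) (step_graphon (adj_weights G)) = 0.
Proof.
apply/eqP; rewrite eq_le orbit_dist_ge0 andbT.
apply: (le_trans (orbit_dist_le_cut_dist _ _)).
apply: (le_trans (cut_dist_le_l1 _ _)).
apply: (@le_trans _ _ (0 + 2 * fine (lebesgue_measure [set 0 : R]))); last first.
  by rewrite lebesgue_measure_set1 mulr0 addr0.
apply: l1_dist_exception => //.
  by move=> x /= ->; rewrite /unitI/= in_itv/= lexx ler01.
move=> x y xI yI /eqP xN0 /eqP yN0.
have -> : step_graphon (adj_weights G) (x, y) =
  (Defs.adjacent G (cell n x) (cell n y))%:R by [].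
rewrite (_ : graph_graphon G (x, y) = (Defs.adjacent G (cell n x) (cell n y))%:R).
  by rewrite subrr normr0.
congr (nat_of_bool _)%:R; apply/existsP/idP => /=.
  move=> [i /existsP[j /and3P[]]].
  by rewrite !ceil_cell// => /eqP-> /eqP->.
move=> Gxy; exists (cell n x); apply/existsP; exists (cell n y).
by rewrite !ceil_cell// !eqxx.
Qed.

End bernoulli_graph.

(** * Counting graphs with prescribed block densities *)

Section block_weights.
Context {R : realType}.
Variables n k : nat.
Let N := n.+1.
Implicit Types (G : sgraph N) (c : 'I_N -> 'I_k).

Let edge_fun G (p : 'I_N * 'I_N) : R := adj G p.1 p.2.

Lemma block_avg_sym G c i j : class_avg (pair_colour c) (edge_fun G) (i, j) =
  class_avg (pair_colour c) (edge_fun G) (j, i).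
Proof.
pose sw (p : 'I_N * 'I_N) := (p.2, p.1).
have swK : involutive sw by case.
rewrite /class_avg; congr (_ / _%:R).
  rewrite [RHS](reindex_inj (inv_inj swK))/=; apply: eq_big => [[x y]|[x y] _].
    by rewrite /pair_colour/= !xpair_eqE andbC.
  exact: adj_sym.
rewrite -!sum1_card [RHS](reindex_inj (inv_inj swK))/=.
by apply: eq_bigl => -[x y]; rewrite !inE /pair_colour/= !xpair_eqE andbC.
Qed.

Definition block_weights G c : @weights R n :=
  Weights (block_avg_sym G c)
    (fun i j => class_avg_range (pair_colour c)
       (fun p => adj_range G p.1 p.2) (i, j)).

Lemma block_weights_const G c i i' j j' : c i = c i' -> c j = c j' ->
  block_weights G c i j = block_weights G c i' j'.
Proof.
by move=> ci cj; apply: class_avg_const; rewrite /pair_colour/= ci cj.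
Qed.

Let block_proj G c (g : R -> R) :
  \sum_i \sum_j adj G i j * g (block_weights G c i j) =
  \sum_i \sum_j block_weights G c i j * g (block_weights G c i j).
Proof.
pose h (p : 'I_N * 'I_N) := g (block_weights G c p.1 p.2).
rewrite !pair_bigA.
transitivity (\sum_p edge_fun G p * h p); first by apply: eq_bigr => -[i j].
rewrite -(class_avg_proj (d := pair_colour c)); first by apply: eq_bigr => -[i j].
by move=> [i j] [i' j'] [ci cj]; rewrite /h (block_weights_const G ci cj).
Qed.

Lemma block_weights_gt0 G c i j : Defs.adjacent G i j -> 0 < block_weights G c i j.
Proof.
move=> Gij; rewrite divr_gt0 ?class_size_gt0//.
rewrite (bigD1 (i, j))//= ltr_wpDr//; last by rewrite /edge_fun /adj/= Gij.
by apply: sumr_ge0 => p _; rewrite /edge_fun /adj ler0n.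
Qed.

Lemma block_weights_lt1 G c i j :
  ~~ Defs.adjacent G i j -> block_weights G c i j < 1.
Proof.
move=> Gij; rewrite ltr_pdivrMr ?class_size_gt0// mul1r -sum1_card natr_sum.
under [ltRHS]eq_bigl do rewrite inE.
rewrite [ltLHS](bigD1 (i, j))//= [ltRHS](bigD1 (i, j))//=.
apply: ltr_leD; first by rewrite /edge_fun /adj/= (negPf Gij).
by apply: ler_sum => p _; have /andP[] := @adj_range R n G p.1 p.2.
Qed.

(** The log-likelihood of G is linear in its adjacency matrix, which may
    therefore be averaged over the blocks, where w is constant. The diagonal
    terms, which the likelihood omits, are nonpositive because G has no loops. *)
Lemma graph_prob_block_weights G c :
  expR (N%:R ^+ 2 * graphon_rate (step_graphon (block_weights G c))) <=
  graph_prob (block_weights G c) G.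
Proof.
set w := block_weights G c.
have pos (e : {set 'I_N}) : #|e| == 2 -> 0 < edge_factor (edge_val w e) (e \in val G).
  move=> /cards2P[i [j [ij ->]]]; rewrite edge_valE//; last exact: wt_sym.
  rewrite /edge_factor; case: ifPn => Gij; first exact: block_weights_gt0.
  by rewrite subr_gt0 block_weights_lt1.
have P0 : 0 < graph_prob w G by apply: prodr_gt0 => e; exact: pos.
rewrite -[leRHS]lnK ?posrE// ler_expR ln_graph_prob// sum_offdiag.
rewrite graphon_rate_step mulrA divff ?expf_neq0 ?pnatr_eq0// mul1r.
have -> : \sum_i \sum_j (adj G i j * ln (w i j) + (1 - adj G i j) * ln (1 - w i j)) =
    2 * \sum_i \sum_j entropy (w i j).
  have e2 i j : 2 * entropy (w i j) = w i j * ln (w i j) +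
      (ln (1 - w i j) - w i j * ln (1 - w i j)).
    by rewrite /entropy; field.
  rewrite mulr_sumr; under [RHS]eq_bigr do rewrite mulr_sumr.
  under [RHS]eq_bigr do under eq_bigr do rewrite e2.
  under [LHS]eq_bigr do under eq_bigr do rewrite mulrBl mul1r.
  under [LHS]eq_bigr do rewrite big_split/= sumrB.
  under [RHS]eq_bigr do rewrite big_split/= sumrB.
  rewrite !big_split/= !sumrN.
  by rewrite (block_proj G c (@ln R)) (block_proj G c (fun x => ln (1 - x))).
have : \sum_i (adj G i i * ln (w i i) + (1 - adj G i i) * ln (1 - w i i)) <= 0.
  apply: sumr_le0 => i _; rewrite /adj adjacentxx mul0r add0r subr0 mul1r.
  by rewrite ln_le0//; have := wt_range w i i; lra.
lra.
Qed.

Let counts G c : {ffun 'I_k * 'I_k -> 'I_(N ^ 2).+1} :=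
  [ffun ab => inord #|[set p : 'I_N * 'I_N |
    (pair_colour c p == ab) && Defs.adjacent G p.1 p.2]%SET|].

Let counts_block_weights G G' c : counts G c = counts G' c ->
  forall i j, block_weights G c i j = block_weights G' c i j.
Proof.
move=> GG' i j; have := congr1 (fun f : {ffun 'I_k * 'I_k -> 'I_(N ^ 2).+1} =>
  nat_of_ord (f (c i, c j))) GG'.
rewrite /= !ffunE !inordK ?ltnS; last 2 first.
- by rewrite (leq_trans (max_card _))// card_prod card_ord expnS expn1.
- by rewrite (leq_trans (max_card _))// card_prod card_ord expnS expn1.
have E H : \sum_(p | pair_colour c p == (c i, c j)) edge_fun H p =
    #|[set p : 'I_N * 'I_N |
      (pair_colour c p == (c i, c j)) && Defs.adjacent H p.1 p.2]%SET|%:R.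
  rewrite -sum1_card natr_sum [RHS]big_mkcond [LHS]big_mkcond/=.
  apply: eq_bigr => p _; rewrite inE /edge_fun /adj.
  by case: (pair_colour c p == _) => //=; case: (Defs.adjacent _ _ _).
by move=> cE; congr (_ / _); rewrite !E cE.
Qed.

(** Graphs with the same block edge counts share their block densities w, and
    their total probability under w is at most 1. *)
Lemma sum_graphs_block_rate c :
  \sum_(G : sgraph N)
    expR (N%:R ^+ 2 * graphon_rate (step_graphon (block_weights G c))) <=
  ((N ^ 2).+1 ^ (k * k))%:R.
Proof.
have card_counts : #|{ffun 'I_k * 'I_k -> 'I_(N ^ 2).+1}| = ((N ^ 2).+1 ^ (k * k))%N.
  by rewrite card_ffun card_prod !card_ord.
rewrite (partition_big (fun G => counts G c) xpredT)//= -card_counts -sum1_card.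
rewrite natr_sum; apply: ler_sum => a _.
case: (pickP (fun G => counts G c == a)) => [G0 /eqP G0a|none]; last first.
  by rewrite big_pred0.
apply: (@le_trans _ _ (\sum_G graph_prob (block_weights G0 c) G)); last first.
  by rewrite sum_graph_prob.
rewrite [leRHS](bigID (fun G => counts G c == a))/=.
rewrite ler_wpDr//; first by apply: sumr_ge0 => G _; exact: graph_prob_ge0.
apply: ler_sum => G /eqP Ga; apply: (le_trans (graph_prob_block_weights G c)).
have wE := counts_block_weights (etrans Ga (esym G0a)).
rewrite le_eqVlt; apply/orP; left; apply/eqP; apply: eq_bigr => e e2.
congr (edge_factor _ _); rewrite /edge_val; congr (_ * _).
by apply: eq_bigr => p _; rewrite wE.
Qed.

End block_weights.

Section upper_bound.
Context {R : realType}.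
Variable T : qgraphon R -> R.

Definition graph_value n (G : sgraph n) : R := T (graphon_class (graph_graphon G)).

Let empty_graph n : sgraph n.
Proof.
exists (finset.set0 : {set {set 'I_n}}); apply/forall_inP => e.
by rewrite finset.in_set0.
Defined.

Lemma ln_nat_sqr_le n : ln ((n.+1 ^ 2).+1%:R) <= 2 * n.+1%:R :> R.
Proof.
have m0 : 0 < n.+1%:R :> R by rewrite ltr0n.
have p1 : 0 < (n.+1 ^ 2).+1%:R :> R by rewrite ltr0n.
have p2 : 0 < 1 + n.+1%:R :> R by rewrite addr_gt0.
apply: (@le_trans _ _ (ln ((1 + n.+1%:R) ^+ 2))).
  rewrite ler_ln ?posrE ?exprn_gt0// -natr1 natrX.
  by set m := n.+1%:R in m0 *; nra.
rewrite lnXn// -[_ *+ 2]mulr_natl ler_pM2l//.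
by apply: le_ln1Dx; rewrite (lt_trans _ m0)// ltrN10.
Qed.

(** Each graph is charged to one of its regular colourings. There are k ^ N
    colourings and polynomially many block counts for each of them, so the
    partition function is comparable to the largest exp (N ^ 2 * (T - I)). *)
Lemma psi_le_block (e : R) : 0 < e -> exists k, forall n,
  exists (G : sgraph n.+1) (c : 'I_n.+1 -> 'I_k),
    cut_dist (step_graphon (@adj_weights R n G)) (step_graphon (block_weights G c))
      <= e /\
    psi T n.+1 <= graph_value G - graphon_rate (step_graphon (@block_weights R n k G c)) +
      (ln k%:R + 2 * k%:R ^+ 2) / n.+1%:R.
Proof.
move=> e0; have [k reg] := @weak_regularity R e e0; exists k => n.
pose N := n.+1; have N0 : 0 < N%:R :> R by rewrite ltr0n.
have N20 : 0 < N%:R ^+ 2 :> R by rewrite exprn_gt0.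
pose rt (G : sgraph N) (c : 'I_N -> 'I_k) : R :=
  graphon_rate (step_graphon (block_weights G c)).
pose val (x : sgraph N * {ffun 'I_N -> 'I_k}) : R := graph_value x.1 - rt x.1 x.2.
pose P (x : sgraph N * {ffun 'I_N -> 'I_k}) :=
  `[< regular_colouring x.2 (fun p => @adj R n x.1 p.1 p.2) e >].
have exc G : exists c : {ffun 'I_N -> 'I_k}, P (G, c).
  have [c Hc] := reg N (@adj R n G) (adj_range G).
  exists [ffun i => c i]; apply/asboolP.
  by apply: (regular_colouring_kernel _ Hc) => i j; rewrite !ffunE.
have [c0 Pc0] := exc (empty_graph N).
have k0 : (0 < k)%N by apply: leq_trans (ltn_ord (c0 ord0)).
case: (@arg_maxP _ _ _ (empty_graph N, c0) P val Pc0) => -[G c] /= Pmax maxP.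
exists G, c; split.
  by apply: cut_dist_step => S A; move/asboolP: Pmax => /(_ S A).
set M := val (G, c); rewrite -/(rt G c) -/(val (G, c)) -/M.
have H : \sum_(G : sgraph N) expR (N%:R ^+ 2 * graph_value G) <=
    expR (N%:R ^+ 2 * M) * ((k ^ N)%:R * ((N ^ 2).+1 ^ (k * k))%:R).
  apply: (@le_trans _ _ (\sum_(G : sgraph N) \sum_(c : {ffun 'I_N -> 'I_k})
      expR (N%:R ^+ 2 * M) * expR (N%:R ^+ 2 * rt G c))).
    apply: ler_sum => G' _; have [c' Pc'] := exc G'.
    rewrite (bigD1 c')//= ler_wpDr//.
      by apply: sumr_ge0 => c1 _; rewrite mulr_ge0 ?expR_ge0.
    rewrite -expRD ler_expR -mulrDr ler_pM2l// -lerBlDr.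
    exact: (maxP (G', c')).
  rewrite exchange_big/=.
  under eq_bigr do rewrite -mulr_sumr.
  rewrite -mulr_sumr ler_pM2l ?expR_gt0//.
  have -> : (k ^ N)%:R * ((N ^ 2).+1 ^ (k * k))%:R =
      \sum_(c : {ffun 'I_N -> 'I_k}) ((N ^ 2).+1 ^ (k * k))%:R :> R.
    by rewrite sumr_const card_ffun !card_ord mulr_natl.
  by apply: ler_sum => c' _; exact: sum_graphs_block_rate.
rewrite /psi -/N mulrC ler_pdivrMr//.
have kN0 : 0 < (k ^ N)%:R :> R by rewrite ltr0n expn_gt0 k0.
have NN0 : 0 < ((N ^ 2).+1 ^ (k * k))%:R :> R by rewrite ltr0n expn_gt0.
have pos1 : 0 < (k ^ N)%:R * ((N ^ 2).+1 ^ (k * k))%:R :> R.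
  by rewrite mulr_gt0.
have pos : 0 < \sum_(G : sgraph N) expR (N%:R ^+ 2 * graph_value G).
  rewrite (bigD1 (empty_graph N))//= ltr_wpDr ?expR_gt0//.
  by apply: sumr_ge0 => G' _; exact: expR_ge0.
move: H; rewrite -ler_ln ?posrE ?mulr_gt0 ?expR_gt0// => /le_trans; apply.
rewrite lnM ?posrE ?expR_gt0// expRK lnM ?posrE//.
rewrite !natrX !lnXn ?ltr0n//.
have -> : (M + (ln k%:R + 2 * k%:R ^+ 2) / N%:R) * N%:R ^+ 2 =
  N%:R ^+ 2 * M + (N%:R * ln k%:R + k%:R ^+ 2 * (2 * N%:R)).
  by field; rewrite gt_eqF.
rewrite lerD2l -[ln k%:R *+ _]mulr_natl lerD2l -[_ *+ (k * k)]mulr_natl natrM -expr2.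
by rewrite ler_wpM2l ?exprn_ge0// ln_nat_sqr_le.
Qed.

End upper_bound.

(** * The upper bound *)

Section upper_bound_limit.
Context {R : realType}.
Implicit Types (f g h : graphon R).

(** Total boundedness of the classes of all finite graphs together. *)
Lemma graph_net (e : R) : 0 < e -> exists L, forall n (G : sgraph n.+1),
  exists r, orbit_dist (graph_graphon G) (step_graphon (@net_weights R L r)) <= e.
Proof.
move=> e0; have e20 : 0 < e / 2 by rewrite divr_gt0.
have [k reg] := @weak_regularity R _ e20.
have [L net] := @block_net R k _ e20.
exists L => n G; have [c Hc] := reg _ (@adj R n G) (adj_range G).
have [r Hr] := net n c (block_weights G c) (@block_weights_const R n k G c).
exists r; apply: (le_trans (orbit_dist_triangle (step_graphon (adj_weights G)) _ _)).
rewrite orbit_dist_graph add0r [leRHS](splitr e).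
apply: (le_trans (orbit_dist_triangle (step_graphon (block_weights G c)) _ _)).
apply: lerD; last exact: Hr.
apply: (le_trans (orbit_dist_le_cut_dist _ _)).
by apply: cut_dist_step => S A; exact: Hc.
Qed.

Lemma ultra_finite_cover (T : Type) (U : set_system T) (I : finType)
    (A : I -> set T) : UltraFilter U -> (forall x, exists i, A i x) ->
  exists i, U (A i).
Proof.
move=> UU cover; apply: contrapT => /forallNP noA.
have nA i : U (~` A i) by have [/noA|] := in_ultra_setVsetC (A i) UU.
have [x Ax] := filter_ex (@filter_forall _ _ (fun i => ~` A i) U _ nA).
by have [i Aix] := cover x; exact: (Ax i).
Qed.

(** A non-principal ultrafilter contains one piece of each of successively finer
    finite covers, and finitely many of these pieces meet at arbitrarily large
    indices. *)
Lemma fast_cauchy_subsequence (X : nat -> graphon R) :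
  (forall e : R, 0 < e -> exists (I : finType) (Y : I -> graphon R),
    forall m, exists i, orbit_dist (X m) (Y i) <= e) ->
  forall d : nat -> R, (forall j, 0 < d j) ->
  exists s : nat -> nat, (forall j, (j <= s j)%N) /\
    forall j, orbit_dist (X (s j)) (X (s j.+1)) <= d j.
Proof.
move=> net d d0.
have [U [UU Uoo]] := ultraFilterLemma (eventually_filter).
have ex j : exists Y : graphon R, U [set m | orbit_dist (X m) Y <= d j / 2].
  have [|I [Y cover]] := net (d j / 2); first by rewrite divr_gt0.
  have [i Ui] := ultra_finite_cover (A := fun i => [set m | orbit_dist (X m) (Y i) <= d j / 2])
    UU cover.
  by exists (Y i).
have [Y UY] := choice ex.
have pick j : exists m, [/\ (j <= m)%N, orbit_dist (X m) (Y j) <= d j / 2 &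
    orbit_dist (X m) (Y j.-1) <= d j.-1 / 2].
  have Uj : U [set m | (j <= m)%N] by apply: Uoo; exact: nbhs_infty_ge.
  have [m [[m1 m2] m3]] := filter_ex (filterI (filterI Uj (UY j)) (UY j.-1)).
  by exists m.
have [s sP] := choice pick.
exists s; split => [j|j]; first by have [] := sP j.
have [_ s1 _] := sP j; have [_ _ s2] := sP j.+1.
apply: (le_trans (orbit_dist_triangle (Y j) _ _)).
rewrite [leRHS](splitr (d j)); apply: lerD; first exact: s1.
by rewrite orbit_dist_sym; exact: s2.
Qed.

Lemma orbit_dist_act f g (s : mp_bij R) :
  orbit_dist (graphon_act f s) g = orbit_dist f g.
Proof.
have fs0 : orbit_dist f (graphon_act f s) = 0.
  rewrite orbit_dist_sym; apply/eqP; rewrite eq_le orbit_dist_ge0 andbT.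
  by apply: (le_trans (orbit_dist_le _ _ s)); rewrite cut_distxx.
apply/eqP; rewrite eq_le; apply/andP; split.
  apply: (le_trans (orbit_dist_triangle f _ _)).
  by rewrite (orbit_dist_sym (graphon_act f s) f) fs0 add0r.
apply: (le_trans (orbit_dist_triangle (graphon_act f s) _ _)).
by rewrite fs0 add0r.
Qed.

Lemma rearrange (Y : nat -> graphon R) :
  (forall j, orbit_dist (Y j) (Y j.+1) < 2^-1 ^+ j) ->
  exists s : nat -> mp_bij R, forall j,
    cut_dist (graphon_act (Y j) (s j)) (graphon_act (Y j.+1) (s j.+1)) <= 2^-1 ^+ j.
Proof.
move=> YY.
have ex (js : nat * mp_bij R) : exists s' : mp_bij R,
    cut_dist (graphon_act (Y js.1) js.2) (graphon_act (Y js.1.+1) s') < 2^-1 ^+ js.1.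
  by apply/orbit_distP; rewrite orbit_dist_act.
have [nxt Hnxt] := choice ex.
pose s := fix s j := if j is j'.+1 then nxt (j', s j') else mp_id.
by exists s => j; apply: ltW; exact: (Hnxt (j, s j)).
Qed.

(** Rearrangements make consecutive terms close in the cut distance itself, which
    brings the sequence within reach of cut_limit. The rate bound of any tail
    passes to h, since cut limits determine the rate. *)
Lemma orbit_limit (Y : nat -> graphon R) :
  (forall j, orbit_dist (Y j) (Y j.+1) < 2^-1 ^+ j) ->
  exists h, (forall j, orbit_dist (Y j) h <= 2 * 2^-1 ^+ j) /\
    forall (c : R) K, (forall j, (K <= j)%N -> graphon_rate (Y j) <= c) ->
      graphon_rate h <= c.
Proof.
move=> YY; have [s Hs] := rearrange YY.
pose F j := graphon_act (Y j) (s j).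
have FF j : cut_dist (F j) (F j.+1) <= 2^-1 ^+ j := Hs j.
have F0 j : graphon_rate (F j) <= 0 by have /andP[] := graphon_rate_range (F j).
have [h Fh _] := cut_limit FF F0.
exists h; split => [j|c K Kc].
  rewrite -(orbit_dist_act _ _ (s j)).
  by apply: (le_trans (orbit_dist_le_cut_dist _ _)); exact: Fh.
pose F' j := F (K + j)%N.
have FF' j : cut_dist (F' j) (F' j.+1) <= 2^-1 ^+ j.
  rewrite /F' addnS (le_trans (FF _))// exprD ler_piMl ?exprn_ge0//.
  by rewrite exprn_ile1// invf_le1// ler1n.
have F'c j : graphon_rate (F' j) <= c by rewrite /F' graphon_rate_act Kc// leq_addr.
have [h' Fh' h'c] := cut_limit FF' F'c.
rewrite (graphon_rate_cut0 (f := h) (g := h'))//.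
apply/eqP; rewrite eq_le cut_dist_ge0 andbT; apply/ler_addgt0Pr => e e0.
have [|j Hj] := @half_pow_small R (e / 4); first by rewrite divr_gt0.
have F'h : cut_dist (F' j) h <= 2 * 2^-1 ^+ (K + j) by exact: Fh.
have := cut_dist_triangle (F' j) h h'; have := Fh' j; move: F'h.
rewrite (cut_dist_sym h (F' j)).
have := Hj _ (leqnn j); have := Hj (K + j)%N (leq_addl _ _); lra.
Qed.

Lemma continuous_class (T : qgraphon R -> R) : continuous T ->
  forall h (e : R), 0 < e -> exists2 d : R, 0 < d & forall g,
    orbit_dist h g < d -> `|T (graphon_class h) - T (graphon_class g)| < e.
Proof.
move=> Tc h e e0; have := Tc (graphon_class h).
move=> /cvgrPdist_lt/(_ e e0)/nbhs_ballP[d /= d0 Hd]; exists d => // g hg.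
by apply: Hd; rewrite ballEmdist /= mdist_qgraphonE cut_metricE.
Qed.

Section limit.
Variable T : qgraphon R -> R.
Hypothesis Tcontinuous : continuous T.
Variable S : R.
Hypothesis S_ub : forall h, T (graphon_class h) - graphon_rate h <= S.

(** If psi exceeded S + e infinitely often, psi_le_block at finer and finer scales
    would give graphs x.1 and block approximations x.2 with a common limit class
    h, at which T - I would exceed S. *)
Lemma psi_upper (e : R) : 0 < e -> exists N, forall n, (N <= n)%N -> psi T n <= S + e.
Proof.
move=> e0; apply: contrapT => /forallNP noN.
have large N : exists n, psi T n.+1 > S + e /\ (N <= n)%N.
  have /existsNP[n /not_implyP[nN /negP]] := noN N.+1.
  by rewrite -ltNge; case: n nN => // n nN Hn; exists n.
(* The steps of the block approximations along the subsequence add up to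
   d j + (d j + d j.+1), which has to stay below 2^-1 ^+ j for orbit_limit. *)
pose d m : R := 2^-1 ^+ m / 8.
have d0 m : 0 < d m by rewrite divr_gt0// exprn_gt0.
have ex m : exists x : graphon R * graphon R,
    [/\ orbit_dist x.1 x.2 <= d m,
        exists n (G : sgraph n.+1), x.1 = graph_graphon G &
        S + e < T (graphon_class x.1) - graphon_rate x.2 + d m].
  have [k Hk] := psi_le_block T (d0 m).
  pose a : R := ln k%:R + 2 * k%:R ^+ 2.
  have [N HN] := exists_invn_le (divr_gt0 (d0 m) (ltr_wpDl (normr_ge0 a) ltr01)).
  have [n [Hn nN]] := large N; have [G [c [Gc psiG]]] := Hk n.
  exists (graph_graphon G, step_graphon (block_weights G c)); split => /=.
  - apply: (le_trans (orbit_dist_triangle (step_graphon (adj_weights G)) _ _)).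
    rewrite orbit_dist_graph add0r; apply: le_trans Gc.
    exact: orbit_dist_le_cut_dist.
  - by exists n, G.
  - apply: (lt_le_trans Hn); apply: (le_trans psiG); rewrite lerD2l.
    have := HN n nN; rewrite ler_pdivlMr ?ltr_wpDl// => H.
    apply: le_trans H; rewrite mulrC ler_wpM2l ?invr_ge0//.
    by rewrite (le_trans (ler_norm _))// lerDl.
have [x xP] := choice ex.
pose X m := (x m).1; pose W m := (x m).2.
have net (e' : R) : 0 < e' -> exists (I : finType) (Y : I -> graphon R),
    forall m, exists i, orbit_dist (X m) (Y i) <= e'.
  move=> /graph_net[L HL]; eexists; exists (fun r => step_graphon (@net_weights R L r)).
  by move=> m; have [_ [n [G XE]] _] := xP m; rewrite /X XE; exact: HL.
have [s [s_ge Xs]] := fast_cauchy_subsequence net d0.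
have d_le j m : (j <= m)%N -> d m <= d j.
  by move=> jm; rewrite ler_pM2r ?invr_gt0// ler_wiXn2l// ?invr_ge0// invf_le1// ler1n.
have XW j : orbit_dist (X (s j)) (W (s j)) <= d j.
  by have [H _ _] := xP (s j); apply: (le_trans H); exact: d_le.
have WW j : orbit_dist (W (s j)) (W (s j.+1)) < 2^-1 ^+ j.
  apply: (le_lt_trans (orbit_dist_triangle (X (s j)) _ _)).
  apply: (@le_lt_trans _ _ (d j + (d j + d j.+1))); last first.
    have := d_le _ _ (leqnSn j); rewrite /d.
    have : 0 < (2^-1 : R) ^+ j by rewrite exprn_gt0.
    by lra.
  apply: lerD; first by rewrite orbit_dist_sym; exact: XW.
  apply: (le_trans (orbit_dist_triangle (X (s j.+1)) _ _)).
  by apply: lerD; [exact: Xs|exact: XW].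
have [h [Wh h_lsc]] := @orbit_limit (fun j => W (s j)) WW.
have e20 : 0 < e / 4 by rewrite divr_gt0.
have [t t0 Ht] := continuous_class Tcontinuous h e20.
have [|J HJ] := @half_pow_small R (Num.min (t / 4) (e / 4)).
  by rewrite lt_min !divr_gt0.
have := h_lsc (T (graphon_class h) - S - e / 4) J; have := S_ub h.
suff H j : (J <= j)%N -> graphon_rate (W (s j)) <= T (graphon_class h) - S - e / 4.
  by move=> + /(_ H); lra.
move=> Jj; have := HJ j Jj; rewrite le_min => /andP[j1 j2].
have hj : 0 < (2^-1 : R) ^+ j by rewrite exprn_gt0.
have hX : orbit_dist h (X (s j)) < t.
  apply: (le_lt_trans (orbit_dist_triangle (W (s j)) _ _)).
  apply: (@le_lt_trans _ _ (2 * 2^-1 ^+ j + d j)).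
    apply: lerD; first by rewrite orbit_dist_sym; exact: Wh.
    by rewrite orbit_dist_sym; exact: XW.
  by rewrite /d; lra.
have [_ _ Hx] := xP (s j).
have := Ht _ hX; have := d_le _ _ (s_ge j); move: Hx.
rewrite -/(X _) -/(W _) /d ltr_norml {hX Wh}.
move: (T (graphon_class h)) (T (graphon_class (X (s j)))).
move: (graphon_rate (W (s j))) (2^-1 ^+ s j) (2^-1 ^+ j) j1 j2 hj => r p q.
by move=> ? ? ? a b ? ? /andP[? ?]; lra.
Qed.

End limit.

End upper_bound_limit.

(** * Concentration of the random graph *)

Section concentration.
Context {R : realType}.

Lemma expR_le_quadratic (x : R) : x <= 2^-1 -> expR x <= 1 + x + 2 * x ^+ 2.
Proof.
move=> x2; have x1 : 0 < 1 - x by lra.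
have H : 1 - x <= expR (- x) by apply: expR_ge1Dx.
have : expR x <= (1 - x)^-1.
  by rewrite -[expR x]invrK -expRN lef_pV2 ?posrE ?expR_gt0.
move=> /le_trans; apply; rewrite -[leLHS]mul1r ler_pdivrMr//.
rewrite -subr_ge0.
have -> : (1 + x + 2 * x ^+ 2) * (1 - x) - 1 = x ^+ 2 * (1 - 2 * x) by ring.
by rewrite mulr_ge0 ?sqr_ge0//; lra.
Qed.

(** The linear terms of expR_le_quadratic cancel, the variable being centred. *)
Lemma bernoulli_mgf (p a : R) : 0 <= p <= 1 -> `|a| <= 2^-1 ->
  p * expR (a * (1 - p)) + (1 - p) * expR (a * (0 - p)) <= expR (2 * a ^+ 2).
Proof.
move=> /andP[p0 p1]; rewrite ler_norml => /andP[a1 a2].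
have q0 : 0 <= 1 - p by lra.
have H1 : expR (a * (1 - p)) <= 1 + a * (1 - p) + 2 * (a * (1 - p)) ^+ 2.
  by apply: expR_le_quadratic; nra.
have H2 : expR (a * (0 - p)) <= 1 + a * (0 - p) + 2 * (a * (0 - p)) ^+ 2.
  by apply: expR_le_quadratic; nra.
apply: (@le_trans _ _ (1 + 2 * a ^+ 2)); last exact: expR_ge1Dx.
apply: (le_trans (lerD (ler_wpM2l p0 H1) (ler_wpM2l q0 H2))).
rewrite -subr_ge0.
have -> : 1 + 2 * a ^+ 2 - (p * (1 + a * (1 - p) + 2 * (a * (1 - p)) ^+ 2) +
    (1 - p) * (1 + a * (0 - p) + 2 * (a * (0 - p)) ^+ 2)) =
    2 * a ^+ 2 * (1 - p + p ^+ 2) by ring.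
apply: mulr_ge0; first by apply: mulr_ge0 => //; exact: sqr_ge0.
by apply: addr_ge0 => //; exact: sqr_ge0.
Qed.

Variable n : nat.
Let N := n.+1.
Variable w : @weights R n.
Hypothesis w_diag : forall i, w i i = 0.
Implicit Types (G : sgraph N) (S A : {set 'I_N}).

Definition discrepancy S A G : R := \sum_(i in S) \sum_(j in A) (adj G i j - w i j).

Let in_rect S A (i j : 'I_N) : R := ((i \in S) && (j \in A))%:R.

Let weight S A (i j : 'I_N) : R := in_rect S A i j + in_rect S A j i.

Let weight_sym S A i j : weight S A i j = weight S A j i.
Proof. by rewrite /weight addrC. Qed.

Let weight_range S A i j : 0 <= weight S A i j <= 2.
Proof.
rewrite /weight /in_rect.
by case: ((i \in S) && _); case: ((j \in S) && _); rewrite /=; lra.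
Qed.

Lemma discrepancy_edges S A G : discrepancy S A G =
  \sum_(e : {set 'I_N} | #|e| == 2)
    edge_val (weight S A) e * ((e \in val G)%:R - edge_val w e).
Proof.
pose d i j := adj G i j - w i j : R.
have d_sym i j : d i j = d j i by rewrite /d adj_sym wt_sym.
have dE : discrepancy S A G = \sum_i \sum_j in_rect S A i j * d i j.
  rewrite /discrepancy big_mkcond/=; apply: eq_bigr => i _.
  rewrite /in_rect; case: (i \in S); last by rewrite big1// => j _; rewrite mul0r.
  rewrite big_mkcond/=; apply: eq_bigr => j _.
  by case: (j \in A); rewrite ?mul1r ?mul0r.
have dE' : discrepancy S A G = \sum_i \sum_j in_rect S A j i * d i j.
  rewrite dE exchange_big/=; apply: eq_bigr => i _; apply: eq_bigr => j _.
  by rewrite d_sym.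
rewrite sum_edges.
have -> : \sum_i \sum_(j | i != j) edge_val (weight S A) [set i; j]%SET *
      (([set i; j]%SET \in val G)%:R - edge_val w [set i; j]%SET) =
    \sum_i \sum_(j | i != j) weight S A i j * d i j.
  apply: eq_bigr => i _; apply: eq_bigr => j ij.
  by rewrite !edge_valE// => ? ?; exact: wt_sym.
rewrite (sum_offdiag (fun i j => weight S A i j * d i j)).
rewrite [X in _ * (_ - X)]big1 ?subr0; last first.
  by move=> i _; rewrite /d w_diag /adj adjacentxx subrr mulr0.
have -> : \sum_i \sum_j weight S A i j * d i j =
    \sum_i \sum_j in_rect S A i j * d i j + \sum_i \sum_j in_rect S A j i * d i j.
  rewrite -big_split/=; apply: eq_bigr => i _; rewrite -big_split/=.
  by apply: eq_bigr => j _; rewrite /weight mulrDl.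
by rewrite -dE -dE'; lra.
Qed.

Lemma discrepancy_mgf S A (t : R) : `|t| <= 4^-1 ->
  \sum_G graph_prob w G * expR (t * discrepancy S A G) <=
  expR (4 * t ^+ 2 * N%:R ^+ 2).
Proof.
move=> t4; pose c e := edge_val (weight S A) e.
pose F e (b : bool) :=
  edge_factor (edge_val w e) b * expR (t * c e * (b%:R - edge_val w e)).
have -> : \sum_G graph_prob w G * expR (t * discrepancy S A G) =
    \sum_(G : sgraph N) \prod_(e : {set 'I_N} | #|e| == 2) F e (e \in val G).
  apply: eq_bigr => G _; rewrite discrepancy_edges mulr_sumr expR_sum -big_split/=.
  by apply: eq_bigr => e _; rewrite /F mulrA.
(* The exponential moment factorises over the edges. *)
rewrite sum_graphs_prod.
have crange (e : {set 'I_N}) : #|e| == 2 -> 0 <= c e <= 2.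
  by move=> /cards2P[i [j [ij ->]]]; rewrite /c edge_valE// => ? ?.
have Fle (e : {set 'I_N}) : #|e| == 2 -> 0 <= F e true + F e false <= expR (8 * t ^+ 2).
  move=> e2; have p01 := edge_weight_range w e2; have /andP[p0 p1] := p01.
  have /andP[c0 c2] := crange e e2.
  have q0 : 0 <= 1 - edge_val w e by rewrite subr_ge0.
  rewrite /F /edge_factor; apply/andP; split.
    by apply: addr_ge0; apply: mulr_ge0 => //; exact: expR_ge0.
  have tc : `|t * c e| <= 2^-1.
    rewrite normrM (ger0_norm c0); apply: (@le_trans _ _ (4^-1 * 2)); last lra.
    by apply: ler_pM.
  apply: (le_trans (bernoulli_mgf p01 tc)).
  rewrite ler_expR exprMn (_ : 8 * t ^+ 2 = 2 * (t ^+ 2 * 2 ^+ 2)); last by ring.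
  by rewrite ler_pM2l// ler_wpM2l ?sqr_ge0// ler_sqr ?nnegrE.
apply: (@le_trans _ _ (\prod_(e : {set 'I_N} | #|e| == 2) expR (8 * t ^+ 2))).
  by apply: ler_prod => e; exact: Fle.
rewrite -expR_sum ler_expR sum_edges.
have -> : 4 * t ^+ 2 * N%:R ^+ 2 = 2^-1 * \sum_(i < N) \sum_(j < N) 8 * t ^+ 2 :> R.
  by rewrite !sumr_const !card_ord -mulrnA -[_ *+ (N * N)]mulr_natr natrM; field.
rewrite ler_pM2l ?invr_gt0//; apply: ler_sum => i _.
rewrite [leRHS](bigID (fun j => i != j))/= lerDl sumr_ge0// => j _.
by rewrite mulr_ge0 ?sqr_ge0.
Qed.

(** Union bound over the pairs S, A of the Chernoff bounds, both signs. *)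
Lemma bad_graphs_prob (eta : R) : 0 < eta <= 1 ->
  \sum_(G : sgraph N | ~~ [forall S : {set 'I_N}, forall A : {set 'I_N},
      `|discrepancy S A G| <= eta * N%:R ^+ 2]) graph_prob w G <=
  2 * 4 ^+ N * expR (- (eta ^+ 2 * N%:R ^+ 2 / 16)).
Proof.
move=> /andP[eta0 eta1]; pose t := eta / 8.
(* This t minimises 4 * t ^+ 2 - t * eta. *)
have t4 : `|t| <= 4^-1 by rewrite ger0_norm /t; lra.
pose Q (s : R) S A G := expR (s * discrepancy S A G) * expR (- (t * eta * N%:R ^+ 2)).
apply: (@le_trans _ _ (\sum_G graph_prob w G *
    (\sum_(S : {set 'I_N}) \sum_(A : {set 'I_N}) (Q t S A G + Q (- t) S A G)))).
  rewrite big_mkcond/=; apply: ler_sum => G _.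
  have Q0 s S A : 0 <= Q s S A G by rewrite mulr_ge0 ?expR_ge0.
  have QQ0 S A : 0 <= Q t S A G + Q (- t) S A G by rewrite addr_ge0.
  case: ifPn => [/forallPn[S /forallPn[A]]|_]; last first.
    rewrite mulr_ge0 ?graph_prob_ge0// sumr_ge0// => S _.
    by rewrite sumr_ge0.
  rewrite -ltNge => SA; rewrite -[leLHS]mulr1 ler_wpM2l ?graph_prob_ge0//.
  rewrite (bigD1 S)//= (bigD1 A)//= -addrA ler_wpDr//.
    rewrite addr_ge0//; first by rewrite sumr_ge0.
    by rewrite sumr_ge0// => S' _; rewrite sumr_ge0.
  have t0 : 0 < t by rewrite /t; lra.
  have Q1 s : eta * N%:R ^+ 2 * t <= s * discrepancy S A G -> 1 <= Q s S A G.
    move=> H; rewrite /Q -expRD -[leLHS]expR0 ler_expR subr_ge0.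
    by rewrite [t * eta]mulrC mulrAC.
  have [D0|D0] := leP 0 (discrepancy S A G).
    rewrite ler_wpDr// Q1// mulrC ler_pM2l// ltW//.
    by rewrite (ger0_norm D0) in SA.
  rewrite ler_wpDl// Q1// mulNr -mulrN mulrC ler_pM2l// ltW//.
  by rewrite (ltr0_norm D0) in SA.
have -> : \sum_G graph_prob w G *
    (\sum_(S : {set 'I_N}) \sum_(A : {set 'I_N}) (Q t S A G + Q (- t) S A G)) =
  \sum_(S : {set 'I_N}) \sum_(A : {set 'I_N})
    (\sum_G graph_prob w G * expR (t * discrepancy S A G) +
     \sum_G graph_prob w G * expR (- t * discrepancy S A G)) *
      expR (- (t * eta * N%:R ^+ 2)).
  under eq_bigr do rewrite mulr_sumr; rewrite exchange_big/=.
  apply: eq_bigr => S _; under eq_bigr do rewrite mulr_sumr; rewrite exchange_big/=.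
  apply: eq_bigr => A _; rewrite -big_split/= mulr_suml; apply: eq_bigr => G _.
  by rewrite /Q; ring.
have -> : 2 * 4 ^+ N * expR (- (eta ^+ 2 * N%:R ^+ 2 / 16)) =
  \sum_(S : {set 'I_N}) \sum_(A : {set 'I_N})
    (expR (4 * t ^+ 2 * N%:R ^+ 2) + expR (4 * (- t) ^+ 2 * N%:R ^+ 2)) *
      expR (- (t * eta * N%:R ^+ 2)).
  rewrite sqrrN.
  have -> : (expR (4 * t ^+ 2 * N%:R ^+ 2) + expR (4 * t ^+ 2 * N%:R ^+ 2)) *
      expR (- (t * eta * N%:R ^+ 2)) =
      2 * expR (4 * t ^+ 2 * N%:R ^+ 2 + - (t * eta * N%:R ^+ 2)).
    by rewrite expRD; ring.
  rewrite !sumr_const -mulrnA -[_ *+ (_ * _)]mulr_natl.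
  have -> : 4 * t ^+ 2 * N%:R ^+ 2 + - (t * eta * N%:R ^+ 2) =
    - (eta ^+ 2 * N%:R ^+ 2 / 16) by rewrite /t; field.
  have -> : (#|{set 'I_N}| * #|{set 'I_N}|)%:R = 4 ^+ N :> R.
    have -> : #|{set 'I_N}| = (2 ^ N)%N.
      by rewrite -cardsT -powersetT card_powerset cardsT card_ord.
    by rewrite -expnMn natrX.
  by ring.
apply: ler_sum => S _; apply: ler_sum => A _.
by rewrite ler_pM2r ?expR_gt0// lerD// discrepancy_mgf// normrN.
Qed.

End concentration.

(** * The lower bound *)

Section gibbs.
Context {R : realType}.

(** The Gibbs variational inequality, a form of Jensen's inequality for ln. *)
Lemma gibbs_le_lnsum (I : finType) (P a : I -> R) : (forall i, 0 <= P i) ->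
  \sum_i P i = 1 ->
  \sum_i P i * a i - \sum_i P i * ln (P i) <= ln (\sum_i expR (a i)).
Proof.
move=> P0 P1; set Z := \sum_i expR (a i).
have Z0 : 0 < Z.
  have [i Pi] : exists i, P i != 0.
    apply: contrapT => /forallNP H; move: P1; rewrite big1.
      by move=> /eqP; rewrite eq_sym oner_eq0.
    by move=> i _; apply/eqP; rewrite -[_ == _]negbK; apply/negP; exact: H.
  rewrite /Z (bigD1 i)//=; apply: ltr_wpDr; last exact: expR_gt0.
  by apply: sumr_ge0 => j _; exact: expR_ge0.
rewrite -[leRHS]mul1r -{1}P1 -subr_le0 mulr_suml -!sumrB.
apply: (@le_trans _ _ (\sum_i (expR (a i) / Z - P i))).
  apply: ler_sum => i _.
  have := xlnx_tangent (P0 i) (divr_gt0 (expR_gt0 (a i)) Z0).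
  by rewrite ln_div ?posrE ?expR_gt0// expRK mulrBr; lra.
by rewrite sumrB -mulr_suml P1 divff ?gt_eqF// subrr.
Qed.

End gibbs.

Section graph_entropy.
Context {R : realType}.
Variable n : nat.
Let N := n.+1.
Variable w : @weights R n.
Hypothesis w_diag : forall i, w i i = 0.

Lemma sum_graph_prob_edge (e0 : {set 'I_N}) (phi : bool -> R) : #|e0| == 2 ->
  \sum_(G : sgraph N) graph_prob w G * phi (e0 \in val G) =
  edge_val w e0 * phi true + (1 - edge_val w e0) * phi false.
Proof.
move=> e02; pose F (e : {set 'I_N}) (b : bool) :=
  edge_factor (edge_val w e) b * (if e == e0 then phi b else 1).
transitivity (\sum_(G : sgraph N)
    \prod_(e : {set 'I_N} | #|e| == 2) F e (e \in val G)).
  apply: eq_bigr => G _; rewrite big_split/=; congr (_ * _).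
  rewrite (bigD1 e0)//= eqxx big1 ?mulr1// => e /andP[_ ee0].
  by rewrite (negPf ee0).
rewrite sum_graphs_prod (bigD1 e0)//= big1 ?mulr1 => [|e /andP[_ ee0]].
  by rewrite /F eqxx.
by rewrite /F (negPf ee0) !mulr1 /edge_factor addrCA subrr addr0.
Qed.

Lemma graph_prob_ln (G : sgraph N) : graph_prob w G * ln (graph_prob w G) =
  graph_prob w G * \sum_(e : {set 'I_N} | #|e| == 2)
    ln (edge_factor (edge_val w e) (e \in val G)).
Proof.
have [->|P0] := eqVneq (graph_prob w G) 0; first by rewrite !mul0r.
congr (_ * _); rewrite ln_prod// => e e2.
rewrite lt_neqAle eq_sym; apply/andP; split.
  apply: contraNneq P0 => e0; rewrite /graph_prob (bigD1 e)//= e0.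
  by rewrite mul0r.
have /andP[p0 p1] := edge_weight_range w e2.
by rewrite /edge_factor; case: ifP; rewrite ?subr_ge0.
Qed.

(** By independence the entropies of the edges add up; the vanishing diagonal
    makes the sum over all ordered pairs equal to the rate, with no error term. *)
Lemma sum_graph_prob_ln : \sum_(G : sgraph N) graph_prob w G * ln (graph_prob w G) =
  N%:R ^+ 2 * graphon_rate (step_graphon w).
Proof.
under eq_bigr do rewrite graph_prob_ln mulr_sumr.
rewrite exchange_big/=.
rewrite (eq_bigr (fun e => 2 * entropy (edge_val w e))); last first.
  move=> e e2; rewrite (sum_graph_prob_edge (fun b => ln (edge_factor (edge_val w e) b)))//.
  by rewrite /edge_factor /entropy; field.
rewrite sum_edges graphon_rate_step mulrA divff ?expf_neq0 ?pnatr_eq0// mul1r.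
have -> : \sum_i \sum_(j | i != j) 2 * entropy (edge_val w [set i; j]%SET) =
    2 * \sum_i \sum_(j | i != j) entropy (w i j).
  rewrite mulr_sumr; apply: eq_bigr => i _; rewrite mulr_sumr.
  by apply: eq_bigr => j ij; rewrite edge_valE// => ? ?; exact: wt_sym.
rewrite mulKf// (sum_offdiag (fun i j => entropy (w i j))).
by rewrite [X in _ - X]big1 ?subr0// => i _; rewrite w_diag entropy0.
Qed.

End graph_entropy.

Section off_diagonal.
Context {R : realType}.
Variable n : nat.
Let N := n.+1.
Variable w : @weights R n.

(** Graphs have no loops, so only weights that vanish on the diagonal are mean
    adjacency matrices of random graphs. *)
Definition off_diagonal : @weights R n.
Proof.
refine (@Weights R n (fun i j => if i == j then 0 else w i j) _ _) => i j.
- by rewrite eq_sym; case: ifP => // _; exact: wt_sym.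
- by case: ifP => _; [rewrite lexx ler01|exact: wt_range].
Defined.

Let diag_error (S : {set 'I_N}) (F : 'I_N -> R) : (forall i, 0 <= F i <= 1) ->
  0 <= \sum_(i in S) F i <= N%:R.
Proof.
move=> F01; apply/andP; split.
  by apply: sumr_ge0 => i _; have /andP[] := F01 i.
rewrite big_mkcond/= -[X in X%:R]card_ord -sum1_card natr_sum; apply: ler_sum => i _.
by case: ifP => _; [have /andP[] := F01 i|exact: ler01].
Qed.

Lemma cut_dist_off_diagonal :
  cut_dist (step_graphon w) (step_graphon off_diagonal) <= N%:R^-1.
Proof.
apply: cut_dist_step => S A.
rewrite expr2 mulrA mulVf ?pnatr_eq0// mul1r.
have -> : \sum_(i in S) \sum_(j in A) (w i j - off_diagonal i j) =
    \sum_(i in S) (i \in A)%:R * w i i.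
  apply: eq_bigr => i _; rewrite big_mkcond/= (bigD1 i)//= big1 ?addr0.
    by rewrite eqxx subr0; case: (i \in A); rewrite ?mul1r ?mul0r.
  by move=> j ji; rewrite eq_sym (negPf ji) subrr; case: ifP.
have : forall i, 0 <= (i \in A)%:R * w i i <= 1.
  by move=> i; case: (i \in A); rewrite ?mul1r ?mul0r ?wt_range ?lexx ?ler01.
move=> /(@diag_error S (fun i => (i \in A)%:R * w i i)) /andP[H0 H1].
by rewrite ger0_norm.
Qed.

Lemma graphon_rate_off_diagonal :
  graphon_rate (step_graphon off_diagonal) <= graphon_rate (step_graphon w) + N%:R^-1.
Proof.
have N0 : 0 < N%:R :> R by rewrite ltr0n.
rewrite !graphon_rate_step.
have -> : \sum_i \sum_j entropy (off_diagonal i j) =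
    \sum_i \sum_j entropy (w i j) + \sum_i - entropy (w i i).
  rewrite -big_split/=; apply: eq_bigr => i _.
  rewrite (bigD1 i)//= eqxx entropy0 add0r [X in _ = X + _](bigD1 i)//= [RHS]addrC addKr.
  by apply: eq_bigr => j ji; rewrite eq_sym (negPf ji).
have : forall i, 0 <= - entropy (w i i) <= 1.
  move=> i; have := entropy_le0 (wt_range w i i).
  by have := entropy_geN1 (wt_range w i i); lra.
move=> /(@diag_error [set: 'I_N]%SET)/andP[_ H].
rewrite mulrDr lerD2l -[leRHS]mulr1 (_ : N%:R^-1 * 1 = (N%:R ^+ 2)^-1 * N%:R :> R).
  rewrite ler_pM2l ?invr_gt0 ?exprn_gt0//; apply: le_trans H.
  by rewrite le_eqVlt; apply/orP; left; apply/eqP; apply: eq_bigl => i; rewrite inE.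
by field; rewrite gt_eqF.
Qed.

End off_diagonal.

Section lower_bound.
Context {R : realType}.
Variable T : qgraphon R -> R.
Hypothesis Tcontinuous : continuous T.
Variable B : R.
Hypothesis TB : forall a, `|T a| <= B.

Lemma bad_graphs_small (eta e : R) : 0 < eta -> 0 < e ->
  exists N, forall n, (N <= n)%N ->
    2 * 4 ^+ n.+1 * expR (- (eta ^+ 2 * n.+1%:R ^+ 2 / 16)) <= e.
Proof.
move=> eta0 e0.
have c0 : 0 < eta ^+ 2 / 48 by rewrite divr_gt0// exprn_gt0.
have [N1 H1] := exists_invn_le c0.
have e20 : 0 < e / 2 by rewrite divr_gt0.
have [N2 H2] := exists_invn_le e20.
exists (maxn N1 N2) => n; rewrite geq_max => /andP[/H1 {}H1 /H2 {}H2].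
set m := n.+1%:R in H1 H2 *.
have m0 : 0 < m by rewrite ltr0n.
(* The 4 ^+ n.+1 rectangles cost exp (2 * m), so an exponent of 3 * m leaves a
   factor exp (- m). *)
have H3 : 3 * m <= eta ^+ 2 * m ^+ 2 / 16.
  have : 1 <= eta ^+ 2 / 48 * m by rewrite -ler_pdivrMr// div1r.
  rewrite -(ler_pM2r m0) mul1r => H.
  have -> : eta ^+ 2 * m ^+ 2 / 16 = 3 * (eta ^+ 2 / 48 * m * m) by field.
  by rewrite ler_pM2l.
have four : 4 ^+ n.+1 <= expR (2 * m).
  have e1 : 2 <= expR 1 :> R by have := expR_ge1Dx (1 : R); lra.
  have e2 : 4 <= expR 2 :> R.
    have -> : 2 = 1 + 1 :> R by lra.
    by rewrite expRD; nra.
  by rewrite mulrC expRM_natl// ?lerXn2r ?nnegrE ?expR_ge0.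
apply: (@le_trans _ _ (2 * expR (- m))).
  rewrite -mulrA ler_pM2l//.
  apply: (@le_trans _ _ (expR (2 * m) * expR (- (eta ^+ 2 * m ^+ 2 / 16)))).
    by rewrite ler_wpM2r ?expR_ge0.
  by rewrite -expRD ler_expR; lra.
rewrite -ler_pdivlMl// mulrC; apply: le_trans H2.
rewrite expRN lef_pV2 ?posrE ?expR_gt0//.
by apply: le_trans (expR_ge1Dx m); rewrite lerDr.
Qed.

(** The Gibbs inequality is applied to the random graph whose edge probabilities
    are a step approximation of h: with high probability this graph is close to
    h, and its entropy is about - n ^ 2 * I (h). *)
Lemma psi_lower h (e : R) : 0 < e -> exists N, forall n, (N <= n)%N ->
  T (graphon_class h) - graphon_rate h - e <= psi T n.
Proof.
move=> e0; have B0 : 0 <= B by apply: le_trans (TB (graphon_class h)).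
have e50 : 0 < e / 5 by rewrite divr_gt0.
have [t t0 Ht] := continuous_class Tcontinuous h e50.
(* The error e is split into five parts: the variation of T near h, the bad
   graphs, the L1 modulus and the approximation error of the rate, and the
   diagonal. *)
pose eta : R := Num.min (t / 4) 1.
have eta01 : 0 < eta <= 1 by rewrite lt_min ge_min lexx orbT ltr01 divr_gt0.
have eta_t : eta <= t / 4 by rewrite ge_min lexx.
have /andP[eta0 _] := eta01.
pose zeta : R := Num.min (e / 5) 1.
have zeta01 : 0 < zeta <= 1 by rewrite lt_min ge_min lexx orbT ltr01 e50.
have zeta_e : zeta <= e / 5 by rewrite ge_min lexx.
have Mz : 0 < 1 - ln zeta by case/andP: zeta01 => _ /ln_le0; lra.
have th0 : 0 < Num.min (t / 4) (e / 5 / (1 - ln zeta)).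
  by rewrite lt_min !divr_gt0.
have [N1 H1] := step_graphon_dense h th0.
have b0 : 0 < e / 5 / (2 * B + 1) by rewrite divr_gt0// ltr_wpDl// mulr_ge0.
have [N2 H2] := bad_graphs_small eta0 b0.
have [|N3 H3] := @exists_invn_le R (Num.min (t / 4) (e / 5)).
  by rewrite lt_min e50 divr_gt0.
exists (maxn N1 (maxn N2 N3)).+1 => -[//|n]; rewrite ltnS !geq_max.
move=> /andP[/H1[w hw] /andP[/H2 {}H2 /H3 {}H3]] {H1}.
set N := n.+1 in H2 H3 *.
have n0 : 0 < N%:R :> R by rewrite ltr0n.
have n20 : 0 < N%:R ^+ 2 :> R by rewrite exprn_gt0.
move: H3; rewrite le_min => /andP[n1t n1e].
move: hw; rewrite le_min => /andP[hwt hwe].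
pose p := off_diagonal w.
have p_diag i : p i i = 0 by rewrite /p/= eqxx.
pose good (G : sgraph N) := [forall S : {set 'I_N}, forall A : {set 'I_N},
  `|discrepancy p S A G| <= eta * N%:R ^+ 2].
have good_T G : good G -> T (graphon_class h) - e / 5 <= graph_value T G.
  move=> /forallP goodG.
  suff hG : orbit_dist h (graph_graphon G) < t.
    by have := Ht _ hG; rewrite ltr_norml => /andP[_ /ltW]; rewrite lerBlDl -lerBlDr.
  apply: (@le_lt_trans _ _ (t / 4 + (t / 4 + t / 4))); last by lra.
  apply: (le_trans (orbit_dist_triangle (step_graphon w) _ _)); apply: lerD.
    apply: (le_trans (orbit_dist_le_cut_dist _ _)).
    by apply: (le_trans (cut_dist_le_l1 _ _)); exact: hwt.
  apply: (le_trans (orbit_dist_triangle (step_graphon p) _ _)); apply: lerD.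
    apply: (le_trans (orbit_dist_le_cut_dist _ _)).
    by apply: (le_trans (cut_dist_off_diagonal w)); exact: n1t.
  rewrite orbit_dist_sym.
  apply: (le_trans (orbit_dist_triangle (step_graphon (adj_weights G)) _ _)).
  rewrite orbit_dist_graph add0r.
  apply: (le_trans (orbit_dist_le_cut_dist _ _)).
  apply: le_trans eta_t; apply: cut_dist_step => S A.
  by have /forallP := goodG S; apply.
have value_ge G : T (graphon_class h) - e / 5 - 2 * B * (~~ good G)%:R <=
    graph_value T G.
  have [/good_T|_] := boolP (good G); first by rewrite mulr0 subr0.
  rewrite mulr1; have := TB (graphon_class h).
  have := TB (graphon_class (graph_graphon G)); rewrite /graph_value.
  move: (T (graphon_class h)) (T (graphon_class (graph_graphon G))) => a b.
  by rewrite !ler_norml => /andP[? ?] /andP[? ?]; lra.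
have mean_T : T (graphon_class h) - e / 5 - e / 5 <=
    \sum_G graph_prob p G * graph_value T G.
  apply: (@le_trans _ _ (\sum_G graph_prob p G *
      (T (graphon_class h) - e / 5 - 2 * B * (~~ good G)%:R))); last first.
    by apply: ler_sum => G _; rewrite ler_wpM2l ?graph_prob_ge0.
  under eq_bigr do rewrite mulrBr.
  rewrite sumrB -mulr_suml sum_graph_prob mul1r lerD2l lerN2.
  have -> : \sum_G graph_prob p G * (2 * B * (~~ good G)%:R) =
      2 * B * \sum_(G | ~~ good G) graph_prob p G.
    rewrite mulr_sumr [RHS]big_mkcond/=; apply: eq_bigr => G _.
    by case: (good G); rewrite /= ?mulr0// mulr1 mulrC.
  have bad_le : \sum_(G | ~~ good G) graph_prob p G <= e / 5 / (2 * B + 1).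
    exact: le_trans (bad_graphs_prob p_diag eta01) H2.
  apply: (@le_trans _ _ ((2 * B + 1) * (e / 5 / (2 * B + 1)))).
    apply: ler_pM => //; first by rewrite mulr_ge0.
      by apply: sumr_ge0 => G _; exact: graph_prob_ge0.
    by rewrite lerDl.
  by rewrite mulrC divfK// gt_eqF// ltr_wpDl// mulr_ge0.
have rate_le : graphon_rate (step_graphon p) <= graphon_rate h + e / 5 + e / 5 + e / 5.
  apply: (le_trans (graphon_rate_off_diagonal w)).
  apply: lerD; last exact: n1e.
  have := graphon_rate_modulus h (step_graphon w) zeta01.
  have : (1 - ln zeta) * l1_dist h (step_graphon w) <= e / 5.
    by rewrite mulrC -ler_pdivlMr//; exact: hwe.
  move: (graphon_rate (step_graphon w)) (graphon_rate h) => a b.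
  move: ((1 - ln zeta) * _) => c; move: zeta_e; clear.
  by rewrite ler_norml => ? ? /andP[? ?]; lra.
rewrite /psi mulrC ler_pdivlMr//.
apply: le_trans (gibbs_le_lnsum (fun G => N%:R ^+ 2 * graph_value T G)
  (graph_prob_ge0 p) (sum_graph_prob p)).
rewrite sum_graph_prob_ln//.
under eq_bigr do rewrite mulrCA.
rewrite -mulr_sumr -mulrBr mulrC ler_pM2l//.
move: mean_T rate_le; move: (\sum_G _) (graphon_rate (step_graphon p)) => a b.
move: (T _) (graphon_rate h) => c d; clear.
by lra.
Qed.

End lower_bound.

Theorem theorem3p1 (R : realType) (T : qgraphon R -> R)
    (Tbounded : bounded_fun T) (Tcontinuous : continuous T) :
  cvgn (psi T) /\
  limn (psi T) = sup [set T a - rate a | a in [set: qgraphon R]].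
Proof.
have [B TB] : exists B, forall a, `|T a| <= B.
  have [M [_ HM]] := Tbounded; exists (M + 1) => a.
  by apply: HM => //; rewrite ltrDl.
set A := [set _ | _ in _]; set S := sup A.
have A_ub : has_ubound A.
  exists (B + 1) => _ [a _ <-]; apply: lerD.
    by apply: le_trans (ler_norm _) (TB a).
  by rewrite lerNl; have /andP[] := graphon_rate_range (graphon_repr a).
have A0 : A !=set0.
  by eexists; exists (graphon_class zero_graphon).
have S_ub h : T (graphon_class h) - graphon_rate h <= S.
  by rewrite -rate_graphon_class; apply: ub_le_sup => //; exists (graphon_class h).
suff psi_cvg : psi T @ \oo --> S.
  by split; [apply/cvg_ex; exists S|exact/cvg_lim].
apply/cvgrPdist_le => e e0; have e20 : 0 < e / 2 by rewrite divr_gt0.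
have [N1 H1] := psi_upper Tcontinuous S_ub e0.
have [_ [a _ <-] aS] := sup_adherent e20 (conj A0 A_ub).
have [N2 H2] := psi_lower Tcontinuous TB (graphon_repr a) e20.
exists (maxn N1 N2) => // n; rewrite /= geq_max => /andP[/H1 {}H1 /H2 {}H2].
rewrite graphon_reprK -/(rate a) in H2; rewrite -/S in aS.
move: (psi T n) (T a) (rate a) H1 H2 aS => x y z H1 H2 aS.
by rewrite ler_norml; apply/andP; split; lra.
Qed.
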